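(* Let $\alpha>-1$ and let $k\ge1$ be an integer. Let $$R_\alpha^{(k)}(x,y)=\frac{1}{\Gamma(k/2)}\int_0^\infty t^{\frac k2-1}\mathfrak{D}_\alpha^kW_t^\alpha(x,y)\,dt,\qquad R^{(k)}(x,y)=\frac1{\Gamma(k/2)}\int_0^\infty t^{\frac k2-1}\left(\frac{d}{dx}+x\right)^kW_t(x,y)\,dt$$ for $x,y\in(0,\infty)$, $x\neq y$, with the differential operators acting in $x$. Then there is a constant $C>0$, independent of $x$ and $y$, such that: (i) $\displaystyle |R_\alpha^{(k)}(x,y)|\le C\frac{y^{\alpha+\frac12}}{x^{\alpha+\frac32}}$ for $0<y<\frac x2$. (ii) For $y>2x>0$: $\displaystyle |R_\alpha^{(k)}(x,y)|\le C\frac{x^{\alpha+\frac12}}{y^{\alpha+\frac32}}$ if $k$ is even, and $\displaystyle |R_\alpha^{(k)}(x,y)|\le C\frac{x^{\alpha+\frac32}}{y^{\alpha+\frac52}}$ if $k$ is odd. (iii) $\displaystyle \left|R_\alpha^{(k)}(x,y)-R^{(k)}(x,y)\right|\le C\frac1x\left(1+\left(\frac{x}{|x-y|}\right)^{\frac12}\right)$ for $0<\frac x2<y<2x$, $y\ne x$.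
   Context: For $\alpha>-1$, $\mathfrak{D}_\alpha f=\left(-\frac{\alpha+1/2}{x}+x+\frac{d}{dx}\right)f$ on $(0,\infty)$. The Laguerre heat kernel is, for $t,x,y\in(0,\infty)$, $$W_t^\alpha(x,y)=\left(\frac{2e^{-t}}{1-e^{-2t}}\right)^{1/2}\left(\frac{2xye^{-t}}{1-e^{-2t}}\right)^{1/2}I_\alpha\left(\frac{2xye^{-t}}{1-e^{-2t}}\right)e^{-\frac12(x^2+y^2)\frac{1+e^{-2t}}{1-e^{-2t}}},$$ where $I_\alpha$ is the modified Bessel function of the first kind and order $\alpha$. The Hermite heat kernel is, for $t>0$ and $x,y\in\mathbb{R}$, $$W_t(x,y)=\frac1{\sqrt\pi}\left(\frac{e^{-t}}{1-e^{-2t}}\right)^{1/2}e^{-\frac12(x^2+y^2)\frac{1+e^{-2t}}{1-e^{-2t}}+\frac{2xye^{-t}}{1-e^{-2t}}}.$$ *)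

(* Defs.v *)
From mathcomp Require Import all_boot all_order all_algebra.
From mathcomp Require Import all_classical all_reals all_analysis.

Set Implicit Arguments.
Unset Strict Implicit.
Unset Printing Implicit Defensive.

Import Order.TTheory GRing.Theory Num.Theory.
Import numFieldNormedType.Exports.

Local Open Scope classical_set_scope.
Local Open Scope ring_scope.

(* Euler's integral; only meaningful for 0 < s, where it converges. *)
Definition Gamma (R : realType) (s : R) : R :=
  Rintegral lebesgue_measure `]0, +oo[
    (fun t : R => t `^ (s - 1) * expR (- t)).

(* Power series of I_alpha(z) for -1 < alpha and 0 < z; all the arguments of
   Gamma are then positive. *)
Definition besselI (R : realType) (alpha z : R) : R :=
  limn (series (fun m : nat =>
    (z / 2) `^ (alpha + 2 * m%:R) / (m`!%:R * Gamma (alpha + m%:R + 1)))).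

Definition laguerre_kernel (R : realType) (alpha t x y : R) : R :=
  let z := 2 * x * y * expR (- t) / (1 - expR (- (2 * t))) in
  Num.sqrt (2 * expR (- t) / (1 - expR (- (2 * t))))
  * Num.sqrt z * besselI alpha z
  * expR (- (2^-1 * (x ^+ 2 + y ^+ 2)
             * ((1 + expR (- (2 * t))) / (1 - expR (- (2 * t)))))).

Definition hermite_kernel (R : realType) (t x y : R) : R :=
  (Num.sqrt pi)^-1
  * Num.sqrt (expR (- t) / (1 - expR (- (2 * t))))
  * expR (- (2^-1 * (x ^+ 2 + y ^+ 2)
             * ((1 + expR (- (2 * t))) / (1 - expR (- (2 * t)))))
          + 2 * x * y * expR (- t) / (1 - expR (- (2 * t)))).

(* [derive1] is a local notion, so at points of (0, +oo) the values of f
   outside (0, +oo) play no role, also after iteration. *)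
Definition laguerre_D (R : realType) (alpha : R) (f : R -> R) : R -> R :=
  fun x => - ((alpha + 2^-1) / x) * f x + x * f x + derive1 f x.

Definition hermite_D (R : realType) (f : R -> R) : R -> R :=
  fun x => derive1 f x + x * f x.

(* The kernels take values in \bar R: a Lebesgue integral with infinite
   positive or negative part is +oo or -oo, so a finite bound on the absolute
   value (also of a difference of two such kernels) includes the absolute
   convergence of the integrals. *)
Definition laguerre_riesz (R : realType) (alpha : R) (k : nat) (x y : R) :
    \bar R :=
  (((Gamma (k%:R / 2))^-1)%:E *
   \int[lebesgue_measure]_(t in `]0%R, +oo[)
     (t `^ (k%:R / 2 - 1) *
      iter k (laguerre_D alpha)
        (fun x' => laguerre_kernel alpha t x' y) x)%:E)%E.

Definition hermite_riesz (R : realType) (k : nat) (x y : R) : \bar R :=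
  (((Gamma (k%:R / 2))^-1)%:E *
   \int[lebesgue_measure]_(t in `]0%R, +oo[)
     (t `^ (k%:R / 2 - 1) *
      iter k (@hermite_D R) (fun x' => hermite_kernel t x' y) x)%:E)%E.

(* Main.v *)
Require Import Defs.
From mathcomp Require Import all_boot all_order all_algebra.
From mathcomp Require Import all_classical all_reals all_analysis.
From mathcomp Require Import measurable_realfun ring lra zify.
Import Order.TTheory GRing.Theory Num.Theory.
Import numFieldNormedType.Exports.
Set Implicit Arguments.
Unset Strict Implicit.
Unset Printing Implicit Defensive.
Local Open Scope classical_set_scope.
Local Open Scope ring_scope.

(* Write s = sinh t, q = e^-t / s, c = y / s, so that z = c x is the argument of
   the Bessel function.  Two descriptions of D_alpha^k W_t^alpha are used.

   If y < x/2, y > 2x or z is bounded: the kernel is a Gaussian times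
   s^(-1/2) z^(alpha+1/2) times an entire function of z^2, and D_alpha^k turns
   the last factor into a polynomial in x, c^2, q with coefficients that are
   again entire in z^2.  Counting degrees gives the factor s^(-k/2), and for odd
   k an additional factor x.  The exponential growth e^z is absorbed by the
   Gaussian.

   If z is large: W_t^alpha = W_t phi_alpha(z), where phi_alpha(z) is
   sqrt(2 pi z) e^-z I_alpha(z).  One has phi_alpha = 1 + O(1/z): for alpha = 1/2
   and -1/2 explicitly, for alpha between them since the log-convexity of Gamma
   interpolates the Taylor coefficients, and for larger alpha by the recurrence.
   By the Bessel equation (z d/dz)^m phi_alpha is then O(1/z) for every m > 0.
   Hence D_alpha^k W_t^alpha - (d/dx + x)^k W_t has in each term an additional
   factor s / (x y), or x^-1 instead of one factor s^(-1/2).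

   In both cases t^(k/2-1) <= s^(k/2) / t cancels s^(-k/2), and what remains is
   bounded by multiples of v^p / (t (1 + v^p)^2) with v = s / b, whose integral
   is at most 1/p because s <= t s'. *)

(** * Derivatives of real functions and integrals on the half-line *)

(** Poisson's integral for [I_alpha] diverges when [alpha <= -1/2], so the asymptotics come from the
    power series and from a differential equation. With [theta = z d/dz], the function [theta phi]
    solves a first-order linear equation whose homogeneous solutions are multiples of [z e^(-2z)];
    hence boundedness of [phi] already yields decay of all the iterates. Near the diagonal each
    kernel alone may be as large as [1 / |x - y|], so only the difference can be estimated, and only
    where z is large; for bounded z the two kernels are estimated separately. The gain [s / x] uses
    up the last negative power of s, which leaves [dt / t] times a Gaussian in
    [(x - y) / sqrt(sinh t)]. This diverges at 0 without the Gaussian; replacing the Gaussian by a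
    power produces [(x / |x - y|)^(1/2)]. The integrals take extended real values, so the difference
    of two of them is the integral of the difference only once one is known to be finite. This is
    why the Hermite integrand gets a majorant of its own. Uniform constants result from fixing the
    polynomial factors before t, x and y. *)

Section Derivatives.
Context {R : realType}.
Implicit Types (f g : R -> R) (x a d e : R).

Lemma isdC a x : is_derive x (1:R) (fun=> a) 0.
Proof. exact: is_derive_cst. Qed.

Lemma isd_id x : is_derive x (1:R) (fun t => t) 1.
Proof. exact: is_derive_id. Qed.

Lemma isdD f g x d e : is_derive x (1:R) f d -> is_derive x (1:R) g e ->
  is_derive x (1:R) (fun t => f t + g t) (d + e).
Proof. exact: is_deriveD. Qed.

Lemma isdN f x d : is_derive x (1:R) f d ->
  is_derive x (1:R) (fun t => - f t) (- d).
Proof. exact: is_deriveN. Qed.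

Lemma isdM f g x d e : is_derive x (1:R) f d -> is_derive x (1:R) g e ->
  is_derive x (1:R) (fun t => f t * g t) (d * g x + f x * e).
Proof.
move=> df dg; apply: (is_derive_eq (is_deriveM df dg)).
by rewrite /GRing.scale/= addrC [g x * _]mulrC.
Qed.

Lemma isdcomp f g x d e : is_derive x (1:R) f d -> is_derive (f x) (1:R) g e ->
  is_derive x (1:R) (fun t => g (f t)) (e * d).
Proof. by move=> df dg; exact: (is_derive1_comp dg df). Qed.

Lemma isdX f n x d : is_derive x (1:R) f d ->
  is_derive x (1:R) (fun t => f t ^+ n) (n%:R * f x ^+ n.-1 * d).
Proof.
move=> df.
have -> : (fun t => f t ^+ n) = f ^+ n by apply/funext => t; rewrite fctE.
exact: (is_deriveX n df).
Qed.

Lemma isdV f x d : f x != 0 -> is_derive x (1:R) f d ->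
  is_derive x (1:R) (fun t => (f t)^-1) (- d / f x ^+ 2).
Proof.
move=> fx0 df; apply: (is_derive_eq (is_deriveV fx0 df)).
by rewrite /GRing.scale/= mulNr [in RHS]mulNr mulrC.
Qed.

Lemma isdexp f x d : is_derive x (1:R) f d ->
  is_derive x (1:R) (fun t => expR (f t)) (expR (f x) * d).
Proof. by move=> df; exact: (isdcomp (g := expR) df (is_derive_expR _)). Qed.

Lemma isdpow f p x d : 0 < f x -> is_derive x (1:R) f d ->
  is_derive x (1:R) (fun t => f t `^ p) (p * f x `^ (p - 1) * d).
Proof. by move=> f0 df; exact: (isdcomp (g := fun t => t `^ p) df (is_derive1_powR _ f0)). Qed.

Lemma isd_eq f x d e : is_derive x (1:R) f d -> d = e -> is_derive x (1:R) f e.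
Proof. by move=> ? <-. Qed.

Lemma isd_cont f x d : is_derive x (1:R) f d -> {for x, continuous f}.
Proof.
by move=> [df _]; apply: differentiable_continuous; exact/derivable1_diffP.
Qed.

Lemma isd_eq0y f g x d : 0 < x -> (forall t, 0 < t -> f t = g t) ->
  is_derive x (1:R) f d -> is_derive x (1:R) g d.
Proof.
move=> x0 fg; apply: (near_eq_is_derive (f := f)).
near=> t; apply: fg; near: t; exact: lt_nbhsr.
Unshelve. all: by end_near. Qed.

Lemma isd_derive1 f x d : is_derive x (1:R) f d -> derive1 f x = d.
Proof. by move=> df; rewrite derive1E derive_val. Qed.

End Derivatives.

(** Differentiation directed by syntax; the derivative is left as an existential variable and side
    conditions remain as goals. The cases with a bare operator, such as [@GRing.opp _], catch
    functions that appear eta-reduced. Composition with an arbitrary function is refused when the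
    inner function is the identity, since it would otherwise apply forever. *)
Ltac isd_step := match goal with
 | |- is_derive _ _ (fun _ => ?a) _ => exact: isdC
 | |- is_derive _ _ (@GRing.inv _) _ => eapply (isdV (f := fun t => t))
 | |- is_derive _ _ (@GRing.mul _ ?a) _ => eapply (isdM (f := fun=> a) (g := fun t => t))
 | |- is_derive _ _ (@GRing.opp _) _ => eapply (isdN (f := fun t => t))
 | |- is_derive _ _ (@expR _) _ => eapply (isdexp (f := fun t => t))
 | |- is_derive _ _ (fun t => t) _ => exact: isd_id
 | |- is_derive _ _ (fun t => _ + _) _ => eapply isdD
 | |- is_derive _ _ (fun t => - _) _ => eapply isdN
 | |- is_derive _ _ (fun t => _ * _) _ => eapply isdM
 | |- is_derive _ _ (fun t => _ ^+ _) _ => eapply isdX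
 | |- is_derive _ _ (fun t => expR _) _ => eapply isdexp
 | |- is_derive _ _ (fun t => _ `^ _) _ => eapply isdpow
 | |- is_derive _ _ (fun t => _^-1) _ => eapply isdV
 | |- is_derive _ _ (fun t => ?f (@?g t)) _ => lazymatch g with (fun t => t) => fail | _ => eapply (@isdcomp _ g f) end
 end.
Ltac isd := repeat isd_step.

Ltac nneg := lazymatch goal with
  | |- is_true (0 <= _ * _) => apply: mulr_ge0; nneg
  | |- is_true (0 <= _ ^+ _) => apply: exprn_ge0; nneg
  | |- is_true (0 <= _^-1) => rewrite invr_ge0; nneg
  | |- is_true (0 <= _ + _) => apply: addr_ge0; nneg
  | |- is_true (0 <= expR _) => exact: expR_ge0
  | |- is_true (0 <= _ `^ _) => exact: powR_ge0
  | |- is_true (0 <= Num.sqrt _) => exact: sqrtr_ge0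
  | |- is_true (0 <= `| _ |) => exact: normr_ge0
  | |- _ => first [assumption | (apply: ltW; assumption) | done]
  end.
Ltac posi := lazymatch goal with
  | |- is_true (0 < _ * _) => apply: mulr_gt0; posi
  | |- is_true (0 < _ ^+ _) => apply: exprn_gt0; posi
  | |- is_true (0 < _^-1) => rewrite invr_gt0; posi
  | |- is_true (0 < _ + _) => apply: addr_gt0; posi
  | |- is_true (0 < expR _) => exact: expR_gt0
  | |- is_true (0 < _ `^ _) => apply: powR_gt0; posi
  | |- is_true (0 < Num.sqrt _) => rewrite sqrtr_gt0; posi
  | |- is_true (0 < pi) => exact: pi_gt0
  | |- _ => first [assumption | done]
  end.

(** * Integration by antiderivatives on the open half-line *)

Section FTC.
Context {R : realType}.
Notation mu := (@lebesgue_measure R).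

Lemma continuous_measurable0y (f : R -> R) :
  (forall x : R, 0 < x -> {for x, continuous f}) ->
  measurable_fun `](0:R), +oo[ f.
Proof.
move=> cf; apply: open_continuous_measurable_fun => //.
by move=> x; rewrite inE/= in_itv/= andbT => /cf.
Qed.

(** Monotone convergence along closed half-lines that stay away from a possible singularity at 0. *)
Lemma integral0y_cvg (f : R -> \bar R) (a : R^nat) :
  measurable_fun `](0:R), +oo[ f ->
  (forall x : R, (0 < x)%R -> (0 <= f x)%E) ->
  nonincreasing_seq a -> (forall n, 0 < a n) -> a @ \oo --> (0:R) ->
  (\int[mu]_(x in `[a n, +oo[) f x)%E @[n --> \oo] -->
    (\int[mu]_(x in `]0%R, +oo[) f x)%E.
Proof.
move=> mf f0 nia a0 cva.
have sub n : `[a n, +oo[ `<=` `](0:R), +oo[.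
  by move=> x/=; rewrite !in_itv/= !andbT; apply: lt_le_trans.
have E : `](0:R), +oo[%classic = \bigcup_k `[a k, +oo[%classic.
  apply/seteqP; split=> x; last by move=> [n _] /sub.
  rewrite /= in_itv/= andbT => x0.
  have /cvgrPdist_lt/(_ _ x0)[N _ /(_ N (leqnn N))] := cva.
  rewrite /= sub0r normrN gtr0_norm// => aN.
  by exists N => //=; rewrite in_itv/= andbT ltW.
rewrite E.
apply: ge0_nondecreasing_set_cvg_integral => //.
- move=> n m nm; rewrite subsetEset => x/=.
  by rewrite !in_itv/= !andbT; apply: le_trans; exact: nia.
- by move=> n; apply: measurable_funS mf.
- by move=> n x /sub/=; rewrite in_itv/= andbT => /f0.
Qed.

Lemma nonincreasing_harmonic : nonincreasing_seq (@harmonic R).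
Proof.
by apply/nonincreasing_seqP => n; rewrite /= lef_pV2 ?posrE// ler_nat.
Qed.

(** Neither [f] nor [F] need be regular at 0: the formula holds on [[1/(n+1), +oo[], and the left
    end then tends to 0. *)
Lemma ge0_FTC0y (f F : R -> R) (l0 l : R) :
  (forall x : R, 0 < x -> 0 <= f x) ->
  (forall x : R, 0 < x -> {for x, continuous f}) ->
  (forall x : R, 0 < x -> is_derive x (1:R) F (f x)) ->
  F x @[x --> 0^'+] --> l0 -> F x @[x --> +oo] --> l ->
  (\int[mu]_(x in `]0%R, +oo[) (f x)%:E)%E = (l - l0)%:E.
Proof.
move=> f0 cf dF F0 Fy.
have mf : measurable_fun `](0:R), +oo[ (EFin \o f).
  by apply/measurable_EFinP; exact: continuous_measurable0y.
have/cvg_lim <- // := integral0y_cvg mf (fun x x0 => f0 x x0)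
  nonincreasing_harmonic harmonic_gt0 cvg_harmonic.
have n0 n : 0 < harmonic n :> R by exact: harmonic_gt0.
apply/cvg_lim => //.
have -> : (fun n => \int[mu]_(x in `[harmonic n, +oo[) (EFin \o f) x)%E
   = (fun n => (l - F (harmonic n))%:E).
  apply/funext => n; rewrite (ge0_continuous_FTC2y (F := F) (l := l)) //.
  - by move=> x nx; apply: f0; apply: lt_le_trans nx.
  - apply/continuous_within_itvcyP; split.
      by move=> x; rewrite in_itv/= andbT => nx; apply: cf; exact: lt_trans nx.
    exact/cvg_at_right_filter/cf.
  - by move=> x nx; have [] := dF x (lt_trans (n0 n) nx).
  - by apply/cvg_at_right_filter/(isd_cont (dF _ _)).
  - move=> x; rewrite in_itv/= andbT => nx.
    by rewrite (isd_derive1 (dF x (lt_trans (n0 n) nx))).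
apply: cvg_EFin; first by near=> n.
apply: cvgB; first exact: cvg_cst.
move/cvg_at_rightP : F0; apply; split => //.
exact: cvg_harmonic.
Unshelve. all: by end_near. Qed.

End FTC.

(** * Elementary bounds for powers, exponentials and logarithms *)

Section PowExp.
Context {R : realType}.

Lemma powR_expR_ln (x s : R) : 0 < x -> x `^ s = expR (s * ln x).
Proof. by move=> x0; rewrite /powR gt_eqF. Qed.

Lemma ln_leB1 (u : R) : 0 < u -> ln u <= u - 1.
Proof. by move=> u0; rewrite lerBrDl -[leRHS](lnK u0) expR_ge1Dx. Qed.

(* The maximum of [s ln t - e t] is at [t = s / e]. *)
Lemma powR_le_expR (s e : R) : 0 <= s -> 0 < e ->
  exists2 C : R, 0 < C & forall t, 0 < t -> t `^ s <= C * expR (e * t).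
Proof.
rewrite le_eqVlt => /predU1P[<- e0|s0 e0].
  exists 1 => // t t0; rewrite powRr0 mul1r -expR0 ler_expR.
  by rewrite mulr_ge0// ltW.
exists (expR (s * ln (s / e) - s)); first exact: expR_gt0.
move=> t t0; rewrite powR_expR_ln// -expRD ler_expR.
have se0 : 0 < s / e by rewrite divr_gt0.
have h : ln t - ln (s / e) <= t / (s / e) - 1.
  by have := ln_leB1 (divr_gt0 t0 se0); rewrite [in X in X -> _]ln_div.
have h1 : s * (t / (s / e)) = e * t by field; rewrite !gt_eqF.
rewrite -subr_ge0 in h; have := mulr_ge0 (ltW s0) h.
rewrite mulrBr mulrBr h1 => {}h; lra.
Qed.

(** Concavity of [v^d], with its tangent at 1. Let [a] be the mean of v and 1 with weights d and 1 -
    d; in the bounds [ln u <= u - 1] at [v / a] and [1 / a], the weighted right-hand sides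
    cancel. *)
Lemma powR_le_tangent (d v : R) : 0 <= d <= 1 -> 0 < v ->
  v `^ d <= 1 - d + d * v.
Proof.
move=> /andP[d0 d1] v0; set a := 1 - d + d * v.
have a0 : 0 < a by rewrite /a; nra.
rewrite powR_expR_ln// -(lnK a0) ler_expR.
have h1 := ln_leB1 (divr_gt0 v0 a0).
have h2 := ln_leB1 (divr_gt0 (ltr01) a0).
rewrite !ln_div ?posrE// ln1 sub0r in h1 h2.
have e : d * (v / a - 1) + (1 - d) * (1 / a - 1) = 0.
  by rewrite /a; field; rewrite gt_eqF.
by nra.
Qed.

End PowExp.

(** * The Gamma function *)

Section GammaIntegral.
Context {R : realType}.
Notation mu := (@lebesgue_measure R).
Implicit Types s t : R.

Lemma cvgy_expRN (c : R) : 0 < c -> expR (- (c * t)) @[t --> +oo] --> (0:R).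
Proof.
move=> c0; apply: (cvg_comp (fun t => c * t) (fun t => expR (- t)) _ (@cvgr_expR R)).
exact: gt0_cvgMry.
Qed.

Definition gamma_fun s t : R := t `^ (s - 1) * expR (- t).

Lemma gamma_fun_ge0 s t : 0 <= gamma_fun s t.
Proof. by rewrite mulr_ge0 ?powR_ge0 ?expR_ge0. Qed.

Lemma continuous_gamma_fun s t : 0 < t -> {for t, continuous (gamma_fun s)}.
Proof. by move=> t0; apply: isd_cont; rewrite /gamma_fun; isd; exact: t0. Qed.

Lemma measurable_gamma_fun s : measurable_fun `](0:R), +oo[ (gamma_fun s).
Proof. by apply: continuous_measurable0y => t; exact: continuous_gamma_fun. Qed.

(* The derivative of [t^s e^-t] changes sign; adding a multiple of [-e^(-t/2)]
   makes it nonnegative, and the two contributions of this term cancel. *)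
Lemma integral_gamma_funS s : 0 < s ->
  (\int[mu]_(t in `]0%R, +oo[) (gamma_fun (s + 1) t)%:E < +oo /\
  \int[mu]_(t in `]0%R, +oo[) (gamma_fun (s + 1) t)%:E =
  s%:E * \int[mu]_(t in `]0%R, +oo[) (gamma_fun s t)%:E)%E.
Proof.
move=> s0.
have [K K0 hK] := @powR_le_expR R s 2^-1 (ltW s0) ltac:(lra).
pose M' t := K * expR (- (t / 2)).
pose M t := - (2 * K) * expR (- (t / 2)).
have dM t : is_derive t (1:R) M (M' t).
  eapply isd_eq; first by rewrite /M; isd.
  by rewrite /M' /=; field.
have cM' t : {for t, continuous M'} by apply: isd_cont; rewrite /M'; isd.
have M'0 t : 0 <= M' t by rewrite mulr_ge0 ?expR_ge0// ltW.
pose F t := t `^ s * expR (- t).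
have dF t : 0 < t -> is_derive t (1:R) F (s * gamma_fun s t - gamma_fun (s + 1) t).
  move=> t0; eapply isd_eq; first by rewrite /F; isd; exact: t0.
  by rewrite /gamma_fun addrK/= /id; ring.
have FM t : 0 < t -> gamma_fun (s + 1) t <= M' t.
  move=> t0; rewrite /gamma_fun addrK /M'.
  have -> : - (t / 2) = 2^-1 * t - t by field.
  rewrite expRD mulrA ler_wpM2r ?expR_ge0//; exact: hK.
have eM : M t @[t --> +oo] --> (0:R).
  rewrite -(mulr0 (- (2 * K))); apply: cvgM; first exact: cvg_cst.
  have -> : (fun t => expR (- (t / 2))) = (fun t => expR (- (2^-1 * t))).
    by apply/funext => t; rewrite mulrC.
  by apply: cvgy_expRN.
have eF : F t @[t --> +oo] --> (0:R).
  apply: (@squeeze_cvgr _ _ _ _ (fun=> 0) (fun t => - 2^-1 * M t)).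
  - near=> t; have t0 : 0 < t by [].
    rewrite mulr_ge0 ?powR_ge0 ?expR_ge0//=.
    have := FM t t0; rewrite /F /M /M' /gamma_fun addrK => h.
    by apply: (le_trans h); rewrite le_eqVlt; apply/orP; left; apply/eqP; field.
  - exact: cvg_cst.
  - by rewrite -(mulr0 (- 2^-1)); apply: cvgM eM; exact: cvg_cst.
have M00 : M t @[t --> 0^'+] --> - (2 * K).
  have -> : - (2 * K) = M 0 by rewrite /M mul0r oppr0 expR0 mulr1.
  exact/cvg_at_right_filter/(isd_cont (dM _)).
have F00 : F t @[t --> 0^'+] --> (0:R).
  rewrite -[X in _ --> X](mul0r (expR (- 0))); apply: cvgM; first exact: powR_cvg0.
  by apply: cvg_at_right_filter; apply: (isd_cont (f := fun t => expR (- t)) (d := expR (- 0) * - 1)); isd.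
have mg := measurable_gamma_fun.
have mM' : measurable_fun `](0:R), +oo[ M'.
  by apply: continuous_measurable0y => t _.
pose D t := M' t - gamma_fun (s + 1) t.
have mD : measurable_fun `](0:R), +oo[ D by exact: measurable_funB.
have D0 t : 0 < t -> 0 <= D t by move=> t0; rewrite subr_ge0 FM.
have E1 : (\int[mu]_(t in `]0%R, +oo[) (M' t)%:E = (2 * K)%:E)%E.
  rewrite (ge0_FTC0y (F := M) (l0 := - (2 * K)) (l := 0))//; last first.
  by rewrite sub0r opprK.
have E2 : (\int[mu]_(t in `]0%R, +oo[) (s * gamma_fun s t + D t)%:E = (2 * K)%:E)%E.
  have -> : 2 * K = (0 + 0) - (0 - 2 * K) :> R by ring.
  refine (ge0_FTC0y (f := fun t => s * gamma_fun s t + D t) (F := F \+ M) _ _ _ _ _).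
  - by move=> t t0; rewrite addr_ge0 ?D0// mulr_ge0 ?gamma_fun_ge0 ?ltW.
  - by move=> t t0; apply: isd_cont; rewrite /D /M' /gamma_fun; isd; exact: t0.
  - by move=> t t0; apply: (isd_eq (isdD (dF t t0) (dM t))); rewrite /D; ring.
  - exact: cvgD.
  - exact: cvgD.
have pos t : `](0:R), +oo[%classic t -> 0 < t by rewrite /= in_itv/= andbT.
have mE f : measurable_fun `](0:R), +oo[ f ->
  measurable_fun `](0:R), +oo[ (fun t : R => (f t)%:E).
  by move/measurable_EFinP.
have E1' : (\int[mu]_(t in `]0%R, +oo[) (gamma_fun (s + 1) t)%:E +
  \int[mu]_(t in `]0%R, +oo[) (D t)%:E = (2 * K)%:E)%E.
  rewrite -ge0_integralD//.
  - by rewrite -E1; apply: eq_integral => t _; rewrite -EFinD /D addrC subrK.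
  - by move=> t _; rewrite lee_fin gamma_fun_ge0.
  - exact: mE.
  - by move=> t /pos t0; rewrite lee_fin D0.
  - exact: mE.
have E2' : (s%:E * \int[mu]_(t in `]0%R, +oo[) (gamma_fun s t)%:E +
  \int[mu]_(t in `]0%R, +oo[) (D t)%:E = (2 * K)%:E)%E.
  rewrite -ge0_integralZl//; last 3 first.
  - exact: mE.
  - by move=> t _; rewrite lee_fin gamma_fun_ge0.
  - by rewrite lee_fin ltW.
  rewrite -ge0_integralD//.
  - by move=> t _; rewrite -EFinM lee_fin mulr_ge0 ?gamma_fun_ge0// ltW.
  - by apply/measurable_EFinP; apply: measurable_funM => //; exact: mg.
  - by move=> t /pos t0; rewrite lee_fin D0.
  - exact: mE.
have D00 : (0 <= \int[mu]_(t in `]0%R, +oo[) (D t)%:E)%E.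
  by apply: integral_ge0 => t /pos t0; rewrite lee_fin D0.
have G0 r : (0 <= \int[mu]_(t in `]0%R, +oo[) (gamma_fun r t)%:E)%E.
  by apply: integral_ge0 => t _; rewrite lee_fin gamma_fun_ge0.
(* All summands are nonnegative and both totals are [2 * K], so each summand is finite and the
   identities may be subtracted. *)
move: D00 E1' E2' (G0 s) (G0 (s + 1)).
case: (\int[mu]_(t in _) (D t)%:E)%E => [d||]; rewrite ?leeNy_eq//.
  case: (\int[mu]_(t in _) (gamma_fun (s + 1) t)%:E)%E => [a||]//.
  case: (\int[mu]_(t in _) (gamma_fun s t)%:E)%E => [b||]//.
  + move=> _ [] e1 [] e2 _ _; split; first exact: ltry.
    by rewrite -EFinM; congr EFin; lra.
  + by rewrite gt0_muley ?lte_fin.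
by rewrite addey// -ltNye (lt_le_trans _ (G0 _)).
Unshelve. all: by end_near. Qed.
End GammaIntegral.

Section Gamma.
Context {R : realType}.
Notation mu := (@lebesgue_measure R).
Implicit Types s t : R.

Lemma itv0yP t : `](0:R), +oo[%classic t -> 0 < t.
Proof. by rewrite /= in_itv/= andbT. Qed.

(** Finiteness at [s] is deduced from finiteness at [s + 1]: the factor [s > 0] cannot turn an
    infinite integral into a finite one. *)
Lemma integrable_gamma_fun s : 0 < s ->
  mu.-integrable `](0:R), +oo[ (EFin \o gamma_fun s).
Proof.
move=> s0; apply/integrableP; split.
  by apply/measurable_EFinP; exact: measurable_gamma_fun.
have [fin e] := integral_gamma_funS s0.
under eq_integral do rewrite /= ger0_norm ?gamma_fun_ge0//.
move: fin; rewrite e/=.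
by case: (\int[mu]_(t in _) _)%E => [r _| |_]; rewrite ?ltry ?ltNyr// gt0_muley// lte_fin.
Qed.

Lemma GammaS s : 0 < s -> Gamma (s + 1) = s * Gamma s.
Proof.
move=> s0; have [_ e] := integral_gamma_funS s0.
rewrite /Gamma /Rintegral -[X in fine X = _]/(\int[mu]_(t in `]0%R, +oo[) (gamma_fun (s + 1) t)%:E)%E e.
rewrite fineM//.
exact: (integrable_fin_num _ (integrable_gamma_fun s0)).
Qed.

Lemma Gamma_gt0 s : 0 < s -> 0 < Gamma s.
Proof.
move=> s0; have If := integrable_gamma_fun s0.
(* A lower bound of the integrand on [[1, 2]]; the minimum covers both signs of [s - 1]. *)
pose c := Num.min 1 (2 `^ (s - 1)) * expR (- 2).
have c0 : 0 < c by rewrite mulr_gt0 ?expR_gt0// lt_min ltr01 powR_gt0.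
suff: (c%:E <= \int[mu]_(t in `]0%R, +oo[) (gamma_fun s t)%:E)%E.
  move=> h; apply: lt_le_trans c0 _; rewrite -lee_fin fineK//.
  exact: (integrable_fin_num _ If).
have sub : `[(1:R), 2] `<=` `](0:R), +oo[.
  by move=> t/=; rewrite !in_itv/= andbT => /andP[+ _]; apply: lt_le_trans.
apply: (@le_trans _ _ (\int[mu]_(t in `[(1%R:R), 2%R]) (gamma_fun s t)%:E)%E); last first.
  apply: ge0_subset_integral => //.
    by apply/measurable_EFinP; exact: measurable_gamma_fun.
  by move=> t _; rewrite lee_fin gamma_fun_ge0.
apply: (@le_trans _ _ (\int[mu]_(t in `[(1%R:R), 2%R]) (cst c%:E t))%E).
  rewrite integral_cst//= lebesgue_measure_itv/= lte_fin ltr1n.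
  by rewrite -EFinB -EFinM lee_fin -[leLHS]mulr1 ler_pM2l// lerBrDl; lra.
apply: ge0_le_integral => //.
- by move=> t _; rewrite lee_fin ltW.
- apply/measurable_EFinP; apply: measurable_funS (measurable_gamma_fun s) => //.
move=> t /=; rewrite in_itv/= => /andP[t1 t2]; rewrite lee_fin /c /gamma_fun.
have t0 : 0 < t by lra.
apply: ler_pM; rewrite ?expR_ge0 ?ler_expR ?lerN2//.
rewrite ge_min; case: (lerP 1 s) => s1; apply/orP.
  by left; have := ler_powR t1 (_ : 0 <= s - 1); rewrite powRr0 => -> //; rewrite subr_ge0.
right; rewrite -[s - 1]opprK (powRN 2 (- _)) (powRN t (- _)) lef_pV2 ?posrE ?powR_gt0//.
have s1' : 0 <= - (s - 1) by lra.
by apply: (ge0_ler_powR s1'); rewrite ?nnegrE ?(ltW t0).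
Qed.

(** Wendel's form of log-convexity. In the integrand [t^d] is replaced by its tangent at [t = s]; by
    [Gamma (s + 1) = s * Gamma s] the integral of the tangent is exactly the right-hand side. *)
Lemma Gamma_le_powR s d : 0 < s -> 0 <= d <= 1 ->
  Gamma (s + d) <= s `^ d * Gamma s.
Proof.
move=> s0 d01; have /andP[d0 d1] := d01.
have i1 := integrable_gamma_fun s0.
have i2 := integrable_gamma_fun (addr_gt0 s0 ltr01).
have i3 : mu.-integrable `](0:R), +oo[
    (EFin \o (fun t => s `^ d * (1 - d) * gamma_fun s t)).
  by apply: eq_integrable (integrableZl _ (s `^ d * (1 - d)) i1).
have i4 : mu.-integrable `](0:R), +oo[
    (EFin \o (fun t => s `^ d * d / s * gamma_fun (s + 1) t)).
  by apply: eq_integrable (integrableZl _ (s `^ d * d / s) i2).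
have -> : s `^ d * Gamma s = \int[mu]_(t in `](0:R), +oo[)
    (s `^ d * (1 - d) * gamma_fun s t + s `^ d * d / s * gamma_fun (s + 1) t).
  rewrite RintegralD// !RintegralZl//.
  rewrite -[\int[mu]_(t in _) gamma_fun (s + 1) t]/(Gamma (s + 1)) GammaS//.
  rewrite -[\int[mu]_(t in _) gamma_fun s t]/(Gamma s).
  by field; rewrite gt_eqF.
rewrite /Gamma; apply: le_Rintegral => //.
- by apply: integrable_gamma_fun; rewrite ltr_wpDr.
- by apply: eq_integrable (integrableD _ i3 i4).
move=> t /itv0yP t0; rewrite /gamma_fun addrK.
have -> : s + d - 1 = (s - 1) + d by ring.
rewrite powRD ?(gt_eqF t0) ?implybT//.
have e1 : t `^ s = t `^ (s - 1) * t.
  by rewrite -{3}(powRr1 (ltW t0)) -powRD ?subrK// (gt_eqF t0) implybT.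
have h2 : t `^ d <= s `^ d * (1 - d + d * (t / s)).
  have -> : t `^ d = s `^ d * (t / s) `^ d.
    by rewrite -powRM ?divr_ge0 ?ltW// mulrC divfK// gt_eqF.
  by rewrite ler_pM2l ?powR_gt0// powR_le_tangent// divr_gt0.
have p0 := powR_ge0 t (s - 1); have q0 := expR_ge0 (- t).
rewrite e1.
have -> : s `^ d * (1 - d) * (t `^ (s - 1) * expR (- t)) +
  s `^ d * d / s * (t `^ (s - 1) * t * expR (- t)) =
  t `^ (s - 1) * (s `^ d * (1 - d + d * (t / s))) * expR (- t).
  by field; rewrite gt_eqF.
by rewrite ler_wpM2r// ler_wpM2l.
Qed.

End Gamma.

(** * The value of Gamma at 1/2 *)

Section GammaHalf.
Context {R : realType}.
Notation mu := (@lebesgue_measure R).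

Lemma cvgy_powR (p : R) : 0 < p -> x `^ p @[x --> +oo] --> +oo.
Proof.
move=> p0; apply/cvgryPge => A; near=> x.
have x0 : 0 < x by [].
have [A0|A0] := lerP A 0; first exact: le_trans A0 (powR_ge0 _ _).
have xA : A `^ p^-1 <= x by near: x; apply: nbhs_pinfty_ge; exact: num_real.
rewrite -(powRr1 (ltW A0)) -(mulVf (lt0r_neq0 p0)) powRrM.
by apply: (ge0_ler_powR (ltW p0)); rewrite ?nnegrE ?powR_ge0 ?(ltW x0).
Unshelve. all: by end_near. Qed.

(** Substituting [x = t^(1/2)] gives twice the Gaussian integral over the half-line. The
    substitution takes place away from 0, where the square root is smooth; the ends [b n] are
    squares so that their images are again a standard null sequence. The value normalizes the Bessel
    series of orders 1/2 and -1/2. *)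
Lemma Gamma_half : Gamma (2^-1 : R) = Num.sqrt pi.
Proof.
pose G (x : R) := 2 * gauss_fun x.
have cG : continuous G.
  by move=> x; apply: cvgM; [exact: cvg_cst|exact: continuous_gauss_fun].
pose F (x : R) := x `^ 2^-1.
have dF (t : R) : 0 < t -> is_derive t (1:R) F (2^-1 * t `^ (2^-1 - 1)).
  by move=> t0; apply: isd_eq; [rewrite /F; isd; exact: t0|rewrite mulr1].
have dF1 (t : R) : 0 < t -> derive1 F t = 2^-1 * t `^ (2^-1 - 1).
  by move=> /dF; exact: isd_derive1.
have cdF (t : R) : 0 < t -> {for t, continuous (derive1 F)}.
  move=> t0; apply: isd_cont.
  apply: (isd_eq0y (f := fun t => 2^-1 * t `^ (2^-1 - 1)) t0).
    by move=> u u0; rewrite dF1.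
  by isd; exact: t0.
pose b n : R := harmonic n ^+ 2.
have b0 n : 0 < b n by rewrite exprn_gt0// harmonic_gt0.
have Fb n : F (b n) = harmonic n.
  by rewrite /F powR12_sqrt ?sqrtr_sqr ?ger0_norm// ?harmonic_ge0// ltW.
have E n : (\int[mu]_(x in `[b n, +oo[) (gamma_fun 2^-1 x)%:E =
    \int[mu]_(x in `[harmonic n, +oo[) (G x)%:E)%E.
  rewrite -Fb [RHS](@increasing_ge0_integration_by_substitutiony R F G (b n))//.
  - apply: eq_integral => t; rewrite inE/= in_itv/= andbT => bt.
    have t0 : 0 < t := lt_le_trans (b0 n) bt.
    have -> : ((G \o F) * derive1 F) t = G (F t) * derive1 F t by [].
    rewrite dF1// /G /gauss_fun /F powR12_sqrt ?sqr_sqrtr ?ltW// /gamma_fun.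
    by congr (_%:E); field.
  - move=> x y; rewrite !in_itv/= !andbT => bx _ xy.
    have x0 : 0 < x := lt_le_trans (b0 n) bx.
    by apply: gt0_ltr_powR; rewrite ?nnegrE ?ltW// (lt_trans x0).
  - move=> t; rewrite in_itv/= andbT => bt.
    exact/cdF/(lt_trans (b0 n) bt).
  - exact/cvgP/cvg_at_right_filter/cdF.
  - apply/cvg_ex; exists 0.
    have h : (2^-1 * (t `^ 2^-1)^-1) @[t --> +oo] --> (0 : R).
      rewrite -(mulr0 2^-1); apply: cvgM; first exact: cvg_cst.
      apply/gtr0_cvgV0; last exact: cvgy_powR.
      by near=> t; rewrite powR_gt0.
    apply: cvg_trans h; apply: near_eq_cvg; near=> t.
    have t0 : 0 < t by [].
    rewrite dF1//; congr (_ * _).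
    by rewrite -powRN; congr (_ `^ _); field.
  - split.
      by move=> t; rewrite in_itv/= andbT => bt; have [] := dF t (lt_trans (b0 n) bt).
    exact/cvg_at_right_filter/(isd_cont (dF _ _)).
  - exact: cvgy_powR.
  - by apply: continuous_subspaceT.
  - by move=> x _; rewrite mulr_ge0// gauss_fun_ge0.
have c1 : (\int[mu]_(x in `[b n, +oo[) (gamma_fun 2^-1 x)%:E)%E @[n --> \oo] -->
    (\int[mu]_(x in `]0%R, +oo[) (gamma_fun 2^-1 x)%:E)%E.
  apply: integral0y_cvg => //.
  - apply/measurable_EFinP; exact: measurable_gamma_fun.
  - by move=> x _; rewrite lee_fin gamma_fun_ge0.
  - move=> m n mn; rewrite /b lerXn2r ?nnegrE ?harmonic_ge0//.
    exact: nonincreasing_harmonic.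
  - have -> : b = (@harmonic R \* @harmonic R) by apply/funext => n; rewrite /b expr2.
    rewrite -[X in _ --> X](mulr0 (0 : R)).
    exact: (cvgM (@cvg_harmonic R) (@cvg_harmonic R)).
have mG2 : measurable_fun `](0:R), +oo[ (fun x : R => (gauss_fun x)%:E).
  by apply/measurable_EFinP; apply: measurable_funTS; exact: measurable_gauss_fun.
have c2 : (\int[mu]_(x in `[harmonic n, +oo[) (G x)%:E)%E @[n --> \oo] -->
    (\int[mu]_(x in `]0%R, +oo[) (G x)%:E)%E.
  apply: integral0y_cvg => //.
  - by apply/measurable_EFinP; apply: continuous_measurable0y => t _; exact: cG.
  - by move=> x _; rewrite lee_fin mulr_ge0 ?gauss_fun_ge0.
  - exact: nonincreasing_harmonic.
  - exact: harmonic_gt0.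
  - exact: cvg_harmonic.
have e : (\int[mu]_(x in `]0%R, +oo[) (gamma_fun 2^-1 x)%:E =
  \int[mu]_(x in `]0%R, +oo[) (G x)%:E)%E.
  have En := funext E.
  rewrite En in c1.
  exact: (cvg_unique (@ereal_hausdorff R) c1 c2).
rewrite /Gamma /Rintegral.
rewrite -[X in fine X]/(\int[mu]_(x in `]0%R, +oo[) (gamma_fun 2^-1 x)%:E)%E e.
under eq_integral do rewrite /G EFinM.
rewrite ge0_integralZl//; last by move=> x _; rewrite lee_fin gauss_fun_ge0.
rewrite integral_itv_obnd_cbnd// integral0y_gauss/=.
by field.
Unshelve. all: by end_near. Qed.

End GammaHalf.

Opaque Gamma.

(** * Bessel functions and their asymptotics *)

Section BesselSeries.
Context {R : realType}.
Implicit Types (nu w s : R) (m : nat).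

Definition bessel_coef nu m : R := (m`!%:R * Gamma (nu + m%:R + 1))^-1.

(* [besselI nu z = (z / 2) `^ nu * bessel_fun nu ((z / 2) ^+ 2)] *)
Definition bessel_fun nu w : R := limn (pseries (bessel_coef nu) w).

Lemma gt_shift nu m : -1 < nu -> 0 < nu + m%:R + 1.
Proof. by move=> nu1; have := ler0n R m; lra. Qed.

Lemma bessel_coef_gt0 nu m : -1 < nu -> 0 < bessel_coef nu m.
Proof.
by move=> nu1; rewrite invr_gt0 mulr_gt0 ?Gamma_gt0 ?gt_shift// ltr0n fact_gt0.
Qed.

Lemma bessel_coefS nu m : -1 < nu ->
  bessel_coef nu m = (nu + 1 + m%:R) * bessel_coef (nu + 1) m.
Proof.
move=> nu1; have h := gt_shift m nu1; rewrite /bessel_coef.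
have -> : nu + 1 + m%:R + 1 = (nu + m%:R + 1) + 1 by ring.
rewrite (GammaS h); field.
have := Gamma_gt0 h => /lt0r_neq0 ->.
by rewrite pnatr_eq0 -lt0n fact_gt0 -[_ + m%:R + _]addrAC !gt_eqF//; lra.
Qed.

(** The reason for the variable [w = (z / 2)^2]: differentiation becomes a pure shift of the
    order. *)
Lemma bessel_coef_diffs nu : -1 < nu ->
  pseries_diffs (bessel_coef nu) = bessel_coef (nu + 1).
Proof.
move=> nu1; apply/funext => m; rewrite /pseries_diffs /bessel_coef.
have -> : nu + m.+1%:R + 1 = nu + 1 + m%:R + 1 by rewrite -natr1; ring.
have /Gamma_gt0/lt0r_neq0 h : 0 < nu + 1 + m%:R + 1.
  by have := ler0n R m; lra.
rewrite factS natrM; field.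
by rewrite h !pnatr_eq0 -lt0n fact_gt0 -[1]/(1%:R) -natrD pnatr_eq0.
Qed.

(** Only the first recurrence factor of Gamma, [nu + 1], can be below 1, so the values increase from
    the second one on and the first two bound all of them from below. This compares the series with
    the exponential series. *)
Lemma bessel_coef_le nu : -1 < nu ->
  exists2 C : R, 0 <= C & forall m, bessel_coef nu m <= C * (m`!%:R)^-1.
Proof.
move=> nu1; pose c := Num.min (Gamma (nu + 1)) (Gamma (nu + 1 + 1)).
have c0 : 0 < c by rewrite lt_min !Gamma_gt0//; lra.
exists c^-1 => [|m]; first by rewrite invr_ge0 ltW.
rewrite /bessel_coef invfM mulrC.
rewrite ler_wpM2r ?invr_ge0// lef_pV2 ?posrE ?Gamma_gt0 ?gt_shift//.
case: m => [|m]; first by rewrite addr0 ge_min lexx.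
elim: m => [|m IH].
  have -> : nu + 1%:R + 1 = nu + 1 + 1 by [].
  by rewrite ge_min lexx orbT.
apply: (le_trans IH).
have -> : nu + m.+2%:R + 1 = (nu + m.+1%:R + 1) + 1 by rewrite -natr1; ring.
rewrite (GammaS (gt_shift m.+1 nu1)).
rewrite ler_peMl ?ltW ?Gamma_gt0 ?gt_shift//.
by rewrite -natr1; have := ler0n R m; lra.
Qed.

Lemma is_cvg_bessel nu w : -1 < nu -> cvgn (pseries (bessel_coef nu) w).
Proof.
move=> nu1; have [C C0 hC] := bessel_coef_le nu1; apply: normed_cvg.
apply: (@series_le_cvg _ _ (C *: exp_coeff `|w|)) => [n|n|n|].
- exact: normr_ge0.
- by rewrite fctE mulr_ge0// exp_coeff_ge0.
- rewrite fctE /= normrM normrX gtr0_norm ?bessel_coef_gt0//.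
  by rewrite /exp_coeff/= /GRing.scale/= [_ / _]mulrC mulrA ler_wpM2r ?exprn_ge0.
- exact/is_cvg_seriesZ/is_cvg_series_exp_coeff.
Qed.

Lemma is_derive_bessel nu w : -1 < nu ->
  is_derive w (1:R) (bessel_fun nu) (bessel_fun (nu + 1) w).
Proof.
move=> nu1; rewrite /bessel_fun -bessel_coef_diffs//.
apply: (@pseries_snd_diffs _ _ (`|w| + 1)); rewrite ?bessel_coef_diffs//; try lra.
- exact: is_cvg_bessel.
- by apply: is_cvg_bessel; lra.
- by apply: is_cvg_bessel; lra.
- by rewrite [ltRHS]ger0_norm ?addr_ge0// ltrDl.
Qed.

(** The recurrence [I_nu - I_(nu+2) = 2 (nu + 1) / z * I_(nu+1)]. The factor [nu + 1 + m] relating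
    the coefficients is split: its part [m] gives w times the derivative of the series of order
    [nu + 1]. *)
Lemma bessel_fun_rec nu w : -1 < nu ->
  bessel_fun nu w = (nu + 1) * bessel_fun (nu + 1) w + w * bessel_fun (nu + 1 + 1) w.
Proof.
move=> nu1; have nu2 : -1 < nu + 1 by lra.
have nu3 : -1 < nu + 1 + 1 by lra.
have := @pseries_diffs_equiv R (bessel_coef (nu + 1)) w.
rewrite bessel_coef_diffs// => /(_ (is_cvg_bessel (w := w) nu3)) h.
apply/cvg_lim => //.
have -> : pseries (bessel_coef nu) w =
  (nu + 1) *: pseries (bessel_coef (nu + 1)) w +
  w *: series (fun i => i%:R * bessel_coef (nu + 1) i * w ^+ i.-1).
  apply/funext => n; rewrite /pseries/series/= !fctE /GRing.scale/=.
  rewrite !mulr_sumr -big_split/=; apply: eq_bigr => -[_|i _].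
    by rewrite bessel_coefS// !mul0r mulr0 addr0 addr0 mulrA.
  by rewrite bessel_coefS//= exprS; ring.
apply: cvgD; first by apply: cvgZl_tmp; apply: is_cvg_bessel.
exact: cvgZl_tmp.
Qed.

Lemma bessel_fun_gt0 nu w : -1 < nu -> 0 <= w -> 0 < bessel_fun nu w.
Proof.
move=> nu1 w0; apply: (@lt_le_trans _ _ (pseries (bessel_coef nu) w 1)).
  by rewrite /pseries/series/= big_nat1 expr0 mulr1 bessel_coef_gt0.
apply: nondecreasing_cvgn_le; last exact: is_cvg_bessel.
apply/nondecreasing_seqP => n; rewrite /pseries /series/= big_nat_recr//=.
by rewrite lerDl mulr_ge0 ?exprn_ge0// ltW ?bessel_coef_gt0.
Qed.

Lemma bessel_fun_homo nu w1 w2 : -1 < nu -> 0 <= w1 -> w1 <= w2 ->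
  bessel_fun nu w1 <= bessel_fun nu w2.
Proof.
move=> nu1 w0 w12; apply: lim_series_le; [exact: is_cvg_bessel..|].
move=> n; rewrite ler_wpM2l ?(ltW (bessel_coef_gt0 _ _))//.
by rewrite lerXn2r ?nnegrE ?(le_trans w0 w12).
Qed.

(* Interpolation between [a] and [a + 1]: log-convexity of Gamma bounds each
   coefficient, and [X^(1-d)] is below its tangent at [X = s]. *)
Lemma bessel_coef_interp a d s m : -1 < a -> 0 <= d <= 1 -> 0 < s ->
  s `^ (d - 1) * bessel_coef (a + d) m <=
  (d + (1 - d) * d / s) * bessel_coef (a + 1) m + (1 - d) / s * bessel_coef a m.
Proof.
move=> a1 /andP[d0 d1] s0; pose X := a + d + m%:R + 1.
have ad : -1 < a + d by lra.
have X0 : 0 < X by apply: gt_shift.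
have h := @Gamma_le_powR R X (1 - d) X0.
have e1 : X + (1 - d) = a + 1 + m%:R + 1 by rewrite /X; ring.
have {}h : Gamma (a + 1 + m%:R + 1) <= X `^ (1 - d) * Gamma X.
  by rewrite -e1; apply: h; lra.
have t := @powR_le_tangent R (1 - d) (X / s) _ (divr_gt0 X0 s0).
have {}t : (X / s) `^ (1 - d) <= d + (1 - d) * (X / s).
  by apply: (le_trans (t _)); lra.
have GX := Gamma_gt0 X0.
have G1 : 0 < Gamma (a + 1 + m%:R + 1) by apply: Gamma_gt0; apply: gt_shift; lra.
have f0 : 0 < (m`!%:R : R) by rewrite ltr0n fact_gt0.
have -> : s `^ (d - 1) * bessel_coef (a + d) m =
    (s `^ (1 - d))^-1 * (m`!%:R * Gamma X)^-1.
  by rewrite -[d - 1]opprK powRN opprB.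
have sd := powR_gt0 (1 - d) s0.
have tX : X `^ (1 - d) = (X / s) `^ (1 - d) * s `^ (1 - d).
  by rewrite -powRM ?divr_ge0 ?ltW// divfK// gt_eqF.
rewrite [bessel_coef a m]bessel_coefS// /bessel_coef.
have -> : (d + (1 - d) * d / s) * (m`!%:R * Gamma (a + 1 + m%:R + 1))^-1 +
  (1 - d) / s * ((a + 1 + m%:R) * (m`!%:R * Gamma (a + 1 + m%:R + 1))^-1)
  = (d + (1 - d) * (X / s)) * (m`!%:R * Gamma (a + 1 + m%:R + 1))^-1.
  by rewrite /X; field; rewrite !gt_eqF.
rewrite ler_pdivlMr ?mulr_gt0//.
have -> : (s `^ (1 - d))^-1 * (m`!%:R * Gamma X)^-1 *
  (m`!%:R * Gamma (a + 1 + m%:R + 1)) =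
  Gamma (a + 1 + m%:R + 1) / (s `^ (1 - d) * Gamma X).
  by field; rewrite !gt_eqF.
rewrite ler_pdivrMr ?mulr_gt0//; apply: (le_trans h).
by rewrite tX -mulrA ler_wpM2r// mulr_ge0// ltW.
Qed.

Lemma ler_lin_limn (u v t : R^nat) (p q r : R) :
  cvgn u -> cvgn v -> cvgn t -> (forall n, r * u n <= p * v n + q * t n) ->
  r * limn u <= p * limn v + q * limn t.
Proof.
move=> cu cv ct h.
have cru : (fun n => r * u n) @ \oo --> r * limn u.
  by apply: cvgM; [exact: cvg_cst|exact: cu].
have cpv : (fun n => p * v n) @ \oo --> p * limn v.
  by apply: cvgM; [exact: cvg_cst|exact: cv].
have cqt : (fun n => q * t n) @ \oo --> q * limn t.
  by apply: cvgM; [exact: cvg_cst|exact: ct].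
by apply: (ler_cvg_to cru (cvgD cpv cqt)); near=> n; exact: h.
Unshelve. all: by end_near. Qed.

Lemma bessel_fun_interp a d s w : -1 < a -> 0 <= d <= 1 -> 0 < s -> 0 <= w ->
  s `^ (d - 1) * bessel_fun (a + d) w <=
  (d + (1 - d) * d / s) * bessel_fun (a + 1) w + (1 - d) / s * bessel_fun a w.
Proof.
move=> a1 d01 s0 w0; have /andP[d0 d1] := d01.
have ca := is_cvg_bessel (w := w) a1.
have cd := @is_cvg_bessel (a + d) w ltac:(lra).
have cS := @is_cvg_bessel (a + 1) w ltac:(lra).
apply: (ler_lin_limn cd cS ca) => n.
rewrite /pseries/series/= !mulr_sumr -big_split/=; apply: ler_sum => i _.
rewrite !mulrA -mulrDl ler_wpM2r ?exprn_ge0//.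
exact: bessel_coef_interp.
Qed.

Lemma besselIE a z : -1 < a -> 0 < z ->
  besselI a z = (z / 2) `^ a * bessel_fun a ((z / 2) ^+ 2).
Proof.
move=> a1 z0; rewrite /besselI /bessel_fun.
have z2 : 0 < z / 2 by rewrite divr_gt0.
rewrite -[RHS]/((z / 2) `^ a *: limn (pseries (bessel_coef a) ((z / 2) ^+ 2))).
rewrite -limZl_tmp; last exact: is_cvg_bessel.
congr (limn _); apply/funext => n.
rewrite /pseries/series/= !fctE /GRing.scale/= mulr_sumr; apply: eq_bigr => m _.
rewrite powRD ?(gt_eqF z2) ?implybT// -natrM powR_mulrn ?ltW// exprM.
by rewrite /bessel_coef; ring.
Qed.

End BesselSeries.

Opaque bessel_fun.

(** * Functions with symbol-type decay at infinity *)

Section BigO.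
Context {R : realType}.
Implicit Types (f g h : R -> R) (n m : nat) (z c : R).

(** The threshold is at least 1, so that a higher order of decay implies a lower one. *)
Definition bigOy n f := exists C Z : R,
  [/\ 0 < C, 1 <= Z & forall z, Z <= z -> `|f z| <= C / z ^+ n].

Lemma bigOy_ext n f g : (forall z, 0 < z -> f z = g z) -> bigOy n f -> bigOy n g.
Proof.
move=> fg [C [Z [C0 Z1 H]]]; exists C, Z; split=> // z Zz.
by rewrite -fg ?H//; lra.
Qed.

Lemma bigOyD n f g : bigOy n f -> bigOy n g -> bigOy n (fun z => f z + g z).
Proof.
move=> [C [Z [C0 Z1 H]]] [D [Y [D0 Y1 K]]]; exists (C + D), (Num.max Z Y).
split; [by rewrite addr_gt0|by rewrite le_max Z1|move=> z].
rewrite ge_max => /andP[Zz Yz].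
by rewrite (le_trans (ler_normD _ _))// mulrDl lerD ?H ?K.
Qed.

Lemma bigOyM n m f g : bigOy n f -> bigOy m g ->
  bigOy (n + m) (fun z => f z * g z).
Proof.
move=> [C [Z [C0 Z1 H]]] [D [Y [D0 Y1 K]]]; exists (C * D), (Num.max Z Y).
split; [by rewrite mulr_gt0|by rewrite le_max Z1|move=> z].
rewrite ge_max => /andP[Zz Yz].
by rewrite normrM exprD invfM mulrACA ler_pM ?H ?K.
Qed.

Lemma bigOy_cst c : bigOy 0 (fun=> c).
Proof.
exists (`|c| + 1), 1; split=> // z _.
by rewrite expr0 divr1 lerDl.
Qed.

Lemma bigOyZ n c f : bigOy n f -> bigOy n (fun z => c * f z).
Proof. by move=> h; apply: (bigOyM (bigOy_cst c) h). Qed.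

Lemma bigOy_inv : bigOy 1 (fun z => z^-1).
Proof.
exists 1, 1; split=> // z z1.
by rewrite expr1 mul1r ger0_norm// invr_ge0; lra.
Qed.

Lemma bigOyW n f : bigOy n.+1 f -> bigOy n f.
Proof.
move=> [C [Z [C0 Z1 H]]]; exists C, Z; split=> // z Zz.
have z1 : 1 <= z by lra.
apply: (le_trans (H _ Zz)); rewrite ler_pM2l// lef_pV2 ?posrE ?exprn_gt0; try lra.
by rewrite exprS ler_peMl// exprn_ge0; lra.
Qed.

Definition theta f z : R := z * derive1 f z.

(* [theta^j f = O(z^-n)] for all [j <= m]: the same decay for all [j], as [theta]
   preserves homogeneity. *)
Fixpoint symbol n m f : Prop := bigOy n f /\
  if m is m'.+1 then (forall z, 0 < z -> derivable f z 1) /\ symbol n m' (theta f)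
  else True.

Lemma symbol_bigOy n m f : symbol n m f -> bigOy n f.
Proof. by case: m => [|m] []. Qed.

Lemma theta_ext f g : (forall z, 0 < z -> f z = g z) ->
  forall z, 0 < z -> theta f z = theta g z.
Proof.
move=> fg z z0; rewrite /theta !derive1E; congr (_ * _).
apply: near_eq_derive; near=> t; apply: fg; near: t; exact: lt_nbhsr.
Unshelve. all: by end_near. Qed.

Lemma symbol_ext n m f g : (forall z, 0 < z -> f z = g z) ->
  symbol n m f -> symbol n m g.
Proof.
elim: m f g => [|m IH] f g fg /= [h1 h2]; split; try exact: bigOy_ext fg h1.
  by [].
case: h2 => h2 h3; split; last exact: IH (theta_ext fg) h3.
move=> z z0; have /derivableP h := h2 z z0.
by have [] := isd_eq0y z0 fg h.
Qed.

Lemma thetaE f d z : is_derive z (1:R) f d -> theta f z = z * d.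
Proof. by move=> h; rewrite /theta (isd_derive1 h). Qed.

Lemma derivable_isd f z : derivable f z 1 -> is_derive z (1:R) f (derive1 f z).
Proof. by move=> /derivableP; rewrite derive1E. Qed.

Lemma symbolW n m f : symbol n m.+1 f -> symbol n m f.
Proof.
elim: m f => [|m IH] f /= [h1 [h2 h3]]; split=> //; split=> //; exact: IH.
Qed.

Lemma symbolW0 n m f : symbol n.+1 m f -> symbol n m f.
Proof.
elim: m f => [|m IH] f /= [h1 h2]; split; try exact: bigOyW.
  by [].
by case: h2 => h2 h3; split=> //; exact: IH.
Qed.

Lemma symbolD n m f g : symbol n m f -> symbol n m g ->
  symbol n m (fun z => f z + g z).
Proof.
elim: m f g => [|m IH] f g /= [h1 h2] [k1 k2]; split; try exact: bigOyD.
  by [].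
case: h2 k2 => h2 h3 [k2 k3]; split.
  by move=> z z0; apply: derivableD; [exact: h2|exact: k2].
apply: symbol_ext (IH _ _ h3 k3) => z z0.
have := isdD (derivable_isd (h2 z z0)) (derivable_isd (k2 z z0)).
by move/thetaE ->; rewrite mulrDr.
Qed.

Lemma symbolZ n m c f : symbol n m f -> symbol n m (fun z => c * f z).
Proof.
elim: m f => [|m IH] f /= [h1 h2]; split; try exact: bigOyZ.
  by [].
case: h2 => h2 h3; have d z : 0 < z -> is_derive z (1:R) (fun z => c * f z)
    (c * derive1 f z).
  by move=> z0; eapply isd_eq; [isd; exact: derivable_isd (h2 z z0)|rewrite /= ?/id; ring].
split; first by move=> z /d [].
apply: symbol_ext (IH _ h3) => z z0.
by rewrite (thetaE (d z z0)) /theta; ring.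
Qed.

(** Since [theta (f / z) = (theta f - f) / z], the additional order of decay is kept by all
    iterates. *)
Lemma symbolV n m f : symbol n m f -> symbol n.+1 m (fun z => f z / z).
Proof.
elim: m f => [|m IH] f /= [h1 h2]; split;
  try by rewrite -addn1; exact: bigOyM h1 bigOy_inv.
  by [].
case: h2 => h2 h3; have d z : 0 < z -> is_derive z (1:R) (fun z => f z / z)
    ((theta f z - f z) / z ^+ 2).
  move=> z0; eapply isd_eq.
    isd; [exact: derivable_isd (h2 z z0)|exact: lt0r_neq0].
  by rewrite /theta /id; field; rewrite gt_eqF.
split; first by move=> z /d [].
have h4 : symbol n m (fun z => theta f z + (-1) * f z).
  by apply: symbolD => //; apply: symbolZ; apply: symbolW.
apply: symbol_ext (IH _ h4) => z z0.
by rewrite (thetaE (d z z0)); field; rewrite gt_eqF.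
Qed.

(* [e^(2z) d / z] has derivative [e^(2z) h / z], which is dominated by the
   derivative of a multiple of [e^(2z) / z^2]. *)
Lemma bigOy_ode (d h : R -> R) :
  (forall z, 0 < z -> is_derive z (1:R) d (- 2 * d z + d z / z + h z)) ->
  bigOy 1 h -> bigOy 1 d.
Proof.
(* From 2 on, [1 - 2 / u] is nonnegative, so that the derivative of [Q] is at least
   [C e^(2u) / u^2], the bound for the derivative of [P]. *)
move=> dd [C [Z0 [C0 Z1 H]]]; pose Z := Num.max Z0 2.
have Z2 : 2 <= Z by rewrite /Z le_max lexx orbT.
have ZZ0 : Z0 <= Z by rewrite /Z le_max lexx.
pose P z := expR (2 * z) * d z / z.
pose Q z := C * expR (2 * z) / z ^+ 2.
have dP z : 0 < z -> is_derive z (1:R) P (expR (2 * z) * h z / z).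
  move=> z0; eapply isd_eq.
    by rewrite /P; isd; [exact: dd|exact: lt0r_neq0].
  by rewrite /= /id; field; rewrite gt_eqF.
have dQ z : 0 < z -> is_derive z (1:R) Q (C * expR (2 * z) * (2 / z ^+ 2 - 2 / z ^+ 3)).
  move=> z0; eapply isd_eq.
    by rewrite /Q; isd; rewrite expf_neq0// gt_eqF.
  by rewrite /= /id; field; rewrite gt_eqF.
(* Used with both signs [s], which bounds the absolute value of [P]. *)
have step (s : R) : `|s| = 1 -> forall z, Z <= z -> s * P z <= Q z + `|P Z|.
  move=> s1 z Zz.
  have dS (u : R) : 0 < u -> is_derive u (1:R) (fun u => Q u - s * P u)
     (C * expR (2 * u) * (2 / u ^+ 2 - 2 / u ^+ 3) - s * (expR (2 * u) * h u / u)).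
    move=> u0; eapply isd_eq; first by isd; [exact: dQ|exact: dP].
    by rewrite /=; ring.
  have := @ger0_derive1_ndecry R (fun u => Q u - s * P u) Z.
  have u0 (u : R) : Z < u -> 0 < u by lra.
  move=> /(_ _ _ _ Z z (lexx _) Zz) mono.
  have : Q Z - s * P Z <= Q z - s * P z.
    apply: mono.
    - by move=> u; rewrite in_itv/= andbT => /u0/dS [].
    - move=> u; rewrite in_itv/= andbT => Zu.
      rewrite (isd_derive1 (dS u (u0 u Zu))).
      have v0 := u0 u Zu.
      have hu : s * h u <= C / u.
        apply: le_trans (ler_norm _) _; rewrite normrM s1 mul1r.
        by have := H u; rewrite expr1; apply; lra.
      have -> : C * expR (2 * u) * (2 / u ^+ 2 - 2 / u ^+ 3) -
          s * (expR (2 * u) * h u / u) =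
          expR (2 * u) / u * (C / u * (1 - 2 / u) + (C / u - s * h u)).
        by field; rewrite gt_eqF.
      rewrite mulr_ge0 ?divr_ge0 ?expR_ge0 ?(ltW v0)// addr_ge0 ?subr_ge0//.
      rewrite mulr_ge0 ?divr_ge0 ?(ltW v0) ?(ltW C0)//.
      by rewrite subr_ge0 ler_pdivrMr// mul1r; lra.
    - apply/continuous_within_itvcyP; split.
        by move=> u; rewrite in_itv/= andbT => /u0/dS/isd_cont.
      by apply: cvg_at_right_filter; apply: (isd_cont (dS Z _)); lra.
  have : s * P Z <= `|P Z| by rewrite (le_trans (ler_norm _))// normrM s1 mul1r.
  have : 0 <= Q Z by rewrite /Q divr_ge0 ?exprn_ge0 ?mulr_ge0 ?expR_ge0//; lra.
  lra.
exists (C + `|P Z|), Z; split; [by rewrite ltr_wpDr|by lra|].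
move=> z Zz; rewrite expr1.
have z0 : 0 < z by lra.
have e0 := expR_gt0 (2 * z).
have PzE : P z = expR (2 * z) / z * d z by rewrite /P; ring.
(* Makes the contribution of the initial value, [|P Z| z e^(-2z)], at most [|P Z| / z]. *)
have ez : z ^+ 2 <= expR (2 * z).
  have -> : 2 * z = z + z by ring.
  rewrite expRD expr2; have := expR_ge1Dx z; nra.
have key : `|P z| <= Q z + `|P Z|.
  have := step 1 (normr1 _) z Zz; have := step (-1) (normrN1 _) z Zz.
  by rewrite mul1r mulN1r ler_norml; lra.
move: key; rewrite PzE normrM ger0_norm ?divr_ge0 ?expR_ge0 ?(ltW z0)//.
rewrite mulrC -ler_pdivlMr ?divr_gt0// => /le_trans; apply.
have -> : (Q z + `|P Z|) / (expR (2 * z) / z) =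
   C / z + `|P Z| * (z ^+ 2 / expR (2 * z)) / z.
  by rewrite /Q; field; rewrite !gt_eqF.
rewrite [leRHS]mulrDl lerD2l ler_wpM2r ?invr_ge0 ?(ltW z0)//.
by rewrite ler_piMr// ler_pdivrMr// mul1r.
Qed.

(** Applying [theta] to the equation shows that [theta d] solves the same equation with
    inhomogeneity [h + theta h - 2 d], which is controlled by the previous step of the induction. *)
Lemma symbol_ode m (d h : R -> R) :
  (forall z, 0 < z -> is_derive z (1:R) d (- 2 * d z + d z / z + h z)) ->
  symbol 1 m h -> symbol 1 m d.
Proof.
elim: m d h => [|m IH] d h dd sh.
  by split=> //; apply: (bigOy_ode dd); case: sh.
have [h0 [dh sth]] := sh.
have h1 := symbolW sh.
have sd : symbol 1 m d := IH d h dd h1.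
have s2 : symbol 1 m (fun z => (h z + theta h z) + (-2) * d z).
  apply: symbolD; last exact: symbolZ.
  by apply: symbolD.
split; first exact: (bigOy_ode dd).
split; first by move=> z /dd [].
apply: (IH (theta d) _ _ s2).
move=> z z0.
apply: (isd_eq0y (f := fun u => - 2 * (u * d u) + d u + u * h u) z0).
  by move=> u u0; rewrite (thetaE (dd u u0)); field; rewrite gt_eqF.
eapply isd_eq.
  isd; [exact: dd|exact: dd|exact: derivable_isd (dh z z0)].
by rewrite /= /id (thetaE (dd z z0)) /theta; field; rewrite gt_eqF.
Qed.

End BigO.

(** * The normalized Bessel function: recurrence, interpolation, half-integer orders *)

Section Phi.
Context {R : realType}.
Implicit Types (nu z d : R).

Definition bessel_pre z : R := Num.sqrt (2 * pi) * z `^ 2^-1 * expR (- z).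

Definition bessel_phi nu z : R :=
  bessel_pre z * ((z / 2) `^ nu * bessel_fun nu ((z / 2) ^+ 2)).

Lemma bessel_pre_gt0 z : 0 < z -> 0 < bessel_pre z.
Proof.
by move=> z0; rewrite !mulr_gt0 ?expR_gt0 ?powR_gt0// sqrtr_gt0 mulr_gt0// pi_gt0.
Qed.

Lemma bessel_phi_gt0 nu z : -1 < nu -> 0 < z -> 0 < bessel_phi nu z.
Proof.
move=> nu1 z0; rewrite mulr_gt0 ?bessel_pre_gt0// mulr_gt0 ?powR_gt0 ?divr_gt0//.
by rewrite bessel_fun_gt0// exprn_ge0// divr_ge0// ltW.
Qed.

Lemma powRS (x p : R) : 0 < x -> x `^ (p + 1) = x `^ p * x.
Proof. by move=> x0; rewrite powRD ?powRr1 ?(ltW x0)// (gt_eqF x0) implybT. Qed.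

Lemma is_derive_powR_div (x p : R) : 0 < x ->
  is_derive x (1:R) (fun t => t `^ p) (p * x `^ p / x).
Proof.
move=> x0; eapply isd_eq; first by isd; exact: x0.
have e : x `^ p = x `^ (p - 1) * x by rewrite -powRS// subrK.
by rewrite e /=; field; rewrite gt_eqF.
Qed.

Lemma is_derive_bessel_pre z : 0 < z ->
  is_derive z (1:R) bessel_pre ((2^-1 / z - 1) * bessel_pre z).
Proof.
move=> z0; eapply isd_eq.
  rewrite /bessel_pre; eapply isdM; first eapply isdM; first exact: isdC.
    exact: is_derive_powR_div.
  by isd.
by rewrite /= /bessel_pre; ring.
Qed.

Lemma is_derive_bessel_phi nu z : -1 < nu -> 0 < z ->
  is_derive z (1:R) (bessel_phi nu)
    (((nu + 2^-1) / z - 1) * bessel_phi nu z + bessel_phi (nu + 1) z).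
Proof.
move=> nu1 z0; have z2 : 0 < z / 2 by rewrite divr_gt0.
eapply isd_eq.
  rewrite /bessel_phi; eapply isdM; first exact: is_derive_bessel_pre.
  eapply isdM.
    eapply (isdcomp (f := fun t => t / 2) (g := fun t => t `^ nu)); first by isd.
    exact: is_derive_powR_div.
  eapply (isdcomp (f := fun t => (t / 2) ^+ 2)); first by isd.
  exact: is_derive_bessel.
rewrite /= /bessel_phi (powRS _ z2).
move: (bessel_fun nu _) (bessel_fun (nu + 1) _) (bessel_pre z) (_ `^ nu).
by move=> g0 g1 p q; field; rewrite gt_eqF.
Qed.

Lemma bessel_phi_rec nu z : -1 < nu -> 0 < z ->
  bessel_phi nu z = 2 * (nu + 1) / z * bessel_phi (nu + 1) z + bessel_phi (nu + 1 + 1) z.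
Proof.
move=> nu1 z0; have z2 : 0 < z / 2 by rewrite divr_gt0.
rewrite /bessel_phi (bessel_fun_rec _ nu1) !(powRS _ z2).
move: (bessel_fun (nu + 1) _) (bessel_fun (nu + 1 + 1) _) (bessel_pre z) (_ `^ nu).
by move=> g0 g1 p q; field; rewrite gt_eqF.
Qed.

(** The tangent point [s] of [bessel_fun_interp] is [z / 2], near the index where the terms of the
    series of [I_a(z)] concentrate; so the correction is only of order [1 / z]. *)
Lemma bessel_phi_interp a d z : -1 < a -> 0 <= d <= 1 -> 0 < z ->
  bessel_phi (a + d) z <= d * bessel_phi (a + 1) z + (1 - d) * bessel_phi a z +
     2 * d * (1 - d) / z * bessel_phi (a + 1) z.
Proof.
move=> a1 d01 z0; have z2 : 0 < z / 2 by rewrite divr_gt0.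
have := bessel_fun_interp a1 d01 z2 (exprn_ge0 2 (ltW z2)).
have c0 : 0 < bessel_pre z * (z / 2) `^ (a + 1).
  by rewrite mulr_gt0 ?bessel_pre_gt0 ?powR_gt0.
rewrite -(ler_pM2l c0) => h.
have -> : bessel_phi (a + d) z = bessel_pre z * (z / 2) `^ (a + 1) *
    ((z / 2) `^ (d - 1) * bessel_fun (a + d) ((z / 2) ^+ 2)).
  have -> : (z / 2) `^ (a + 1) = (z / 2) `^ (a + d) / (z / 2) `^ (d - 1).
    by rewrite -powRB ?(gt_eqF z2) ?implybT//; congr (_ `^ _); ring.
  by rewrite /bessel_phi; field; rewrite gt_eqF// powR_gt0.
apply: (le_trans h); rewrite le_eqVlt; apply/orP; left; apply/eqP.
rewrite /bessel_phi !(powRS _ z2).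
move: (bessel_fun (a + 1) _) (bessel_fun a _) (bessel_pre z) (_ `^ a).
by move=> g0 g1 p q; field; rewrite gt_eqF.
Qed.

Lemma bessel_fun0 nu : bessel_fun nu 0 = bessel_coef nu 0 :> R.
Proof.
rewrite -[LHS]/(limn (pseries (bessel_coef nu) 0)).
apply/cvg_lim => //; apply/cvgrPdist_lt => e e0; exists 1%N => // -[//|n] _.
rewrite /pseries/series/= big_nat_recl// big1 ?addr0 ?mulr1 ?subrr ?normr0//.
by move=> i _; rewrite exprS mul0r mulr0.
Qed.

Lemma derivative0_cst (f : R -> R) x y :
  (forall z, is_derive z (1:R) f 0) -> f x = f y.
Proof. by move=> h; exact: is_derive_0_is_cst. Qed.

(** [A] and [B] are cosh and sinh divided by [sqrt pi]. The series give [A' = B] and [B' = A], so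
    that [(A + B) e^(-u)] and [(A - B) e^u] are constant, and both constants are
    [1 / Gamma (1/2)]. *)
Lemma bessel_phi_half z : 0 < z ->
  bessel_phi (- 2^-1) z = 1 + expR (- z) ^+ 2 /\
  bessel_phi 2^-1 z = 1 - expR (- z) ^+ 2.
Proof.
move=> z0; pose A u : R := bessel_fun (- 2^-1) ((u / 2) ^+ 2).
pose B u : R := u / 2 * bessel_fun 2^-1 ((u / 2) ^+ 2).
have n1 : -1 < - 2^-1 :> R by lra.
have e1 : - 2^-1 + 1 = 2^-1 :> R by field.
have dA u : is_derive u (1:R) A (B u).
  eapply isd_eq.
    eapply (isdcomp (f := fun t => (t / 2) ^+ 2)); first by isd.
    exact: is_derive_bessel.
  by rewrite /= /B e1; move: (bessel_fun 2^-1 _) => g0; field.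
have dB u : is_derive u (1:R) B (A u).
  eapply isd_eq.
    rewrite /B; eapply isdM; first by isd.
    eapply (isdcomp (f := fun t => (t / 2) ^+ 2)); first by isd.
    by apply: is_derive_bessel; lra.
  rewrite /= /A (bessel_fun_rec _ n1) e1.
  by move: (bessel_fun 2^-1 _) (bessel_fun (2^-1 + 1) _) => g0 g1; field.
have p0 : 0 < Num.sqrt pi :> R by rewrite sqrtr_gt0 pi_gt0.
have A0 : A 0 = (Num.sqrt pi)^-1.
  rewrite /A mul0r expr0n bessel_fun0 /bessel_coef fact0 mul1r addr0 e1.
  by rewrite Gamma_half.
have B0 : B 0 = 0 by rewrite /B mul0r mul0r.
have ep := expRN z; have e0 := lt0r_neq0 (expR_gt0 z).
have pl : (A z + B z) * expR (- z) = (Num.sqrt pi)^-1.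
  transitivity ((A 0 + B 0) * expR (- 0)); last first.
    by rewrite A0 B0 oppr0 expR0 addr0 mulr1.
  apply: (derivative0_cst (f := fun u => (A u + B u) * expR (- u))) => u.
  eapply isd_eq; first by eapply isdM; [eapply isdD; [exact: dA|exact: dB]|isd].
  by rewrite /=; ring.
have mi : (A z - B z) * expR z = (Num.sqrt pi)^-1.
  transitivity ((A 0 - B 0) * expR 0); last first.
    by rewrite A0 B0 expR0 subr0 mulr1.
  apply: (derivative0_cst (f := fun u => (A u - B u) * expR u)) => u.
  eapply isd_eq.
    eapply isdM; last by isd.
    by eapply isdD; [exact: dA|eapply isdN; exact: dB].
  by rewrite /= /id; ring.
have z2 : 0 < z / 2 by rewrite divr_gt0.
have pre : bessel_pre z * (z / 2) `^ (- 2^-1) = 2 * Num.sqrt pi * expR (- z).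
  rewrite /bessel_pre sqrtrM// powRN !powR12_sqrt ?ltW//.
  have -> : Num.sqrt z = Num.sqrt (z / 2) * Num.sqrt 2.
    by rewrite -sqrtrM ?ltW// divfK// pnatr_eq0.
  have h2 : Num.sqrt 2 * Num.sqrt 2 = 2 :> R by rewrite -expr2 sqr_sqrtr.
  have h1 : Num.sqrt (z / 2) != 0 by rewrite gt_eqF// sqrtr_gt0.
  rewrite -[X in _ = X * _ * _]h2.
  by move: (Num.sqrt (z / 2)) (Num.sqrt 2) (Num.sqrt pi) (expR _) h1 => q1 q2 q3 q4 h1; field.
have f1 : bessel_phi (- 2^-1) z = 2 * Num.sqrt pi * expR (- z) * A z.
  by rewrite /bessel_phi mulrA pre.
have f2 : bessel_phi 2^-1 z = 2 * Num.sqrt pi * expR (- z) * B z.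
  rewrite /bessel_phi /B -pre.
  have -> : (z / 2) `^ 2^-1 = (z / 2) `^ (- 2^-1) * (z / 2).
    by rewrite -(powRS _ z2) e1.
  by move: (bessel_fun _ _) (_ `^ _) (bessel_pre _) => g0 g1 g2; ring.
have pi0 : Num.sqrt pi != 0 :> R by rewrite gt_eqF.
have hp : A z + B z = (Num.sqrt pi)^-1 * expR z.
  by rewrite -pl ep mulfVK.
have hm : A z - B z = (Num.sqrt pi)^-1 * expR (- z).
  by rewrite -mi ep mulfK.
have hA : A z = 2^-1 * (Num.sqrt pi)^-1 * (expR z + expR (- z)).
  by rewrite mulrDr -!mulrA -hp -hm; field.
have hB : B z = 2^-1 * (Num.sqrt pi)^-1 * (expR z - expR (- z)).
  by rewrite mulrBr -!mulrA -hp -hm; field.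
rewrite f1 f2 hA hB ep; by split; field; rewrite e0 pi0.
Qed.

End Phi.

(** * Asymptotics of the normalized Bessel function for all orders above -1 *)

Section PhiAsymptotics.
Context {R : realType}.
Implicit Types (nu z d : R).

Lemma theta_bessel_phi nu z : -1 < nu -> 0 < z ->
  theta (bessel_phi nu) z =
  (nu + 2^-1 - z) * bessel_phi nu z + z * bessel_phi (nu + 1) z.
Proof.
move=> nu1 z0; rewrite (thetaE (is_derive_bessel_phi nu1 z0)).
move: (bessel_phi nu z) (bessel_phi (nu + 1) z) => p q.
by field; rewrite gt_eqF.
Qed.

(* The modified Bessel equation, written for [theta phi]. *)
Lemma is_derive_theta_bessel_phi nu z : -1 < nu -> 0 < z ->
  is_derive z (1:R) (theta (bessel_phi nu))
  (- 2 * theta (bessel_phi nu) z + theta (bessel_phi nu) z / z +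
   (nu ^+ 2 - 4^-1) * (bessel_phi nu z / z)).
Proof.
move=> nu1 z0; have nu2 : -1 < nu + 1 by lra.
pose f u := (nu + 2^-1 - u) * bessel_phi nu u + u * bessel_phi (nu + 1) u.
apply: (isd_eq0y (f := f) z0).
  by move=> u u0; rewrite theta_bessel_phi.
eapply isd_eq.
  rewrite /f; eapply isdD; eapply isdM.
  - by isd.
  - exact: is_derive_bessel_phi.
  - by isd.
  - exact: is_derive_bessel_phi.
rewrite theta_bessel_phi// (bessel_phi_rec nu1 z0).
move: (bessel_phi (nu + 1) z) (bessel_phi (nu + 1 + 1) z) => p q /=.
by field; rewrite gt_eqF.
Qed.

(** A bootstrap from boundedness: if m iterates of [phi] are bounded, the inhomogeneity
    [(nu^2 - 1/4) phi / z] has the same iterates of order [1 / z], hence so has [theta phi], and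
    this bounds one more iterate of [phi]. *)
Lemma symbol_bessel_phi nu m : -1 < nu -> bigOy 0 (bessel_phi nu) ->
  symbol 0 m (bessel_phi nu) /\ symbol 1 m (theta (bessel_phi nu)).
Proof.
move=> nu1 b; suff s0 : forall m, symbol 0 m (bessel_phi nu).
  split; first exact: s0.
  refine (symbol_ode (d := theta (bessel_phi nu))
    (h := fun z => (nu ^+ 2 - 4^-1) * (bessel_phi nu z / z)) _ _).
    move=> z z0; exact: (is_derive_theta_bessel_phi nu1 z0).
  exact: (symbolZ _ (symbolV (s0 m))).
elim=> [|{}m IH]; split; [exact: b|exact: I|exact: b|split].
  by move=> z z0; have [] := is_derive_bessel_phi nu1 z0.
refine (symbolW0 _).
refine (symbol_ode (d := theta (bessel_phi nu))
    (h := fun z => (nu ^+ 2 - 4^-1) * (bessel_phi nu z / z)) _ _).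
  move=> z z0; exact: (is_derive_theta_bessel_phi nu1 z0).
exact: (symbolZ _ (symbolV IH)).
Qed.

(** By the derivative formula the difference is [(theta phi - (nu + 1/2) phi) / z], with bounded
    numerator. Thus boundedness at one order compares it with the next one, before any limit is
    known. *)
Lemma bessel_phi_succ nu : -1 < nu -> bigOy 0 (bessel_phi nu) ->
  bigOy 1 (fun z => bessel_phi (nu + 1) z - bessel_phi nu z).
Proof.
move=> nu1 b; have [_ /symbol_bigOy h] := symbol_bessel_phi 0 nu1 b.
have h1 : bigOy 0 (fun z => theta (bessel_phi nu) z + (- (nu + 2^-1)) * bessel_phi nu z).
  by apply: bigOyD; [exact: bigOyW|exact: bigOyZ].
apply: bigOy_ext (bigOyM h1 bigOy_inv) => z z0.
rewrite theta_bessel_phi//.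
move: (bessel_phi (nu + 1) z) (bessel_phi nu z) => p q.
by field; rewrite gt_eqF.
Qed.

Definition phi_asymp nu := bigOy 1 (fun z => bessel_phi nu z - 1).

Lemma phi_asymp_bounded nu : phi_asymp nu -> bigOy 0 (bessel_phi nu).
Proof.
move=> h; have := bigOyD (bigOyW h) (bigOy_cst 1).
by apply: bigOy_ext => z _; rewrite subrK.
Qed.

Lemma phi_asympS nu : -1 < nu -> phi_asymp nu -> phi_asymp (nu + 1).
Proof.
move=> nu1 h; have := bigOyD (bessel_phi_succ nu1 (phi_asymp_bounded h)) h.
by apply: bigOy_ext => z _; rewrite addrA subrK.
Qed.

Lemma bigOy_expRN2 : bigOy 1 (fun z : R => expR (- z) ^+ 2).
Proof.
exists 1, 1; split=> // z z1; rewrite expr1.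
have z0 : 0 < z by lra.
rewrite ger0_norm ?exprn_ge0 ?expR_ge0// expRN exprVn mul1r lef_pV2 ?posrE ?exprn_gt0 ?expR_gt0//.
have := expR_ge1Dx z; have := expR_gt0 z; rewrite expr2; nra.
Qed.

Lemma phi_asymp_Nhalf : phi_asymp (- 2^-1).
Proof.
apply: bigOy_ext bigOy_expRN2 => z z0.
by have [-> _] := bessel_phi_half z0; rewrite addrAC subrr add0r.
Qed.

Lemma phi_asymp_half : phi_asymp 2^-1.
Proof.
apply: bigOy_ext (bigOyZ (-1) bigOy_expRN2) => z z0.
by have [_ ->] := bessel_phi_half z0; ring.
Qed.

Lemma bigOy_le n (f g : R -> R) : (forall z, 0 < z -> `|f z| <= g z) ->
  bigOy n g -> bigOy n f.
Proof.
move=> fg [C [Z [C0 Z1 H]]]; exists C, Z; split=> // z Zz.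
have z0 : 0 < z by lra.
exact: le_trans (fg z z0) (le_trans (ler_norm _) (H z Zz)).
Qed.

Lemma interp_le_sub1 (d p q z a : R) :
  a <= d * p + (1 - d) * q + 2 * d * (1 - d) / z * p ->
  a - 1 <= d * (p - 1) + (1 - d) * (q - 1) + 2 * d * (1 - d) * (p / z).
Proof.
rewrite -(lerD2r (-1)) => /le_trans; apply.
by rewrite le_eqVlt; apply/orP; left; apply/eqP; ring.
Qed.

(** The interpolation inequality solved for its end [q], with the mean written as [q + d (p - q)]: a
    lower bound for [q] once [p - q] is small. *)
Lemma interp_ge_sub1 (d p q z b : R) :
  b <= d * p + (1 - d) * q + 2 * d * (1 - d) / z * p ->
  1 - q <= (1 - b) + d * (p - q) + 2 * d * (1 - d) * (p / z).
Proof.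
rewrite -subr_ge0 => h; rewrite -subr_ge0; apply: (le_trans h).
by rewrite le_eqVlt; apply/orP; left; apply/eqP; ring.
Qed.

(* Interpolation between -1/2 and 1/2 gives boundedness and the upper bound;
   interpolation of 1/2 between [nu] and [nu + 1] gives the lower bound. *)
Lemma phi_asymp_mid nu : - 2^-1 <= nu <= 2^-1 -> phi_asymp nu.
Proof.
move=> /andP[n1 n2]; pose d := nu + 2^-1.
have nu1 : -1 < nu by lra.
have d01 : 0 <= d <= 1 by rewrite /d; lra.
have e1 : - 2^-1 + 1 = 2^-1 :> R by field.
have n0 : -1 < - 2^-1 :> R by lra.
have up z : 0 < z -> bessel_phi nu z - 1 <=
   d * (bessel_phi 2^-1 z - 1) + (1 - d) * (bessel_phi (- 2^-1) z - 1) +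
     2 * d * (1 - d) * (bessel_phi 2^-1 z / z).
  move=> z0; have := @bessel_phi_interp R (- 2^-1) d z _ d01 z0.
  rewrite e1 (_ : - 2^-1 + d = nu); last by rewrite /d; ring.
  by move=> /(_ n0)/interp_le_sub1.
pose U z := d * (bessel_phi 2^-1 z - 1) + (1 - d) * (bessel_phi (- 2^-1) z - 1) +
     2 * d * (1 - d) * (bessel_phi 2^-1 z / z).
have hU : bigOy 1 U.
  apply: bigOyD; first by apply: bigOyD; apply: bigOyZ;
    [exact: phi_asymp_half|exact: phi_asymp_Nhalf].
  apply: bigOyZ; apply: (bigOyM (n := 0) _ bigOy_inv).
  exact/phi_asymp_bounded/phi_asymp_half.
have bnd : bigOy 0 (bessel_phi nu).
  apply: (@bigOy_le 0 _ (fun z => U z + 1)); last first.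
    by apply: bigOyD; [exact: bigOyW|exact: bigOy_cst].
  move=> z z0; rewrite ger0_norm; last by rewrite ltW// bessel_phi_gt0.
  by rewrite -lerBlDr; exact: up.
have suc := bessel_phi_succ nu1 bnd.
pose d' := 2^-1 - nu.
have d'01 : 0 <= d' <= 1 by rewrite /d'; lra.
pose L z := (1 - bessel_phi 2^-1 z) + d' * (bessel_phi (nu + 1) z - bessel_phi nu z)
  + 2 * d' * (1 - d') * (bessel_phi (nu + 1) z / z).
have lo z : 0 < z -> 1 - bessel_phi nu z <= L z.
  move=> z0; have := @bessel_phi_interp R nu d' z nu1 d'01 z0.
  rewrite (_ : nu + d' = 2^-1); last by rewrite /d'; ring.
  exact: interp_ge_sub1.
have bnd1 : bigOy 0 (bessel_phi (nu + 1)).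
  have := bigOyD (bigOyW suc) bnd.
  by apply: bigOy_ext => z _; rewrite subrK.
have hL : bigOy 1 L.
  apply: bigOyD; first apply: bigOyD; last 1 first.
  - by apply: bigOyZ; apply: (bigOyM (n := 0) bnd1 bigOy_inv).
  - apply: bigOy_ext (bigOyZ (-1) phi_asymp_half) => z z0; ring.
  - by apply: bigOyZ.
have nU : bigOy 1 (fun z => `|U z|).
  move: hU => [C [Z [C0 Z1 H]]]; exists C, Z; split=> // z Zz.
  by rewrite normr_id H.
have nL : bigOy 1 (fun z => `|L z|).
  move: hL => [C [Z [C0 Z1 H]]]; exists C, Z; split=> // z Zz.
  by rewrite normr_id H.
apply: (bigOy_le _ (bigOyD nU nL)) => z z0.
rewrite ler_norml; apply/andP; split.
  rewrite lerNl opprB (le_trans (lo z z0))// (le_trans (ler_norm _))//.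
  by rewrite lerDr normr_ge0.
rewrite (le_trans (up z z0))// (le_trans (ler_norm _))//.
by rewrite lerDl normr_ge0.
Qed.

(** Unit steps lead upward from [[-1/2, 1/2]] to every order from -1/2 on. *)
Lemma phi_asymp_gt nu : -1 < nu -> phi_asymp nu.
Proof.
have ge m : forall nu, - 2^-1 <= nu < 2^-1 + m%:R -> phi_asymp nu.
  elim: m => [|m IH] mu.
    by move=> /andP[h1 h2]; apply: phi_asymp_mid; lra.
  move=> /andP[h1 h2]; have [h3|h3] := lerP mu 2^-1.
    by apply: phi_asymp_mid; lra.
  rewrite -[m.+1%:R]natr1 in h2; rewrite -(subrK 1 mu); apply: phi_asympS; first by lra.
  by apply: IH; lra.
have ge' mu : - 2^-1 <= mu -> phi_asymp mu.
  move=> h; apply: (ge (Num.truncn `|mu|).+1); rewrite h andTb.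
  apply: le_lt_trans (ler_norm mu) _; apply: lt_le_trans (truncnS_gt _) _.
  by rewrite lerDr invr_ge0.
(* Orders below -1/2 are reached downward: the recurrence expresses order [nu] through [nu + 1] and
   [nu + 2], which are positive. *)
move=> nu1; have a1 := @ge' (nu + 1) ltac:(lra).
have a2 := @ge' (nu + 1 + 1) ltac:(lra).
have b1 : bigOy 1 (fun z => 2 * (nu + 1) * (bessel_phi (nu + 1) z / z)).
  by apply: bigOyZ; apply: (bigOyM (n := 0) (phi_asymp_bounded a1) bigOy_inv).
apply: bigOy_ext (bigOyD b1 a2) => z z0.
rewrite (bessel_phi_rec nu1 z0).
move: (bessel_phi (nu + 1) z) (bessel_phi (nu + 1 + 1) z) => p q; ring.
Qed.

Lemma bessel_phi_bounded nu : -1 < nu -> bigOy 0 (bessel_phi nu).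
Proof. by move=> h; apply/phi_asymp_bounded/phi_asymp_gt. Qed.

End PhiAsymptotics.

(** * The model integral *)

Section Sinh.
Context {R : realType}.
Implicit Types (t b p v : R).
Notation mu := (@lebesgue_measure R).

Definition sinh t : R := (expR t - expR (- t)) / 2.
Definition cosh t : R := (expR t + expR (- t)) / 2.

Lemma is_derive_sinh t : is_derive t (1:R) sinh (cosh t).
Proof. by eapply isd_eq; [rewrite /sinh; isd|rewrite /cosh /=; field]. Qed.

Lemma is_derive_cosh t : is_derive t (1:R) cosh (sinh t).
Proof. by eapply isd_eq; [rewrite /cosh; isd|rewrite /sinh /=; field]. Qed.

Lemma sinh0 : sinh 0 = 0.
Proof. by rewrite /sinh oppr0 subrr mul0r. Qed.

Lemma ge0_of_derive (f df : R -> R) t : f 0 = 0 ->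
  (forall u, is_derive u (1:R) f (df u)) -> (forall u, 0 < u -> 0 <= df u) ->
  0 <= t -> 0 <= f t.
Proof.
move=> f0 dF df0 t0; rewrite -f0.
apply: (@ger0_derive1_ndecry R f 0) => //.
- by move=> u; rewrite in_itv/= andbT => u0; rewrite (isd_derive1 (dF u)) df0.
- apply: continuous_subspaceT => u; exact: (isd_cont (dF u)).
Qed.

Lemma cosh_ge1 t : 1 <= cosh t.
Proof.
rewrite /cosh expRN; have e0 := expR_gt0 t.
rewrite -subr_ge0.
have -> : (expR t + (expR t)^-1) / 2 - 1 = (expR t - 1) ^+ 2 / (2 * expR t).
  by field; rewrite gt_eqF.
by rewrite divr_ge0 ?sqr_ge0// mulr_ge0// ltW.
Qed.

Lemma le_sinh t : 0 <= t -> t <= sinh t.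
Proof.
move=> t0; rewrite -subr_ge0.
apply: (@ge0_of_derive (fun t => sinh t - t) (fun t => cosh t - 1)) => //.
- by rewrite sinh0 subr0.
- by move=> u; eapply isdD; [exact: is_derive_sinh|isd].
- by move=> u _; rewrite subr_ge0 cosh_ge1.
Qed.

Lemma sinh_gt0 t : 0 < t -> 0 < sinh t.
Proof. by move=> t0; apply: lt_le_trans (le_sinh (ltW t0)). Qed.

Lemma sinh_le_cosh t : 0 <= t -> sinh t <= t * cosh t.
Proof.
move=> t0; rewrite -subr_ge0.
apply: (@ge0_of_derive (fun t => t * cosh t - sinh t) (fun t => t * sinh t)) => //.
- by rewrite sinh0 subr0 mul0r.
- move=> u; eapply isd_eq.
    eapply isdD; [eapply isdM; [isd|exact: is_derive_cosh]|
      eapply isdN; exact: is_derive_sinh].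
  by rewrite /=; ring.
- by move=> u u0; rewrite mulr_ge0 ?ltW// sinh_gt0.
Qed.

Lemma sinh_le_expR t : sinh t <= t * expR t.
Proof.
have e0 := expR_gt0 t.
have h := expR_ge1Dx (- t - t).
have -> : sinh t = expR t * (1 - expR (- t - t)) / 2.
  by rewrite /sinh expRD expRN; field; rewrite gt_eqF.
by rewrite -mulrA [t * _]mulrC ler_pM2l//; lra.
Qed.

(** [hump p v / v] is the derivative of [- p^-1 / (1 + v^p)], so the integral against [dv / v] is
    elementary. The function is invariant under [v -> 1 / v] and decays as a power at both ends. *)
Definition hump p v : R := v `^ p / (1 + v `^ p) ^+ 2.

Lemma hump_ge0 p v : 0 <= hump p v.
Proof. by rewrite divr_ge0 ?powR_ge0 ?exprn_ge0 ?addr_ge0 ?powR_ge0. Qed.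

(** For [v <= 1] the denominator of the hump is at most 4. *)
Lemma powR_le_hump p v : 0 <= p -> 0 < v <= 1 -> v `^ p <= 4 * hump p v.
Proof.
move=> p0 /andP[v0 v1]; have h0 := powR_gt0 p v0.
have h1 : v `^ p <= 1.
  apply: (@le_trans _ _ (1 `^ p)); last by rewrite powR1.
  by apply: (ge0_ler_powR p0) => //; rewrite nnegrE ltW.
rewrite /hump mulrCA ler_peMr ?(ltW h0)//.
rewrite ler_pdivlMr ?exprn_gt0 ?addr_gt0// mul1r.
have : 0 <= v `^ p by exact: ltW.
rewrite expr2; nra.
Qed.

(** Half of the exponential suffices: [e^(k/(2v))] dominates [1 + v^-p] up to a constant, and the
    square of this appears in [hump p v = v^-p / (1 + v^-p)^2]. *)
Lemma powRN_expR_le_hump p k : 0 < p -> 0 < k ->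
  exists2 C, 0 < C & forall v, 0 < v -> v `^ (- p) * expR (- (k / v)) <= C * hump p v.
Proof.
move=> p0 k0; have [C1 C10 h] := @powR_le_expR R p (k / 2) (ltW p0) ltac:(lra).
exists ((C1 + 1) ^+ 2); first by rewrite exprn_gt0// addr_gt0.
move=> v v0; have w0 : 0 < v^-1 by rewrite invr_gt0.
have vp := powR_gt0 p v0.
have {}h : (v `^ p)^-1 + 1 <= (C1 + 1) * expR (k / 2 / v).
  have -> : (v `^ p)^-1 = v^-1 `^ p.
    by rewrite -powRN -mulN1r powRrM powR_inv1 ?ltW.
  rewrite mulrDl mul1r; apply: lerD; first exact: h.
  have kv : 0 <= k / 2 / v by rewrite !divr_ge0 ?ltW.
  by apply: le_trans (expR_ge1Dx _); rewrite lerDl.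
have e0 := expR_gt0 (k / 2 / v).
have -> : expR (- (k / v)) = (expR (k / 2 / v) ^+ 2)^-1.
  rewrite expRN; congr (_^-1); rewrite expr2 -expRD; congr expR.
  by field; rewrite gt_eqF.
rewrite powRN /hump.
have -> : (C1 + 1) ^+ 2 * (v `^ p / (1 + v `^ p) ^+ 2) =
  (v `^ p)^-1 * ((C1 + 1) / ((v `^ p)^-1 + 1)) ^+ 2.
  field; rewrite ?gt_eqF ?addr_gt0//.
rewrite ler_pM2l ?invr_gt0// -exprVn lerXn2r ?nnegrE ?invr_ge0 ?divr_ge0 ?addr_ge0 ?invr_ge0 ?(ltW vp) ?(ltW C10) ?(ltW e0)//.
rewrite ler_pdivlMr ?addr_gt0 ?invr_gt0// mulrC ler_pdivrMr//.
Qed.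

Lemma hump_sinh_integral p b : 0 < p -> 0 < b ->
  measurable_fun `](0:R), +oo[ (fun t => t^-1 * hump p (sinh t / b)) /\
  (\int[mu]_(t in `]0%R, +oo[) (t^-1 * hump p (sinh t / b))%:E <= (p^-1)%:E)%E.
Proof.
move=> p0 b0; pose v t := sinh t / b.
have v0 t : 0 < t -> 0 < v t by move=> t0; rewrite divr_gt0// sinh_gt0.
have dv t : is_derive t (1:R) v (cosh t / b).
  by eapply isd_eq; [rewrite /v; eapply isdM; [exact: is_derive_sinh|isd]|rewrite /=; ring].
pose F t := - p^-1 * (1 + v t `^ p)^-1.
pose f t := hump p (v t) * (cosh t / sinh t).
have w0 t : 0 < 1 + v t `^ p by rewrite ltr_pwDl// powR_ge0.
have dvp t : 0 < t -> is_derive t (1:R) (fun t => v t `^ p)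
    (p * v t `^ p / v t * (cosh t / b)).
  move=> t0; eapply (isdcomp (f := v) (g := fun u => u `^ p)); first exact: dv.
  exact/is_derive_powR_div/v0.
have dF t : 0 < t -> is_derive t (1:R) F (f t).
  move=> t0; eapply isd_eq.
    rewrite /F; eapply isdM; first by isd.
    eapply isdV; first exact/lt0r_neq0/w0.
    by eapply isdD; [isd|exact: dvp].
  rewrite /= /f /hump /v; field.
  by rewrite -/(v t) !gt_eqF ?sinh_gt0.
have cf (g : R -> R) t : 0 < t -> {for t, continuous g} ->
   {for t, continuous (fun t => hump p (v t) * g t)}.
  move=> t0 cg; apply: continuousM => //.
  apply: (isd_cont (f := fun t => hump p (v t))).
  rewrite /hump; eapply isdM; first exact: dvp.
  eapply isdV; first by rewrite expf_neq0// lt0r_neq0.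
  eapply isdX; eapply isdD; first by isd.
  exact: dvp.
have cfV t : 0 < t -> {for t, continuous (fun t : R => t^-1)}.
  by move=> t0; apply: isd_cont; isd; exact: lt0r_neq0.
have mg : measurable_fun `](0:R), +oo[ (fun t => t^-1 * hump p (v t)).
  apply: continuous_measurable0y => t t0.
  have -> : (fun t => t^-1 * hump p (v t)) = (fun t => hump p (v t) * t^-1).
    by apply/funext => u; rewrite mulrC.
  exact/cf/cfV.
have cff t : 0 < t -> {for t, continuous f}.
  move=> t0; apply: cf => //; apply: isd_cont; eapply isdM; first exact: is_derive_cosh.
  eapply isdV; first by rewrite gt_eqF// sinh_gt0.
  exact: is_derive_sinh.
split=> //.
have f0 t : 0 < t -> 0 <= f t.
  move=> t0; rewrite mulr_ge0 ?hump_ge0// divr_ge0 ?(ltW (sinh_gt0 t0))//.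
  exact: le_trans (cosh_ge1 t).
have vp0 : v t `^ p @[t --> 0^'+] --> (0 : R).
  apply: (@squeeze_cvgr _ _ _ _ (fun=> 0) (fun t => t `^ p * (expR t / b) `^ p)).
  - near=> t; have t0 : 0 < t by [].
    rewrite powR_ge0 -powRM ?divr_ge0 ?expR_ge0 ?(ltW t0) ?(ltW b0)//=.
    apply: (ge0_ler_powR (ltW p0)).
    + by rewrite nnegrE ltW// v0.
    + by rewrite nnegrE mulr_ge0 ?divr_ge0 ?expR_ge0 ?(ltW t0) ?(ltW b0).
    + by rewrite /v mulrA ler_wpM2r ?invr_ge0 ?(ltW b0)// sinh_le_expR.
  - exact: cvg_cst.
  - rewrite -[X in _ --> X](mul0r ((expR 0 / b) `^ p)).
    apply: cvgM; first exact: powR_cvg0.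
    apply: cvg_at_right_filter.
    apply: (isd_cont (f := fun t => (expR t / b) `^ p)).
    by eapply isdpow; [rewrite divr_gt0 ?expR_gt0|isd].
have F0 : F t @[t --> 0^'+] --> - p^-1.
  have -> : - p^-1 = - p^-1 * (1 + 0)^-1 by rewrite addr0 invr1 mulr1.
  apply: cvgM; first exact: cvg_cst.
  apply: cvgV; first by rewrite addr0 oner_neq0.
  by apply: cvgD; [exact: cvg_cst|exact: vp0].
have Fy : F t @[t --> +oo] --> (0 : R).
  rewrite -[X in _ --> X](mulr0 (- p^-1)); apply: cvgM; first exact: cvg_cst.
  apply: (@squeeze_cvgr _ _ _ _ (fun=> 0) (fun t => b `^ p * (t `^ p)^-1)).
  - near=> t; have t0 : 0 < t by [].
    have tp := powR_gt0 p t0; have bp := powR_gt0 p b0.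
    rewrite invr_ge0 (ltW (w0 t))/=.
    have -> : b `^ p * (t `^ p)^-1 = (t `^ p / b `^ p)^-1 by rewrite invfM invrK mulrC.
    rewrite lef_pV2 ?posrE ?divr_gt0//.
    have -> : t `^ p / b `^ p = (t / b) `^ p.
      by rewrite powRM ?invr_ge0 ?ltW// -powRN -mulN1r powRrM powR_inv1 ?ltW.
    apply: (@le_trans _ _ (v t `^ p)); last by rewrite lerDr.
    apply: (ge0_ler_powR (ltW p0)).
    + by rewrite nnegrE divr_ge0 ?ltW.
    + by rewrite nnegrE ltW// v0.
    + by rewrite /v ler_wpM2r ?invr_ge0 ?(ltW b0)// le_sinh// ltW.
  - exact: cvg_cst.
  - rewrite -[X in _ --> X](mulr0 (b `^ p)); apply: cvgM; first exact: cvg_cst.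
    apply/gtr0_cvgV0; last exact: cvgy_powR.
    by near=> t; rewrite powR_gt0.
have <- : (\int[mu]_(t in `]0%R, +oo[) (f t)%:E = (p^-1)%:E)%E.
  rewrite -[p^-1]opprK -[- - p^-1]add0r.
  exact: (ge0_FTC0y f0 cff dF F0 Fy).
apply: ge0_le_integral => //.
- by move=> t /itv0yP t0; rewrite lee_fin mulr_ge0 ?invr_ge0 ?hump_ge0// ltW.
- exact/measurable_EFinP.
- by apply/measurable_EFinP; exact: continuous_measurable0y.
move=> t /itv0yP t0; rewrite lee_fin /f mulrC ler_wpM2l ?hump_ge0//.
rewrite ler_pdivlMr ?sinh_gt0// mulrC ler_pdivrMr// mulrC.
exact/sinh_le_cosh/ltW.
Unshelve. all: by end_near. Qed.
End Sinh.

(** * The Riesz kernel away from the diagonal *)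

Section Kernels.
Context {R : realType}.
Implicit Types (alpha t x y q c : R) (k i j l p : nat).

Definition cpar t y : R := y / sinh t.
Definition qpar t : R := expR (- t) / sinh t.

Lemma one_minus_expR t : 1 - expR (- (2 * t)) = 2 * expR (- t) * sinh t.
Proof.
have -> : - (2 * t) = - t + - t by ring.
rewrite /sinh expRD expRN; have := expR_gt0 t => e0; field.
by rewrite gt_eqF.
Qed.

Lemma one_plus_expR t : 1 + expR (- (2 * t)) = 2 * expR (- t) * cosh t.
Proof.
have -> : - (2 * t) = - t + - t by ring.
rewrite /cosh expRD expRN; have := expR_gt0 t => e0; field.
by rewrite gt_eqF.
Qed.

Lemma cosh_sinh t : cosh t = sinh t + expR (- t).
Proof. by rewrite /cosh /sinh; field. Qed.

Definition gauss_expo t x y : R := - (2^-1 * (x ^+ 2 + y ^+ 2) * (cosh t / sinh t)).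

Definition laguerre_pre alpha t y x : R :=
  Num.sqrt ((sinh t)^-1) *
  ((cpar t y * x) `^ 2^-1 * (cpar t y * x / 2) `^ alpha) *
  expR (gauss_expo t x y).

Lemma hermite_kernelE t x y : 0 < t ->
  hermite_kernel t x y = (Num.sqrt pi)^-1 * Num.sqrt ((2 * sinh t)^-1) *
    expR (gauss_expo t x y + cpar t y * x).
Proof.
move=> t0; have s0 := sinh_gt0 t0; have e0 := expR_gt0 (- t).
rewrite /hermite_kernel /gauss_expo /cpar one_minus_expR one_plus_expR.
congr (_ * Num.sqrt _ * expR (- (_ * _) + _)); field; by rewrite !gt_eqF.
Qed.

Lemma cpar_gt0 t y : 0 < t -> 0 < y -> 0 < cpar t y.
Proof. by move=> t0 y0; rewrite divr_gt0// sinh_gt0. Qed.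

Lemma laguerre_kernelE alpha t x y : -1 < alpha -> 0 < t -> 0 < x -> 0 < y ->
  laguerre_kernel alpha t x y =
  laguerre_pre alpha t y x * bessel_fun alpha ((cpar t y * x / 2) ^+ 2).
Proof.
move=> a1 t0 x0 y0; have s0 := sinh_gt0 t0; have e0 := expR_gt0 (- t).
have c0 : 0 < cpar t y * x by rewrite mulr_gt0// cpar_gt0.
rewrite /laguerre_kernel /= one_minus_expR one_plus_expR.
have -> : 2 * x * y * expR (- t) / (2 * expR (- t) * sinh t) = cpar t y * x.
  by rewrite /cpar; field; rewrite !gt_eqF.
have -> : 2 * expR (- t) / (2 * expR (- t) * sinh t) = (sinh t)^-1.
  by field; rewrite !gt_eqF.
have -> : 2 * expR (- t) * cosh t / (2 * expR (- t) * sinh t) = cosh t / sinh t.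
  by field; rewrite !gt_eqF.
rewrite besselIE// -(powR12_sqrt (ltW c0)) /laguerre_pre /gauss_expo.
by move: (bessel_fun _ _) (expR _) (Num.sqrt _) (_ `^ _) (_ `^ _) => *; ring.
Qed.

Lemma laguerre_kernel_phi alpha t x y : -1 < alpha -> 0 < t -> 0 < x -> 0 < y ->
  laguerre_kernel alpha t x y = hermite_kernel t x y * bessel_phi alpha (cpar t y * x).
Proof.
move=> a1 t0 x0 y0; have s0 := sinh_gt0 t0.
rewrite laguerre_kernelE// hermite_kernelE// /laguerre_pre /bessel_phi /bessel_pre.
have p0 : 0 < Num.sqrt pi :> R by rewrite sqrtr_gt0 pi_gt0.
have q0 : 0 < Num.sqrt 2 :> R by rewrite sqrtr_gt0.
have -> : Num.sqrt ((2 * sinh t)^-1) = (Num.sqrt 2)^-1 * Num.sqrt (sinh t)^-1.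
  by rewrite invfM sqrtrM ?invr_ge0// sqrtrV.
have -> : Num.sqrt (2 * pi) = Num.sqrt 2 * Num.sqrt pi :> R by rewrite sqrtrM.
rewrite expRD expRN; have e0 := expR_gt0 (cpar t y * x).
move: (bessel_fun _ _) (expR (gauss_expo _ _ _)) (expR _) e0 (Num.sqrt (sinh t)^-1)
  (_ `^ _) (_ `^ _) (Num.sqrt pi) p0 (Num.sqrt 2) q0 => b g e e0 s r1 r2 p' p0 q q0.
by field; rewrite !gt_eqF.
Qed.

Lemma is_derive_gauss_expo t x y :
  is_derive x (1:R) (fun x => gauss_expo t x y) (- (x * (cosh t / sinh t))).
Proof. by rewrite /gauss_expo; move: (cosh t / sinh t) => h; eapply isd_eq; [isd|rewrite /= ?/id; field]. Qed.

Lemma is_derive_laguerre_pre alpha t y x : 0 < t -> 0 < x -> 0 < y ->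
  is_derive x (1:R) (laguerre_pre alpha t y)
    (((alpha + 2^-1) / x - x * (cosh t / sinh t)) * laguerre_pre alpha t y x).
Proof.
move=> t0 x0 y0; have c0 := cpar_gt0 t0 y0.
eapply isd_eq.
  rewrite /laguerre_pre; eapply isdM; first eapply isdM; first by isd.
    eapply isdM.
      eapply (isdcomp (f := fun x => cpar t y * x) (g := fun u => u `^ 2^-1)); first by isd.
      by apply: is_derive_powR_div; rewrite mulr_gt0.
    eapply (isdcomp (f := fun x => cpar t y * x / 2) (g := fun u => u `^ alpha)); first by isd.
    by apply: is_derive_powR_div; rewrite divr_gt0// mulr_gt0.
  by eapply isdexp; exact: is_derive_gauss_expo.
rewrite /= /laguerre_pre.
move: (expR _) (Num.sqrt _) (_ `^ _) (_ `^ _) (cosh t / sinh t) => g s r1 r2 h.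
by field; rewrite !gt_eqF.
Qed.

Lemma is_derive_hermite_kernel t y x : 0 < t ->
  is_derive x (1:R) (fun x => hermite_kernel t x y)
    ((cpar t y - x * (cosh t / sinh t)) * hermite_kernel t x y).
Proof.
move=> t0.
have -> : (fun x => hermite_kernel t x y) = (fun x => (Num.sqrt pi)^-1 *
    Num.sqrt ((2 * sinh t)^-1) * expR (gauss_expo t x y + cpar t y * x)).
  by apply/funext => u; rewrite hermite_kernelE.
eapply isd_eq.
  eapply isdM; first by isd.
  by eapply isdexp; eapply isdD; [exact: is_derive_gauss_expo|isd].
by rewrite /= hermite_kernelE//; ring.
Qed.

Lemma qparE t : 0 < t -> 1 - cosh t / sinh t = - qpar t.
Proof.
by move=> /sinh_gt0 s0; rewrite cosh_sinh /qpar; field; rewrite gt_eqF.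
Qed.

Lemma laguerre_D_eq alpha (f g : R -> R) d x : 0 < x ->
  (forall u, 0 < u -> f u = g u) -> is_derive x (1:R) g d ->
  laguerre_D alpha f x = (x - (alpha + 2^-1) / x) * g x + d.
Proof.
move=> x0 fg dg; rewrite /laguerre_D fg//.
rewrite (isd_derive1 (isd_eq0y x0 (fun u u0 => esym (fg u u0)) dg)); ring.
Qed.

Lemma hermite_D_eq (f g : R -> R) d x : 0 < x ->
  (forall u, 0 < u -> f u = g u) -> is_derive x (1:R) g d ->
  hermite_D f x = x * g x + d.
Proof.
move=> x0 fg dg; rewrite /hermite_D fg//.
rewrite (isd_derive1 (isd_eq0y x0 (fun u u0 => esym (fg u u0)) dg)); ring.
Qed.

(* Since [q] and [c ^+ 2] have the weight of [x ^- 2], every term is homogeneous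
   of degree [- k]; moreover [i] is odd if [k] is. *)
Inductive laguerre_poly alpha : nat -> (R -> R -> R -> R) -> Prop :=
| laguerre_poly_term k (a : R) i p l : (2 * p + 2 * l = k + i)%N ->
    laguerre_poly alpha k (fun q c x =>
      a * x ^+ i * (c ^+ 2) ^+ p * q ^+ l * bessel_fun (alpha + p%:R) ((c * x / 2) ^+ 2))
| laguerre_poly_add k F G : laguerre_poly alpha k F -> laguerre_poly alpha k G ->
    laguerre_poly alpha k (fun q c x => F q c x + G q c x).

Lemma alpha_nat_gt alpha p : -1 < alpha -> -1 < alpha + p%:R.
Proof. by move=> a1; have := ler0n R p; lra. Qed.

(** [T1] differentiates the power of x, [T2] shifts the Bessel order and brings down [c^2 x / 2],
    and [T3] is [- q x F]. *)
Lemma laguerre_polyS alpha k F : -1 < alpha -> laguerre_poly alpha k F ->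
  exists2 F', laguerre_poly alpha k.+1 F' &
    forall q c x, is_derive x (1:R) (F q c) (F' q c x + q * x * F q c x).
Proof.
move=> a1; elim=> [{}k a i p l e|{}k F1 F2 _ [G1 L1 D1] _ [G2 L2 D2]]; last first.
  exists (fun q c x => G1 q c x + G2 q c x); first exact: laguerre_poly_add.
  by move=> q c x; eapply isd_eq; [eapply isdD; [exact: D1|exact: D2]|ring].
pose T1 (q c x : R) := (a * i%:R) * x ^+ i.-1 * (c ^+ 2) ^+ p * q ^+ l *
   bessel_fun (alpha + p%:R) ((c * x / 2) ^+ 2).
pose T2 (q c x : R) := (a / 2) * x ^+ i.+1 * (c ^+ 2) ^+ p.+1 * q ^+ l *
   bessel_fun (alpha + p.+1%:R) ((c * x / 2) ^+ 2).
pose T3 (q c x : R) := (- a) * x ^+ i.+1 * (c ^+ 2) ^+ p * q ^+ l.+1 *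
   bessel_fun (alpha + p%:R) ((c * x / 2) ^+ 2).
have L23 : laguerre_poly alpha k.+1 (fun q c x => T2 q c x + T3 q c x).
  by apply: laguerre_poly_add; apply: laguerre_poly_term; lia.
have D q c x : is_derive x (1:R) (fun x => a * x ^+ i * (c ^+ 2) ^+ p * q ^+ l *
    bessel_fun (alpha + p%:R) ((c * x / 2) ^+ 2))
    (T1 q c x + (T2 q c x + T3 q c x) + q * x * (a * x ^+ i * (c ^+ 2) ^+ p * q ^+ l *
    bessel_fun (alpha + p%:R) ((c * x / 2) ^+ 2))).
  eapply isd_eq.
    eapply isdM; first by isd.
    eapply (isdcomp (f := fun x => (c * x / 2) ^+ 2)); first by isd.
    exact/is_derive_bessel/alpha_nat_gt.
  rewrite /T1 /T2 /T3 -[p.+1%:R]natr1 [alpha + (_ + 1)]addrA /= ?/id !exprS expr0.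
  move: (bessel_fun (alpha + p%:R) _) (bessel_fun (alpha + p%:R + 1) _) => b0 b1.
  by field.
(* For [i = 0] the term [T1] is zero, but its exponents violate the degree count because [0.-1 = 0];
   it has to be dropped. *)
case: i => [|i] in e T1 T2 T3 L23 D *.
  exists (fun q c x => T2 q c x + T3 q c x); first exact: L23.
  move=> q c x; refine (isd_eq (D q c x) _).
  by rewrite /T1 mulr0 !mul0r add0r.
exists (fun q c x => T1 q c x + (T2 q c x + T3 q c x)); last exact: D.
by apply: laguerre_poly_add L23; apply: laguerre_poly_term; rewrite /=; lia.
Qed.

(** The logarithmic derivative of the prefactor is [(alpha + 1/2) / x - x (1 + q)], which the
    zero-order part of the operator reduces to [- q x]. So the operator turns the cofactor F into
    [F' - q x F]. The same F serves all t, y and x. *)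
Lemma iter_laguerre alpha k : -1 < alpha ->
  exists2 F, laguerre_poly alpha k F & forall t y x, 0 < t -> 0 < y -> 0 < x ->
    iter k (laguerre_D alpha) (fun x' => laguerre_kernel alpha t x' y) x =
    laguerre_pre alpha t y x * F (qpar t) (cpar t y) x.
Proof.
move=> a1; elim: k => [|k [F LF IH]].
  exists (fun q c x => 1 * x ^+ 0 * (c ^+ 2) ^+ 0 * q ^+ 0 *
    bessel_fun (alpha + 0%:R) ((c * x / 2) ^+ 2)); first exact: laguerre_poly_term.
  move=> t y x t0 y0 x0 /=; rewrite laguerre_kernelE// addr0.
  by rewrite !mul1r.
have [F' LF' D] := laguerre_polyS a1 LF; exists F' => // t y x t0 y0 x0.
rewrite iterS.
have dB := is_derive_laguerre_pre alpha t0 x0 y0.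
rewrite (laguerre_D_eq alpha x0 (fun u u0 => IH t y u t0 y0 u0)
  (isdM dB (D (qpar t) (cpar t y) x))).
have -> : cosh t / sinh t = 1 + qpar t by rewrite -[qpar t]opprK -qparE// opprB addrC subrK.
by move: (laguerre_pre _ _ _ _) (F _ _ _) (F' _ _ _) => b f f'; ring.
Qed.

End Kernels.

(** * Growth of the Bessel factor and of the polynomial cofactor *)

Section Nonlocal.
Context {R : realType}.
Implicit Types (alpha nu t x y z q c s X Y : R) (k i j l p N : nat).

(** True growth is [z^(-nu - 1/2) e^z]; the excess [e^(z/8)] pays for the power, which grows when
    [nu < -1/2]. Any rate above 1 and below 5/4 would do, 5/4 being what the Gaussian absorbs when
    one variable is at least twice the other. *)
Lemma bessel_fun_le_expR nu : -1 < nu ->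
  exists2 C : R, 0 < C & forall z, 0 < z ->
    bessel_fun nu ((z / 2) ^+ 2) <= C * expR (9 / 8 * z).
Proof.
move=> nu1; have [C [Z [C0 Z1 H]]] := bessel_phi_bounded nu1.
have [D D0 hD] := @powR_le_expR R 2^-1 8^-1 ltac:(lra) ltac:(lra).
have K0 : 0 < Num.sqrt (2 * pi) :> R by rewrite sqrtr_gt0 mulr_gt0 ?pi_gt0.
have p2 : 0 < 2 `^ nu :> R by rewrite powR_gt0.
pose E := C / Num.sqrt (2 * pi) * 2 `^ nu * D.
have E0 : 0 < E by rewrite !mulr_gt0 ?invr_gt0.
have b0 : 0 < bessel_fun nu ((Z / 2) ^+ 2).
  by apply: bessel_fun_gt0 => //; exact: sqr_ge0.
exists (E + bessel_fun nu ((Z / 2) ^+ 2)); first by rewrite addr_gt0.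
move=> z z0; have e1 : 1 <= expR (9 / 8 * z).
  by apply: le_trans (expR_ge1Dx _); rewrite lerDl mulr_ge0 ?(ltW z0)//; lra.
have [zZ|Zz] := lerP z Z.
  apply: (@le_trans _ _ (bessel_fun nu ((Z / 2) ^+ 2))).
    apply: bessel_fun_homo => //; first exact: sqr_ge0.
    by rewrite lerXn2r ?nnegrE ?divr_ge0 ?ler_wpM2r//; lra.
  rewrite -[leLHS]mulr1 ler_pM ?(ltW b0)//.
  by rewrite lerDr ltW.
have z1 : 1 <= z by lra.
have z2 : 0 < z / 2 by rewrite divr_gt0.
apply: (@le_trans _ _ (E * expR (9 / 8 * z))); last first.
  by rewrite ler_wpM2r ?expR_ge0// lerDl ltW.
have := H z (ltW Zz); rewrite expr0 divr1 ger0_norm ?(ltW (bessel_phi_gt0 nu1 z0))//.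
have w0 : 0 < bessel_pre z * (z / 2) `^ nu by rewrite mulr_gt0 ?bessel_pre_gt0 ?powR_gt0.
rewrite /bessel_phi mulrA mulrC -ler_pdivlMr// => /le_trans; apply.
rewrite ler_pdivrMr//.
have -> : E * expR (9 / 8 * z) * (bessel_pre z * (z / 2) `^ nu) =
  C * (D * expR (8^-1 * z) * z `^ 2^-1 * (2 `^ nu * (z / 2) `^ nu)).
  rewrite /E /bessel_pre.
  have -> : expR (9 / 8 * z) = expR (8^-1 * z) * expR z.
    by rewrite -expRD; congr expR; field.
  rewrite expRN; have := expR_gt0 z => ez.
  by field; rewrite !gt_eqF.
rewrite -[leLHS]mulr1 ler_pM2l//.
rewrite -powRM ?divr_ge0 ?(ltW z0)// mulrC [2 * _]mulrC divfK ?pnatr_eq0//.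
have h1 : z `^ 2^-1 <= D * expR (8^-1 * z) by exact: hD.
have h0 : 0 < z `^ 2^-1 by rewrite powR_gt0.
apply: (@le_trans _ _ (z `^ nu * (z `^ 2^-1 * z `^ 2^-1))); last first.
  by rewrite ler_wpM2l ?powR_ge0// ler_wpM2r// ltW.
rewrite -!powRD ?(gt_eqF z0) ?implybT// -[leLHS](powRr0 z).
by rewrite ler_powR//; lra.
Qed.

Lemma laguerre_exponent_gt0 k i p l : (2 * p + 2 * l = k + i)%N -> odd k -> (0 < i)%N.
Proof. by case: i => // + ok; rewrite addn0 => e; move: ok; rewrite -e oddD !oddM. Qed.

(** Homogeneity: for [x = X s], [c = Y / s] and [q <= s^-2], each term yields [s^-k] times a
    monomial in X and Y. For odd k one factor X is kept apart; the rest goes into a power of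
    [1 + X + Y]. *)
Lemma laguerre_poly_le alpha k F : -1 < alpha -> laguerre_poly alpha k F ->
  exists C N, 0 < C /\ forall s q X Y, 0 < s -> 0 <= q <= s ^- 2 -> 0 < X -> 0 < Y ->
    `|F q (Y / s) (X * s)| <=
    C * (s ^- k * X ^+ odd k * ((1 + X + Y) ^+ N * expR (9 / 8 * (X * Y)))).
Proof.
move=> a1; elim=> [{}k a i p l e|{}k F1 F2 _ [C1 [N1 [C10 H1]]] _ [C2 [N2 [C20 H2]]]];
    last first.
  exists (C1 + C2), (maxn N1 N2); split; first by rewrite addr_gt0.
  move=> s q X Y s0 q0 X0 Y0; apply: (le_trans (ler_normD _ _)); rewrite mulrDl.
  have u1 : 1 <= 1 + X + Y by lra.
  have ms : 0 <= s ^- k * X ^+ odd k.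
    by rewrite mulr_ge0 ?invr_ge0 ?exprn_ge0 ?(ltW s0) ?(ltW X0).
  have le N : (N <= maxn N1 N2)%N ->
      s ^- k * X ^+ odd k * ((1 + X + Y) ^+ N * expR (9 / 8 * (X * Y))) <=
      s ^- k * X ^+ odd k * ((1 + X + Y) ^+ (maxn N1 N2) * expR (9 / 8 * (X * Y))).
    by move=> h; rewrite ler_wpM2l// ler_wpM2r ?expR_ge0// ler_weXn2l.
  apply: lerD.
    apply: (le_trans (H1 s q X Y s0 q0 X0 Y0)).
    by rewrite ler_pM2l// le// leq_maxl.
  apply: (le_trans (H2 s q X Y s0 q0 X0 Y0)).
  by rewrite ler_pM2l// le// leq_maxr.
have [C C0 HC] := bessel_fun_le_expR (alpha_nat_gt p a1).
exists ((`|a| + 1) * C), (i + 2 * p)%N; split.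
  by rewrite mulr_gt0// ltr_wpDl.
move=> s q X Y s0 /andP[q0 q1] X0 Y0.
have u1 : 1 <= 1 + X + Y by lra.
have -> : Y / s * (X * s) = X * Y by field; rewrite gt_eqF.
have XY0 : 0 < X * Y by rewrite mulr_gt0.
have bp : 0 < bessel_fun (alpha + p%:R) ((X * Y / 2) ^+ 2).
  by apply: bessel_fun_gt0; [exact: alpha_nat_gt|exact: sqr_ge0].
rewrite !normrM !normrX (gtr0_norm bp) [`|Y / s|]gtr0_norm ?divr_gt0//.
rewrite [`|X * s|]gtr0_norm ?mulr_gt0// (ger0_norm q0).
have ql : q ^+ l <= (s ^+ (2 * l))^-1.
  rewrite exprM -exprVn lerXn2r ?nnegrE ?invr_ge0 ?exprn_ge0 ?(ltW s0)//.
have Xi : X ^+ i <= X ^+ odd k * (1 + X + Y) ^+ i.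
  have Xu : X <= 1 + X + Y by lra.
  have [ok|ok] := boolP (odd k); last first.
    by rewrite expr0 mul1r lerXn2r ?nnegrE ?(ltW X0)//; lra.
  have [i' ->] : exists i', i = i'.+1.
    by exists i.-1; rewrite prednK// (laguerre_exponent_gt0 e).
  rewrite !exprS expr0 mulr1 ler_pM2l//.
  apply: (@le_trans _ _ ((1 + X + Y) ^+ i')).
    by rewrite lerXn2r ?nnegrE ?(ltW X0)//; lra.
  by rewrite ler_peMl// exprn_ge0; lra.
have Yp : Y ^+ (2 * p) <= (1 + X + Y) ^+ (2 * p).
  by rewrite lerXn2r ?nnegrE ?(ltW Y0)//; lra.
apply: (@le_trans _ _ ((`|a| + 1) * (X ^+ i * s ^+ i) * ((Y / s) ^+ 2) ^+ p *
   (s ^+ (2 * l))^-1 * (C * expR (9 / 8 * (X * Y))))).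
  apply: ler_pM; [by nneg|exact: ltW| |by rewrite HC].
  apply: ler_pM; [by nneg|exact: exprn_ge0| |exact: ql].
  apply: ler_wpM2r; first by nneg.
  rewrite exprMn; apply: ler_wpM2r; first by nneg.
  by rewrite lerDl.
have -> : (`|a| + 1) * (X ^+ i * s ^+ i) * ((Y / s) ^+ 2) ^+ p *
   (s ^+ (2 * l))^-1 * (C * expR (9 / 8 * (X * Y))) =
   (`|a| + 1) * C * (s ^- k * (X ^+ i * Y ^+ (2 * p)) * expR (9 / 8 * (X * Y))).
  have -> : s ^- k = s ^+ i / (s ^+ (2 * p) * s ^+ (2 * l)).
    rewrite -exprD e exprD; field.
    by rewrite !expf_neq0// gt_eqF.
  rewrite -exprM exprMn exprVn; field.
  by rewrite !expf_neq0// gt_eqF.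
rewrite ler_pM2l; last by rewrite mulr_gt0// ltr_wpDl.
rewrite -!mulrA ler_wpM2l ?invr_ge0 ?exprn_ge0 ?(ltW s0)//.
rewrite !mulrA ler_wpM2r ?expR_ge0// exprD mulrA.
by rewrite ler_pM ?exprn_ge0 ?(ltW X0) ?(ltW Y0).
Qed.

End Nonlocal.

(** * Majorant of the Laguerre integrand where the Gaussian absorbs the Bessel growth *)

Section NonlocalIntegrand.
Context {R : realType}.
Implicit Types (alpha nu t x y z q c s X Y : R) (k i j l p N : nat).

Lemma expr_le_expR N (e : R) : 0 < e ->
  exists2 C : R, 0 < C & forall v, 0 < v -> v ^+ N <= C * expR (e * v).
Proof.
move=> e0; have [C C0 H] := @powR_le_expR R N%:R e (ler0n _ _) e0.
by exists C => // v v0; rewrite -powR_mulrn ?(ltW v0)// H.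
Qed.

(** If one variable is at least twice the other, [X Y <= 2/5 (X^2 + Y^2)], and
    [9/8 * 2/5 = 1/2 - 1/20]. Of the remaining 1/20 one half absorbs the polynomial and the other
    half is kept. *)
Lemma gauss_absorb N (Z : R) : exists2 C : R, 0 < C & forall X Y, 0 < X -> 0 < Y ->
  [\/ 2 * X <= Y, 2 * Y <= X | X * Y <= Z] ->
  (1 + X + Y) ^+ N * expR (9 / 8 * (X * Y)) * expR (- (2^-1 * (X ^+ 2 + Y ^+ 2))) <=
  C * expR (- (40^-1 * (X ^+ 2 + Y ^+ 2))).
Proof.
have [C C0 H] := @expr_le_expR N 40^-1 ltac:(lra).
exists (2 ^+ N * C * expR (40^-1) * expR (9 / 8 * `|Z|)) => [|X Y X0 Y0 h].
  by posi.
pose W := X ^+ 2 + Y ^+ 2.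
have W0 : 0 <= W by rewrite /W addr_ge0 ?sqr_ge0.
have u : 1 + X + Y <= 2 * (1 + W).
  by rewrite /W !expr2; have := sqr_ge0 (X - 1); have := sqr_ge0 (Y - 1); rewrite !expr2; nra.
have uN : (1 + X + Y) ^+ N <= 2 ^+ N * C * expR (40^-1) * expR (40^-1 * W).
  apply: (@le_trans _ _ ((2 * (1 + W)) ^+ N)).
    rewrite lerXn2r ?nnegrE//; lra.
  have e : expR 40^-1 * expR (40^-1 * W) = expR (40^-1 * (1 + W)).
    by rewrite -expRD; congr expR; ring.
  rewrite exprMn -!mulrA e ler_pM2l ?exprn_gt0//.
  by apply: H; lra.
have ex : 9 / 8 * (X * Y) - 2^-1 * W <= 9 / 8 * `|Z| - 20^-1 * W.
  have nZ := normr_ge0 Z; have Zn := ler_norm Z.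
  case: h => h; rewrite /W !expr2.
  - have : 0 <= (Y - 2 * X) * (2 * Y - X) by rewrite mulr_ge0//; lra.
    nra.
  - have : 0 <= (X - 2 * Y) * (2 * X - Y) by rewrite mulr_ge0//; lra.
    nra.
  - by have := sqr_ge0 X; have := sqr_ge0 Y; rewrite !expr2; nra.
rewrite -mulrA -expRD -/W.
apply: (@le_trans _ _ (2 ^+ N * C * expR (40^-1) * expR (40^-1 * W) *
   expR (9 / 8 * `|Z| - 20^-1 * W))).
  by apply: ler_pM; [nneg|nneg|exact: uN|rewrite ler_expR].
rewrite -!mulrA !ler_pM2l//; try posi.
rewrite -!expRD ler_expR; lra.
Qed.

Lemma powR_sinh_le (t : R) k : 0 < t ->
  t `^ (k%:R / 2 - 1) <= t^-1 * Num.sqrt (sinh t) ^+ k.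
Proof.
move=> t0; have s0 := sinh_gt0 t0.
rewrite powRB ?(gt_eqF t0) ?implybT// powRr1 ?(ltW t0)// mulrC ler_pM2l ?invr_gt0//.
rewrite -powR12_sqrt ?(ltW s0)// -powR_mulrn ?powR_ge0// -powRrM mulrC.
apply: ge0_ler_powR; rewrite ?nnegrE ?(ltW s0) ?(ltW t0)//.
exact/le_sinh/ltW.
Qed.

(** The scale [b] is free below [x^2 + y^2], so that the same estimate yields weights in x or in y.
    The third regime, bounded argument of the Bessel function, is meant for points near the
    diagonal. *)
Lemma laguerre_integrand_le alpha k (Z : R) : -1 < alpha ->
  let p := alpha + 1 + (odd k)%:R / 2 in
  exists2 C : R, 0 < C & forall t x y b, 0 < t -> 0 < x -> 0 < y -> 0 < b ->
  b <= x ^+ 2 + y ^+ 2 -> [\/ 2 * x <= y, 2 * y <= x | cpar t y * x <= Z] ->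
  `|t `^ (k%:R / 2 - 1) *
    iter k (laguerre_D alpha) (fun x' => laguerre_kernel alpha t x' y) x| <=
  C * ((x * y) `^ (alpha + 2^-1) * x ^+ odd k * b `^ (- p)) *
    (t^-1 * hump p (sinh t / b)).
Proof.
move=> a1 p; have p0 : 0 < p.
  by rewrite /p; case: (odd k); rewrite /= ?mul0r ?mul1r; lra.
have [F LF E] := iter_laguerre k a1.
have [C1 [N [C10 H1]]] := laguerre_poly_le a1 LF.
have [C2 C20 H2] := gauss_absorb N Z.
have [C3 C30 H3] := @powRN_expR_le_hump R p 40^-1 p0 ltac:(lra).
exists (2 `^ (- alpha) * C1 * C2 * C3); first by posi.
move=> t x y b t0 x0 y0 b0 bW reg.
have s0 := sinh_gt0 t0; pose s := Num.sqrt (sinh t).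
have ss : s ^+ 2 = sinh t by rewrite sqr_sqrtr// ltW.
have sp : 0 < s by rewrite sqrtr_gt0.
pose X := x / s; pose Y := y / s.
have X0 : 0 < X by rewrite divr_gt0.
have Y0 : 0 < Y by rewrite divr_gt0.
have cE : cpar t y = Y / s by rewrite /cpar /Y -ss; field; rewrite gt_eqF.
have xE : x = X * s by rewrite /X divfK// gt_eqF.
have yE : y = Y * s by rewrite /Y divfK// gt_eqF.
have zE : cpar t y * x = X * Y by rewrite cE {1}xE; field; rewrite gt_eqF.
have q0 : 0 <= qpar t <= s ^- 2.
  rewrite /qpar ss divr_ge0 ?expR_ge0 ?(ltW s0)//=.
  rewrite -[leRHS]mul1r ler_wpM2r ?invr_ge0 ?(ltW s0)//.
  by rewrite -expR0 ler_expR lerNl oppr0 ltW.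
have reg' : [\/ 2 * X <= Y, 2 * Y <= X | X * Y <= Z].
  case: reg => h; [apply: Or31|apply: Or32|apply: Or33].
  - by rewrite /X /Y mulrA ler_wpM2r ?invr_ge0 ?(ltW sp).
  - by rewrite /X /Y mulrA ler_wpM2r ?invr_ge0 ?(ltW sp).
  - by rewrite -zE.
have {}H1 := H1 s _ X Y sp q0 X0 Y0; rewrite -cE -xE in H1.
have {}H2 := H2 X Y X0 Y0 reg'.
have v0 : 0 < sinh t / b by rewrite divr_gt0.
have {}H3 := H3 _ v0.
rewrite E// normrM ger0_norm ?powR_ge0// normrM.
have Bpos : 0 < laguerre_pre alpha t y x.
  by rewrite /laguerre_pre zE; posi; rewrite invr_gt0.
rewrite (gtr0_norm Bpos).
have Ble : laguerre_pre alpha t y x <= s^-1 * (2 `^ (- alpha) * (X * Y) `^ (alpha + 2^-1)) *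
    expR (- (2^-1 * (X ^+ 2 + Y ^+ 2))).
  rewrite /laguerre_pre zE sqrtrV ?(ltW s0)//.
  have -> : (X * Y) `^ 2^-1 * (X * Y / 2) `^ alpha =
      2 `^ (- alpha) * (X * Y) `^ (alpha + 2^-1).
    have XY0 : 0 < X * Y by rewrite mulr_gt0.
    have -> : (X * Y / 2) `^ alpha = (X * Y) `^ alpha * 2^-1 `^ alpha.
      by rewrite powRM ?invr_ge0 ?(ltW XY0).
    rewrite powRD ?(gt_eqF XY0) ?implybT//.
    have -> : (2^-1 : R) `^ alpha = 2 `^ (- alpha).
      by rewrite -[2^-1]powR_inv1// -powRrM mulN1r.
    by ring.
  apply: ler_wpM2l; first by nneg.
  rewrite ler_expR /gauss_expo lerN2.
  have -> : 2^-1 * (x ^+ 2 + y ^+ 2) * (cosh t / sinh t) =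
      2^-1 * (X ^+ 2 + Y ^+ 2) * cosh t.
    by rewrite xE yE -ss; field; rewrite gt_eqF.
  by rewrite ler_peMr ?cosh_ge1//; nneg; exact: sqr_ge0.
have e3 : expR (- (40^-1 * (X ^+ 2 + Y ^+ 2))) <= expR (- (40^-1 / (sinh t / b))).
  rewrite ler_expR lerN2; apply: ler_wpM2l => //.
  rewrite invf_div ler_pdivrMr//; apply: (le_trans bW).
  by rewrite xE yE -ss le_eqVlt; apply/orP; left; apply/eqP; ring.
have XY0 : 0 < X * Y by rewrite mulr_gt0.
(* The exponent [p] collects the negative powers of [sinh t]: 1/2 from the square root,
   [alpha + 1/2] from [X Y], and another 1/2 from X when k is odd. *)
have ePow : s^-1 * (X * Y) `^ (alpha + 2^-1) * X ^+ odd k =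
    (x * y) `^ (alpha + 2^-1) * x ^+ odd k * b `^ (- p) * (sinh t / b) `^ (- p).
  have sE : s = sinh t `^ 2^-1 by rewrite powR12_sqrt// ltW.
  have bE : b `^ (- p) * (sinh t / b) `^ (- p) = sinh t `^ (- p).
    by rewrite -(powRM _ (ltW b0) (ltW v0)) [b * _]mulrC divfK// gt_eqF.
  have sp' : sinh t `^ (- p) =
      s^-1 * (sinh t `^ (alpha + 2^-1))^-1 * (s ^+ odd k)^-1.
    rewrite -powR_mulrn ?(ltW sp)// sE -powRrM -!powRN -!powRD ?(gt_eqF s0) ?implybT//.
    by congr (_ `^ _); rewrite /p; field.
  have xyE : x * y = X * Y * sinh t by rewrite xE yE -ss; ring.
  have -> : (x * y) `^ (alpha + 2^-1) * x ^+ odd k * b `^ (- p) * (sinh t / b) `^ (- p) =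
    (x * y) `^ (alpha + 2^-1) * x ^+ odd k * (b `^ (- p) * (sinh t / b) `^ (- p)) by rewrite !mulrA.
  rewrite bE sp' xyE (powRM _ (ltW XY0) (ltW s0)).
  rewrite (_ : x ^+ odd k = X ^+ odd k * s ^+ odd k); last by rewrite -exprMn -xE.
  have w0 : sinh t `^ (alpha + 2^-1) != 0 by rewrite gt_eqF// powR_gt0.
  move: (_ `^ _) (sinh t `^ _) w0 => u1 u2 w0.
  by field; rewrite w0 ?expf_neq0 ?gt_eqF.
pose A := 2 `^ (- alpha) * C1 * (s^-1 * (X * Y) `^ (alpha + 2^-1) * X ^+ odd k) * t^-1.
have A0 : 0 < A by rewrite /A; posi.
apply: (@le_trans _ _ (A * ((1 + X + Y) ^+ N * expR (9 / 8 * (X * Y)) *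
    expR (- (2^-1 * (X ^+ 2 + Y ^+ 2)))))).
  apply: (@le_trans _ _ ((t^-1 * s ^+ k) * (s^-1 * (2 `^ (- alpha) * (X * Y) `^ (alpha + 2^-1)) *
    expR (- (2^-1 * (X ^+ 2 + Y ^+ 2))) * (C1 * (s ^- k * X ^+ odd k *
    ((1 + X + Y) ^+ N * expR (9 / 8 * (X * Y)))))))).
    apply: ler_pM; [exact: powR_ge0| |exact: powR_sinh_le|].
      by apply: mulr_ge0; [exact: ltW|exact: normr_ge0].
    by apply: ler_pM => //; [exact: ltW].
  rewrite le_eqVlt; apply/orP; left; apply/eqP; rewrite /A.
  move: (expR _) (expR _) (_ `^ _) (_ `^ _) => u1 u2 u3 u4.
  by field; rewrite expf_neq0 ?gt_eqF.
apply: (@le_trans _ _ (A * (C2 * expR (- (40^-1 / (sinh t / b)))))).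
  by rewrite ler_pM2l//; apply: (le_trans H2); rewrite ler_pM2l.
rewrite /A ePow.
pose D := 2 `^ (- alpha) * C1 * C2 * ((x * y) `^ (alpha + 2^-1) * x ^+ odd k * b `^ (- p)) * t^-1.
have D0 : 0 < D by rewrite /D; posi.
apply: (@le_trans _ _ (D * ((sinh t / b) `^ (- p) * expR (- (40^-1 / (sinh t / b)))))).
  rewrite le_eqVlt; apply/orP; left; apply/eqP; rewrite /D; ring.
apply: (@le_trans _ _ (D * (C3 * hump p (sinh t / b)))); first by rewrite ler_pM2l.
rewrite le_eqVlt; apply/orP; left; apply/eqP; rewrite /D; ring.
Qed.
End NonlocalIntegrand.

(** * The Riesz kernel near the diagonal *)

Section Local.
Context {R : realType}.
Implicit Types (alpha nu t x y z q c s X Y : R) (k i j l p N : nat).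

(* [f] and [h] are the factors by which the Hermite kernel is multiplied after [k]
   steps, for the Laguerre and for the Hermite kernel respectively. *)
Inductive local_pair alpha : nat -> (R -> R -> R -> R) -> (R -> R -> R -> R) -> Prop :=
| local_pair_main k (a : R) i l : (2 * i + l = k)%N -> local_pair alpha k
    (fun q c x => a * q ^+ i * (c - q * x) ^+ l * bessel_phi alpha (c * x))
    (fun q c x => a * q ^+ i * (c - q * x) ^+ l)
| local_pair_rem k (a : R) i l j (eta : R -> R) : (2 * i + l + j.+1 = k)%N ->
    (forall m, symbol 0 m eta) -> local_pair alpha k
    (fun q c x => a * q ^+ i * (c - q * x) ^+ l * x ^- j.+1 * eta (c * x))
    (fun q c x => 0)
| local_pair_add k f h f' h' : local_pair alpha k f h -> local_pair alpha k f' h' ->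
    local_pair alpha k (fun q c x => f q c x + f' q c x) (fun q c x => h q c x + h' q c x).

Lemma symbol_theta (eta : R -> R) : (forall m, symbol 0 m eta) ->
  forall m, symbol 0 m (theta eta).
Proof. by move=> h m; have [_ [_]] := h m.+1. Qed.

Lemma symbol_derivable (eta : R -> R) z : (forall m, symbol 0 m eta) -> 0 < z ->
  is_derive z (1:R) eta (theta eta z / z).
Proof.
move=> h z0; have [_ [d _]] := h 1%N.
by apply: (isd_eq (derivable_isd (d z z0))); rewrite /theta mulrC mulKf// gt_eqF.
Qed.

Lemma is_derive_local_coef (a q c x : R) i l : is_derive x (1:R)
  (fun x => a * q ^+ i * (c - q * x) ^+ l)
  (- (a * l%:R) * q ^+ i.+1 * (c - q * x) ^+ l.-1).
Proof. by eapply isd_eq; [isd|rewrite /= ?/id !exprS; ring]. Qed.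

(** The logarithmic derivative of the Hermite kernel is [c - q x - x]; the operators cancel [- x],
    and [D_alpha] also contributes [- (alpha + 1/2) / x]. This term and the derivative of
    [phi (c x)], which is [theta phi / x], carry a factor [1 / x] and therefore enter the remainder,
    where boundedness is enough. *)
Lemma local_pairS alpha k f h : -1 < alpha -> local_pair alpha k f h ->
  exists f' h', local_pair alpha k.+1 f' h' /\ forall q c x, 0 < c -> 0 < x ->
    is_derive x (1:R) (f q c)
      (f' q c x - (c - q * x) * f q c x + (alpha + 2^-1) / x * f q c x) /\
    is_derive x (1:R) (h q c) (h' q c x - (c - q * x) * h q c x).
Proof.
move=> a1; have sphi m : symbol 0 m (bessel_phi alpha).
  by have [] := symbol_bessel_phi m a1 (bessel_phi_bounded a1).
elim=> [{}k a i l e|{}k a i l j eta e se|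
  {}k f1 h1 f2 h2 _ [f1' [h1' [L1 D1]]] _ [f2' [h2' [L2 D2]]]]; last first.
- exists (fun q c x => f1' q c x + f2' q c x), (fun q c x => h1' q c x + h2' q c x).
  split; first exact: local_pair_add.
  move=> q c x c0 x0; have [d1 e1] := D1 q c x c0 x0; have [d2 e2] := D2 q c x c0 x0.
  split; [apply: (isd_eq (isdD d1 d2))|apply: (isd_eq (isdD e1 e2))]; ring.
(* [j.+1] comes from differentiating [x ^- j.+1], and [alpha + 2^-1] from the operator. *)
- pose eta' z := theta eta z + (- (j.+1%:R + alpha + 2^-1)) * eta z.
  have se' m : symbol 0 m eta'.
    by apply: symbolD; [exact: symbol_theta|apply: symbolZ; exact: se].
  pose T1 (q c x : R) := a * q ^+ i * (c - q * x) ^+ l.+1 * x ^- j.+1 * eta (c * x).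
  pose T2 (q c x : R) := (- (a * l%:R)) * q ^+ i.+1 * (c - q * x) ^+ l.-1 * x ^- j.+1 * eta (c * x).
  pose T3 (q c x : R) := a * q ^+ i * (c - q * x) ^+ l * x ^- j.+2 * eta' (c * x).
  have L13 : local_pair alpha k.+1 (fun q c x => T1 q c x + T3 q c x)
      (fun q c x => 0 + 0).
    apply: local_pair_add.
      by apply: (@local_pair_rem _ _ a i l.+1 j eta) => //; lia.
    by apply: (@local_pair_rem _ _ a i l j.+1 eta') => //; lia.
  have D q c x : 0 < c -> 0 < x -> is_derive x (1:R)
     (fun x => a * q ^+ i * (c - q * x) ^+ l * x ^- j.+1 * eta (c * x))
     (T2 q c x + (T1 q c x + T3 q c x) -
      (c - q * x) * (a * q ^+ i * (c - q * x) ^+ l * x ^- j.+1 * eta (c * x)) +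
      (alpha + 2^-1) / x * (a * q ^+ i * (c - q * x) ^+ l * x ^- j.+1 * eta (c * x))).
    move=> c0 x0; eapply isd_eq.
      eapply isdM; first eapply isdM; first exact: is_derive_local_coef.
        by eapply (isdV (f := fun x => x ^+ j.+1)); [rewrite expf_neq0// gt_eqF|isd].
      eapply (isdcomp (f := fun x => c * x)); first by isd.
      by apply: symbol_derivable => //; rewrite mulr_gt0.
    rewrite /= /T1 /T2 /T3 /eta' ?/id.
    move: (eta _) (theta eta _) => u v; rewrite !exprS.
    by field; rewrite ?expf_neq0 ?gt_eqF.
  (* For [l = 0] the term [T2] vanishes and, because [0.-1 = 0], does not fit the weight count. *)
  case: l => [|l] in e T1 T2 T3 L13 D *.
    exists (fun q c x => T1 q c x + T3 q c x), (fun q c x => 0 + 0); split; first exact: L13.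
    move=> q c x c0 x0; split; last by apply: (isd_eq (isdC 0 x)); ring.
    refine (isd_eq (D q c x c0 x0) _).
    by rewrite /T2 mulr0 oppr0 !mul0r add0r.
  exists (fun q c x => T2 q c x + (T1 q c x + T3 q c x)), (fun q c x => 0 + (0 + 0)); split.
    apply: local_pair_add L13.
    by apply: (@local_pair_rem _ _ _ i.+1 l j eta) => //; lia.
  move=> q c x c0 x0; split; first exact: D.
  by apply: (isd_eq (isdC 0 x)); ring.
pose eta' z := theta (bessel_phi alpha) z + (- (alpha + 2^-1)) * bessel_phi alpha z.
have se' m : symbol 0 m eta'.
  by apply: symbolD; [exact: symbol_theta|apply: symbolZ; exact: sphi].
pose t1 (q c x : R) := a * q ^+ i * (c - q * x) ^+ l.+1.
pose t2 (q c x : R) := (- (a * l%:R)) * q ^+ i.+1 * (c - q * x) ^+ l.-1.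
pose T3 (q c x : R) := a * q ^+ i * (c - q * x) ^+ l * x ^- 1 * eta' (c * x).
pose f13 q c x := t1 q c x * bessel_phi alpha (c * x) + T3 q c x.
pose h13 q c x := t1 q c x + 0.
have L13 : local_pair alpha k.+1 f13 h13.
  apply: local_pair_add.
    by apply: (@local_pair_main _ _ a i l.+1); lia.
  by apply: (@local_pair_rem _ _ a i l 0 eta') => //; lia.
have D q c x : 0 < c -> 0 < x -> is_derive x (1:R)
   (fun x => a * q ^+ i * (c - q * x) ^+ l * bessel_phi alpha (c * x))
   (t2 q c x * bessel_phi alpha (c * x) + f13 q c x -
    (c - q * x) * (a * q ^+ i * (c - q * x) ^+ l * bessel_phi alpha (c * x)) +
    (alpha + 2^-1) / x * (a * q ^+ i * (c - q * x) ^+ l * bessel_phi alpha (c * x))).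
  move=> c0 x0; eapply isd_eq.
    eapply isdM; first exact: is_derive_local_coef.
    eapply (isdcomp (f := fun x => c * x)); first by isd.
    by apply: symbol_derivable => //; rewrite mulr_gt0.
  rewrite /= /f13 /t1 /t2 /T3 /eta' ?/id.
  move: (bessel_phi alpha _) (theta (bessel_phi alpha) _) => u v; rewrite !exprS expr0.
  by field; rewrite ?gt_eqF.
have D' q c x : is_derive x (1:R) (fun x => a * q ^+ i * (c - q * x) ^+ l)
   (t2 q c x + h13 q c x - (c - q * x) * (a * q ^+ i * (c - q * x) ^+ l)).
  apply: (isd_eq (is_derive_local_coef a q c x i l)).
  by rewrite /t2 /h13 /t1 !exprS; ring.
case: l => [|l] in e t1 t2 T3 f13 h13 L13 D D' *.
  exists f13, h13; split; first exact: L13.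
  move=> q c x c0 x0; split.
    refine (isd_eq (D q c x c0 x0) _).
    by rewrite /t2 mulr0 oppr0 !mul0r add0r.
  refine (isd_eq (D' q c x) _).
  by rewrite /t2 mulr0 oppr0 !mul0r add0r.
exists (fun q c x => t2 q c x * bessel_phi alpha (c * x) + f13 q c x),
  (fun q c x => t2 q c x + h13 q c x); split.
  apply: local_pair_add L13.
  by apply: (@local_pair_main _ _ _ i.+1 l); lia.
by move=> q c x c0 x0; split; [exact: D|exact: D'].
Qed.

Lemma iter_local alpha k : -1 < alpha ->
  exists f h, local_pair alpha k f h /\ forall t y x, 0 < t -> 0 < y -> 0 < x ->
    iter k (laguerre_D alpha) (fun x' => laguerre_kernel alpha t x' y) x =
      hermite_kernel t x y * f (qpar t) (cpar t y) x /\
    iter k (@hermite_D R) (fun x' => hermite_kernel t x' y) x =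
      hermite_kernel t x y * h (qpar t) (cpar t y) x.
Proof.
move=> a1; elim: k => [|k [f [h [L IH]]]].
  exists (fun q c x => 1 * q ^+ 0 * (c - q * x) ^+ 0 * bessel_phi alpha (c * x)).
  exists (fun q c x => 1 * q ^+ 0 * (c - q * x) ^+ 0); split.
    exact: local_pair_main.
  move=> t y x t0 y0 x0 /=; rewrite laguerre_kernel_phi//.
  by rewrite !mul1r mulr1.
have [f' [h' [L' D]]] := local_pairS a1 L; exists f', h'; split=> // t y x t0 y0 x0.
have [Df Dh] := D (qpar t) (cpar t y) x (cpar_gt0 t0 y0) x0.
have dW := is_derive_hermite_kernel y x t0.
have chE : cosh t / sinh t = 1 + qpar t by rewrite -[qpar t]opprK -qparE// opprB addrC subrK.
rewrite !iterS; split.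
  rewrite (laguerre_D_eq alpha x0 (fun u u0 => (IH t y u t0 y0 u0).1) (isdM dW Df)) chE.
  move: (hermite_kernel _ _ _) (f _ _ _) (f' _ _ _) => w u v.
  by ring.
rewrite (hermite_D_eq x0 (fun u u0 => (IH t y u t0 y0 u0).2) (isdM dW Dh)) chE.
move: (hermite_kernel _ _ _) (h _ _ _) (h' _ _ _) => w u v.
by ring.
Qed.

End Local.

(** * Gaussian bounds for the Hermite terms and for the difference *)

Section LocalBounds.
Context {R : realType}.
Implicit Types (alpha t x y z q c s : R) (k i j l : nat).

Definition near_gauss t x y : R := expR (- ((x - y) ^+ 2 / (16 * sinh t))).

Lemma expr_gauss_le l : exists2 C : R, 0 < C & forall v, 0 <= v ->
  v ^+ l * expR (- (v ^+ 2 / 8)) <= C.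
Proof.
have [C C0 H] := @expr_le_expR R l 8^-1 ltac:(lra).
exists (C * expR 8^-1) => [|v v0]; first by posi.
have v1 : 0 < 1 + v ^+ 2 by rewrite ltr_pwDl// sqr_ge0.
apply: (@le_trans _ _ ((1 + v ^+ 2) ^+ l * expR (- (v ^+ 2 / 8)))).
  rewrite ler_wpM2r ?expR_ge0// lerXn2r ?nnegrE ?(ltW v1)//.
  by have := sqr_ge0 (v - 1); rewrite !expr2; nra.
apply: (@le_trans _ _ (C * expR (8^-1 * (1 + v ^+ 2)) * expR (- (v ^+ 2 / 8)))).
  by rewrite ler_wpM2r ?expR_ge0// H.
rewrite -!mulrA ler_pM2l// -expRD ler_expR le_eqVlt; apply/orP; left; apply/eqP.
by field.
Qed.

(* Completing squares: with [r = e^-t], the exponent of the kernel is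
   [- ((x - r y)^2 + (y - r x)^2) / (4 r sinh t)], and [u = (y - r x) / sinh t]. *)
Lemma hermite_weight_le i l : exists2 C : R, 0 < C & forall t x y,
  0 < t -> 0 < x -> 0 < y ->
  hermite_kernel t x y * (qpar t ^+ i * `|cpar t y - qpar t * x| ^+ l) <=
  C * (Num.sqrt (sinh t) ^- (2 * i + l + 1) * near_gauss t x y).
Proof.
have [C C0 H] := expr_gauss_le l.
exists ((Num.sqrt pi)^-1 * (Num.sqrt 2)^-1 * C) => [|t x y t0 x0 y0]; first by posi.
have s0 := sinh_gt0 t0; rewrite hermite_kernelE//.
pose r := expR (- t); have r0 : 0 < r by exact: expR_gt0.
have r1 : r <= 1 by rewrite /r -expR0 ler_expR lerNl oppr0 ltW.
set s := Num.sqrt (sinh t).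
have ss : sinh t = s ^+ 2 by rewrite sqr_sqrtr// ltW.
have sp : 0 < s by rewrite sqrtr_gt0.
have -> : Num.sqrt ((2 * sinh t)^-1) = (Num.sqrt 2)^-1 * s^-1.
  by rewrite invfM sqrtrM ?invr_ge0// !sqrtrV// ltW.
pose v := `|y - r * x| / s.
have v0 : 0 <= v by rewrite divr_ge0// ltW.
have uE : `|cpar t y - qpar t * x| = v / s.
  rewrite /cpar /qpar -/r ss (_ : y / s ^+ 2 - r / s ^+ 2 * x = (y - r * x) / s ^+ 2).
    have n0 : 0 <= (s ^+ 2)^-1 by nneg.
    by rewrite normrM (ger0_norm n0) /v; field; rewrite gt_eqF.
  by field; rewrite gt_eqF.
have qi : qpar t ^+ i <= s ^- (2 * i).
  rewrite exprM -exprVn lerXn2r ?nnegrE ?invr_ge0 ?exprn_ge0 ?(ltW sp)//.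
    by rewrite divr_ge0 ?expR_ge0// ltW.
  rewrite /qpar ss -/r -[leRHS]mul1r ler_wpM2r ?invr_ge0 ?exprn_ge0 ?(ltW sp)//.
have chE : cosh t = s ^+ 2 + r by rewrite -ss cosh_sinh.
have rE : 2 * r * s ^+ 2 = 1 - r ^+ 2.
  rewrite -ss /sinh /r expRN; field; rewrite gt_eqF ?expR_gt0//.
have ex : gauss_expo t x y + cpar t y * x <=
    - (v ^+ 2 / 8) + - ((x - y) ^+ 2 / (16 * sinh t)).
  have -> : gauss_expo t x y + cpar t y * x =
      - (((x - r * y) ^+ 2 + (y - r * x) ^+ 2) / (4 * r * s ^+ 2)).
    rewrite /gauss_expo /cpar chE ss.
    have -> : (x - r * y) ^+ 2 + (y - r * x) ^+ 2 =
      (2 * r * s ^+ 2 + 2 * r ^+ 2) * (x ^+ 2 + y ^+ 2) - 4 * r * x * y.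
      by rewrite rE; ring.
    by field; rewrite !gt_eqF.
  have vE : v ^+ 2 = (y - r * x) ^+ 2 / s ^+ 2.
    by rewrite /v expr_div_n real_normK// num_real.
  rewrite vE ss -opprD lerN2.
  set a := x - r * y; set b := y - r * x.
  (* The identity [a - b = (1 + r) (x - y)] with [1 + r >= 1] recovers a Gaussian in [x - y]. *)
  have ab : (x - y) ^+ 2 <= 2 * (a ^+ 2 + b ^+ 2).
    have : (x - y) ^+ 2 <= ((1 + r) * (x - y)) ^+ 2.
      by rewrite exprMn ler_peMl ?sqr_ge0// expr2; nra.
    have -> : (1 + r) * (x - y) = a - b by rewrite /a /b; ring.
    by have := sqr_ge0 (a + b); rewrite !expr2; nra.
  have h0 : 0 <= a ^+ 2 + b ^+ 2 by rewrite addr_ge0 ?sqr_ge0.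
  apply: (@le_trans _ _ ((a ^+ 2 + b ^+ 2) / (4 * s ^+ 2))); last first.
    apply: ler_wpM2l => //; rewrite lef_pV2 ?posrE; try posi.
    by rewrite ler_pM2r ?exprn_gt0//; lra.
  (* Half of [b^2] is reserved for absorbing the power [v^l]; what is left of [a^2 + b^2] still
     dominates [(x - y)^2 / 4]. *)
  have -> : b ^+ 2 / s ^+ 2 / 8 + (x - y) ^+ 2 / (16 * s ^+ 2) =
     (b ^+ 2 / 2 + (x - y) ^+ 2 / 4) / (4 * s ^+ 2).
    by field; rewrite gt_eqF.
  apply: ler_wpM2r; first by nneg.
  by have := sqr_ge0 a; lra.
rewrite uE; clearbody v.
apply: (@le_trans _ _ ((Num.sqrt pi)^-1 * ((Num.sqrt 2)^-1 * s^-1) *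
   (expR (- (v ^+ 2 / 8)) * near_gauss t x y) * (s ^- (2 * i) * (v / s) ^+ l))).
  apply: ler_pM; [by nneg|apply: mulr_ge0| | ].
  - by apply: exprn_ge0; rewrite divr_ge0 ?expR_ge0// ltW.
  - by nneg.
  - by apply: ler_wpM2l; [nneg|rewrite -expRD ler_expR].
  - by apply: ler_wpM2r; [nneg|].
have -> : (Num.sqrt pi)^-1 * ((Num.sqrt 2)^-1 * s^-1) *
   (expR (- (v ^+ 2 / 8)) * near_gauss t x y) * (s ^- (2 * i) * (v / s) ^+ l) =
   (Num.sqrt pi)^-1 * (Num.sqrt 2)^-1 * (v ^+ l * expR (- (v ^+ 2 / 8))) *
   (s ^- (2 * i + l + 1) * near_gauss t x y).
  rewrite !exprD expr1 expr_div_n.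
  move: (expR _) (near_gauss _ _ _) (Num.sqrt pi)^-1 (Num.sqrt 2)^-1 => e1 e2 w1 w2.
  by field; rewrite ?expf_neq0 ?gt_eqF.
apply: ler_wpM2r; first by rewrite /near_gauss; nneg.
by apply: ler_wpM2l; [nneg|exact: H].
Qed.

Lemma near_gauss_ge0 t x y : 0 <= near_gauss t x y.
Proof. exact: expR_ge0. Qed.

Lemma hermite_kernel_ge0 t x y : 0 < t -> 0 <= hermite_kernel t x y.
Proof. by move=> t0; rewrite hermite_kernelE//; nneg. Qed.

Lemma local_pair_hermite_le alpha k f h : local_pair alpha k f h ->
  exists2 C : R, 0 < C & forall t x y, 0 < t -> 0 < x -> 0 < y ->
  `|hermite_kernel t x y * h (qpar t) (cpar t y) x| <=
    C * (Num.sqrt (sinh t) ^- k.+1 * near_gauss t x y).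
Proof.
elim=> [{}k a i l e|{}k a i l j eta e se|
  {}k f1 h1 f2 h2 _ [C1 C10 H1] _ [C2 C20 H2]].
- have [C C0 H] := hermite_weight_le i l.
  exists ((`|a| + 1) * C) => [|t x y t0 x0 y0]; first by rewrite mulr_gt0// ltr_wpDl.
  have q0 : 0 <= qpar t by rewrite divr_ge0 ?expR_ge0// ltW// sinh_gt0.
  have := H t x y t0 x0 y0; have := hermite_kernel_ge0 x y t0.
  move: (hermite_kernel t x y) => w w0 hw.
  rewrite !normrM !normrX (ger0_norm w0) (ger0_norm q0).
  have -> : w * (`|a| * qpar t ^+ i * `|cpar t y - qpar t * x| ^+ l)
    = `|a| * (w * (qpar t ^+ i * `|cpar t y - qpar t * x| ^+ l)) by ring.
  rewrite -[leRHS]mulrA; apply: ler_pM; [by nneg|by nneg|by rewrite lerDl|].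
  by rewrite -e -addn1.
- exists 1 => // t x y t0 x0 y0; rewrite mulr0 normr0 mul1r.
  by rewrite /near_gauss; nneg.
- exists (C1 + C2) => [|t x y t0 x0 y0]; first by rewrite addr_gt0.
  rewrite mulrDr; apply: (le_trans (ler_normD _ _)); rewrite mulrDl.
  by apply: lerD; [exact: H1|exact: H2].
Qed.

(** A main term differs from its Hermite counterpart by the factor [phi - 1], hence the gain
    [1 / z]. A remainder term contains [x ^- j.+1] in place of [s ^- j.+1]; all but one of these
    factors are traded back, hence the gain [s / x]. *)
Lemma local_pair_diff_le alpha k f h : -1 < alpha -> local_pair alpha k f h ->
  exists C Z : R, [/\ 0 < C, 1 <= Z & forall t x y, 0 < t -> 0 < x -> 0 < y ->
    y <= 2 * x -> Z <= cpar t y * x ->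
  `|hermite_kernel t x y * f (qpar t) (cpar t y) x -
    hermite_kernel t x y * h (qpar t) (cpar t y) x| <=
    C * (Num.sqrt (sinh t) ^- k.+1 * near_gauss t x y *
     ((cpar t y * x)^-1 + Num.sqrt (sinh t) / x))].
Proof.
move=> a1; elim=> [{}k a i l e|{}k a i l j eta e se|
  {}k f1 h1 f2 h2 _ [C1 [Z1 [C10 Z11 H1]]] _ [C2 [Z2 [C20 Z21 H2]]]]; last first.
- exists (C1 + C2), (Num.max Z1 Z2); split; first by rewrite addr_gt0.
    by rewrite le_max Z11.
  move=> t x y t0 x0 y0 yx; rewrite ge_max => /andP[hZ1 hZ2].
  have -> (w a b c d : R) : w * (a + b) - w * (c + d) = (w * a - w * c) + (w * b - w * d).
    by ring.
  apply: (le_trans (ler_normD _ _)).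
  by rewrite [leRHS]mulrDl; apply: lerD; [exact: H1|exact: H2].
- have [C C0 H] := hermite_weight_le i l.
  have [D [Z [D0 Z1 HD]]] := symbol_bigOy (se 0%N).
  exists ((`|a| + 1) * C * (2 ^+ j * D)), Z; split => //.
    by apply: mulr_gt0; [rewrite mulr_gt0// ltr_wpDl|posi].
  move=> t x y t0 x0 y0 yx zZ.
  have s0 := sinh_gt0 t0; set s := Num.sqrt (sinh t).
  have sp : 0 < s by rewrite sqrtr_gt0.
  have c0 := cpar_gt0 t0 y0; have z0 : 0 < cpar t y * x by rewrite mulr_gt0.
  have q0 : 0 <= qpar t by rewrite divr_ge0 ?expR_ge0// ltW// sinh_gt0.
  (* From [z >= 1] and [y <= 2 x]: [sinh t <= x y <= 2 x^2]. *)
  have sx : s <= 2 * x.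
    have h1 : sinh t <= 2 * x ^+ 2.
      have : 1 <= cpar t y * x by exact: le_trans zZ.
      rewrite /cpar mulrAC ler_pdivlMr// mul1r => /le_trans; apply.
      by rewrite expr2 mulrA ler_pM2r.
    rewrite -(@ler_pXn2r _ 2) ?nnegrE ?mulr_ge0 ?(ltW sp) ?(ltW x0)//.
    rewrite sqr_sqrtr ?(ltW s0)// exprMn; have := sqr_ge0 x; nra.
  have := H t x y t0 x0 y0; have := hermite_kernel_ge0 x y t0.
  move: (hermite_kernel t x y) => w w0 hw.
  rewrite mulr0 subr0 !normrM !normrX (ger0_norm w0) (ger0_norm q0).
  rewrite normfV normrX (gtr0_norm x0).
  have heta := HD _ zZ; rewrite expr0 divr1 in heta.
  have hs : x ^- j.+1 <= 2 ^+ j * (s ^- j.+1 * (s / x)).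
    have -> : x ^- j.+1 = (x ^- j) * x^-1 by rewrite -exprVn exprSr exprVn.
    have -> : 2 ^+ j * (s ^- j.+1 * (s / x)) = (s / 2) ^- j * x^-1.
      rewrite exprS expr_div_n invf_div; field.
      by rewrite ?expf_neq0 ?gt_eqF.
    apply: ler_wpM2r; first by nneg.
    rewrite lef_pV2 ?posrE; try posi.
    by apply: lerXn2r; rewrite ?nnegrE; [nneg|nneg|lra].
  apply: (@le_trans _ _ (`|a| * (w *
      (qpar t ^+ i * `|cpar t y - qpar t * x| ^+ l)) *
      (2 ^+ j * (s ^- j.+1 * (s / x)) * D))).
    rewrite -!mulrA mulrCA; apply: ler_wpM2l => //.
    apply: ler_wpM2l; first exact: w0.
    apply: ler_wpM2l; first by nneg.
    apply: ler_wpM2l; first by nneg.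
    rewrite !mulrA; apply: ler_pM => //; first by nneg.
    by rewrite -!mulrA.
  apply: (@le_trans _ _ ((`|a| + 1) * (C * (s ^- (2 * i + l + 1) * near_gauss t x y)) *
      (2 ^+ j * (s ^- j.+1 * (s / x)) * D))).
    apply: ler_wpM2r; first by nneg.
    by apply: ler_pM; [nneg|nneg|rewrite lerDl|exact: hw].
  apply: (@le_trans _ _ ((`|a| + 1) * C * (2 ^+ j * D) *
     (s ^- k.+1 * near_gauss t x y * (s / x)))).
    rewrite le_eqVlt; apply/orP; left; apply/eqP.
    have -> : s ^- k.+1 = s ^- (2 * i + l + 1) * s ^- j.+1.
      have -> : k.+1 = (2 * i + l + 1 + j.+1)%N by rewrite -e addn1 addSn.
      by rewrite exprD invfM.
    move: (s ^- (2 * i + l + 1)) (s ^- j.+1) (near_gauss t x y) (s / x) (2 ^+ j).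
    by move=> g1 g2 g3 g4 g5; ring.
  apply: ler_wpM2l; first by nneg.
  apply: ler_wpM2l; first by rewrite /near_gauss; nneg.
  by rewrite lerDr invr_ge0 ltW.
- have [C C0 H] := hermite_weight_le i l.
  have [D [Z [D0 Z1 HD]]] := phi_asymp_gt a1.
  exists ((`|a| + 1) * C * D), Z; split => //.
    by apply: mulr_gt0 => //; rewrite mulr_gt0// ltr_wpDl.
  move=> t x y t0 x0 y0 yx zZ.
  have s0 := sinh_gt0 t0; set s := Num.sqrt (sinh t).
  have sp : 0 < s by rewrite sqrtr_gt0.
  have c0 := cpar_gt0 t0 y0; have z0 : 0 < cpar t y * x by rewrite mulr_gt0.
  have q0 : 0 <= qpar t by rewrite divr_ge0 ?expR_ge0// ltW// sinh_gt0.
  have hphi := HD _ zZ; rewrite expr1 in hphi.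
  have := H t x y t0 x0 y0; have := hermite_kernel_ge0 x y t0.
  move: (hermite_kernel t x y) => w w0 hw.
  have -> : w * (a * qpar t ^+ i * (cpar t y - qpar t * x) ^+ l *
      bessel_phi alpha (cpar t y * x)) -
      w * (a * qpar t ^+ i * (cpar t y - qpar t * x) ^+ l) =
      a * (w * (qpar t ^+ i * (cpar t y - qpar t * x) ^+ l)) *
      (bessel_phi alpha (cpar t y * x) - 1) by ring.
  rewrite !normrM !normrX (ger0_norm w0) (ger0_norm q0).
  apply: (@le_trans _ _ ((`|a| + 1) * (C * (s ^- (2 * i + l + 1) * near_gauss t x y)) *
      (D / (cpar t y * x)))).
    apply: ler_pM; [by nneg|by nneg| |exact: hphi].
    by apply: ler_pM; [nneg|nneg|rewrite lerDl|exact: hw].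
  apply: (@le_trans _ _ ((`|a| + 1) * C * D *
     (s ^- k.+1 * near_gauss t x y * (cpar t y * x)^-1))).
    rewrite le_eqVlt; apply/orP; left; apply/eqP.
    have -> : k.+1 = (2 * i + l + 1)%N by rewrite -e addn1.
    move: (s ^- (2 * i + l + 1)) (near_gauss t x y) (cpar t y * x)^-1.
    by move=> g1 g2 g3; ring.
  apply: ler_wpM2l; first by nneg.
  apply: ler_wpM2l; first by rewrite /near_gauss; nneg.
  by rewrite lerDl divr_ge0 ?ltW.
Qed.

End LocalBounds.

(** * Measurability in t and integrable majorants *)

Section Measurability.
Context {R : realType}.
Implicit Types (alpha t x y z q c s : R) (k i j l : nat).
Notation mu := (@lebesgue_measure R).

Lemma is_derive_cpar t y : 0 < t ->
  is_derive t (1:R) (fun t => cpar t y) (- y * cosh t / sinh t ^+ 2).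
Proof.
move=> t0; eapply isd_eq.
  rewrite /cpar; eapply isdM; first by isd.
  by eapply isdV; [rewrite gt_eqF// sinh_gt0|exact: is_derive_sinh].
by rewrite /=; ring.
Qed.

Lemma derivable_qpar t : 0 < t -> exists d, is_derive t (1:R) qpar d.
Proof.
move=> t0; eexists; rewrite /qpar; eapply isdM; first by isd.
by eapply isdV; [rewrite gt_eqF// sinh_gt0|exact: is_derive_sinh].
Qed.

Lemma laguerre_poly_derivable alpha k F x y t : -1 < alpha -> 0 < t ->
  laguerre_poly alpha k F ->
  exists d, is_derive t (1:R) (fun t => F (qpar t) (cpar t y) x) d.
Proof.
move=> a1 t0; have [dq Dq] := derivable_qpar t0; have Dc := is_derive_cpar y t0.
elim=> [{}k a i p l _|{}k F1 F2 _ [d1 D1] _ [d2 D2]]; last first.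
  by eexists; eapply isdD; [exact: D1|exact: D2].
eexists; eapply isdM.
  eapply isdM; last by eapply isdX; exact: Dq.
  eapply isdM; first by isd.
  by eapply isdX; eapply isdX; exact: Dc.
eapply (isdcomp (f := fun t => (cpar t y * x / 2) ^+ 2)); last first.
  exact/is_derive_bessel/alpha_nat_gt.
by eapply isdX; eapply isdM; [eapply isdM; [exact: Dc|isd]|isd].
Qed.

Lemma derivable_gauss_expo x y t : 0 < t ->
  exists d, is_derive t (1:R) (fun t => gauss_expo t x y) d.
Proof.
move=> t0; eexists; rewrite /gauss_expo; eapply isdN; eapply isdM; first by isd.
eapply isdM; first exact: is_derive_cosh.
by eapply isdV; [rewrite gt_eqF// sinh_gt0|exact: is_derive_sinh].
Qed.

Lemma continuous_sqrt_comp (f : R -> R) t : {for t, continuous f} ->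
  {for t, continuous (fun t => Num.sqrt (f t))}.
Proof. by move=> cf; apply: continuous_comp cf _; exact: sqrt_continuous. Qed.

Lemma derivable_continuous_at (f : R -> R) t : (exists d, is_derive t (1:R) f d) ->
  {for t, continuous f}.
Proof. by move=> [d]; exact: isd_cont. Qed.

Lemma continuous_sqrt_sinhV (a : R) t : 0 < a -> 0 < t ->
  {for t, continuous (fun t => Num.sqrt ((a * sinh t)^-1))}.
Proof.
move=> a0 t0; apply: continuous_sqrt_comp; apply: derivable_continuous_at; eexists.
eapply isdV; first by rewrite gt_eqF// mulr_gt0// sinh_gt0.
by eapply isdM; [isd|exact: is_derive_sinh].
Qed.

Lemma eq_measurable0y (f g : R -> R) : (forall t, 0 < t -> f t = g t) ->
  (forall t, 0 < t -> {for t, continuous g}) -> measurable_fun `](0:R), +oo[ f.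
Proof.
move=> fg cg; apply: (eq_measurable_fun g).
  by move=> t; rewrite inE => /itv0yP t0; rewrite fg.
exact: continuous_measurable0y.
Qed.

Lemma measurable_laguerre_integrand alpha k x y : -1 < alpha -> 0 < x -> 0 < y ->
  measurable_fun `](0:R), +oo[ (fun t => t `^ (k%:R / 2 - 1) *
    iter k (laguerre_D alpha) (fun x' => laguerre_kernel alpha t x' y) x).
Proof.
move=> a1 x0 y0; have [F LF E] := iter_laguerre k a1.
apply: (@eq_measurable0y _ (fun t => Num.sqrt ((1 * sinh t)^-1) *
   (t `^ (k%:R / 2 - 1) * (((cpar t y * x) `^ 2^-1 * (cpar t y * x / 2) `^ alpha) *
  expR (gauss_expo t x y) * F (qpar t) (cpar t y) x)))).
  move=> t t0; rewrite E// /laguerre_pre mul1r.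
  by move: (_ `^ _) (_ `^ _) (_ `^ _) (Num.sqrt _) (expR _) (F _ _ _) => *; ring.
move=> t t0; apply: continuousM; first exact: continuous_sqrt_sinhV.
apply: derivable_continuous_at.
have [d1 D1] := laguerre_poly_derivable x y a1 t0 LF.
have [d2 D2] := derivable_gauss_expo x y t0.
have Dc := is_derive_cpar y t0; have c0 := cpar_gt0 t0 y0.
eexists; eapply isdM; first by isd; exact: t0.
eapply isdM; last exact: D1.
eapply isdM; last by eapply isdexp; exact: D2.
eapply isdM.
  by eapply isdpow; [rewrite mulr_gt0|eapply isdM; [exact: Dc|isd]].
by eapply isdpow; [rewrite divr_gt0// mulr_gt0|
  eapply isdM; [eapply isdM; [exact: Dc|isd]|isd]].
Qed.

Lemma local_pair_derivable alpha k f h x y t : 0 < t -> local_pair alpha k f h ->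
  exists d, is_derive t (1:R) (fun t => h (qpar t) (cpar t y) x) d.
Proof.
move=> t0; have [dq Dq] := derivable_qpar t0; have Dc := is_derive_cpar y t0.
elim=> [{}k a i l _|{}k a i l j eta _ _|{}k f1 h1 f2 h2 _ [d1 D1] _ [d2 D2]].
- eexists; eapply isdM.
    by eapply isdM; [isd|eapply isdX; exact: Dq].
  eapply isdX; eapply isdD; first exact: Dc.
  by eapply isdN; eapply isdM; [exact: Dq|isd].
- by eexists; isd.
- by eexists; eapply isdD; [exact: D1|exact: D2].
Qed.

Lemma measurable_hermite_integrand k x y : 0 < x -> 0 < y ->
  measurable_fun `](0:R), +oo[ (fun t => t `^ (k%:R / 2 - 1) *
    iter k (@hermite_D R) (fun x' => hermite_kernel t x' y) x).
Proof.
(* Only the Hermite formula is taken from the pair; order 0 is an arbitrary choice. *)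
move=> x0 y0; have [f [h [L E]]] := @iter_local R 0 k ltac:(lra).
apply: (@eq_measurable0y _ (fun t => Num.sqrt ((2 * sinh t)^-1) *
   (t `^ (k%:R / 2 - 1) * ((Num.sqrt pi)^-1 *
  expR (gauss_expo t x y + cpar t y * x) * h (qpar t) (cpar t y) x)))).
  move=> t t0; have [_ ->] := E t y x t0 y0 x0; rewrite hermite_kernelE//.
  by move: (_ `^ _) (Num.sqrt _) (Num.sqrt _) (expR _) (h _ _ _) => *; ring.
move=> t t0; apply: continuousM; first exact: continuous_sqrt_sinhV.
apply: derivable_continuous_at.
have [d1 D1] := local_pair_derivable x y t0 L.
have [d2 D2] := derivable_gauss_expo x y t0.
have Dc := is_derive_cpar y t0.
eexists; eapply isdM; first by isd; exact: t0.
eapply isdM; last exact: D1.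
eapply isdM; first by isd.
by eapply isdexp; eapply isdD; [exact: D2|eapply isdM; [exact: Dc|isd]].
Qed.

Definition hdom (g : R -> R) (A : R) := [/\ measurable_fun `](0:R), +oo[ g,
  forall t, 0 < t -> 0 <= g t &
  (\int[mu]_(t in `]0%R, +oo[) (g t)%:E <= A%:E)%E].

Lemma hdom_hump (C p b : R) : 0 <= C -> 0 < p -> 0 < b ->
  hdom (fun t => C * (t^-1 * hump p (sinh t / b))) (C / p).
Proof.
move=> C0 p0 b0; have [m i] := hump_sinh_integral p0 b0.
split; first exact: measurable_funM.
  move=> t t0; apply: mulr_ge0 => //; apply: mulr_ge0; last exact: hump_ge0.
  by rewrite invr_ge0 ltW.
under eq_integral do rewrite EFinM.
rewrite ge0_integralZl//.
- by rewrite EFinM lee_wpmul2l.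
- exact/measurable_EFinP.
- move=> t /itv0yP t0; rewrite lee_fin mulr_ge0 ?hump_ge0//.
  by rewrite invr_ge0 ltW.
Qed.

Lemma hdomD g1 g2 A1 A2 : hdom g1 A1 -> hdom g2 A2 ->
  hdom (fun t => g1 t + g2 t) (A1 + A2).
Proof.
move=> [m1 p1 i1] [m2 p2 i2]; split; first exact: measurable_funD.
  by move=> t t0; rewrite addr_ge0 ?p1 ?p2.
under eq_integral do rewrite EFinD.
rewrite ge0_integralD//.
- by rewrite EFinD leeD.
- by move=> t /itv0yP t0; rewrite lee_fin p1.
- exact/measurable_EFinP.
- by move=> t /itv0yP t0; rewrite lee_fin p2.
- exact/measurable_EFinP.
Qed.

Lemma hdom_integral (f g : R -> R) (A : R) : measurable_fun `](0:R), +oo[ f ->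
  (forall t, 0 < t -> `|f t| <= g t) -> hdom g A ->
  mu.-integrable `](0:R), +oo[ (EFin \o f) /\
  (`| \int[mu]_(t in `]0%R, +oo[) (f t)%:E | <= A%:E)%E.
Proof.
move=> mf fg [mg g0 ig].
have mfE : measurable_fun `](0:R), +oo[ (EFin \o f) by exact/measurable_EFinP.
have le : (\int[mu]_(t in `]0%R, +oo[) `|(EFin \o f) t| <= A%:E)%E.
  apply: le_trans ig; apply: ge0_le_integral => //.
  - by apply: measurableT_comp.
  - exact/measurable_EFinP.
  - by move=> t /itv0yP t0; rewrite /= lee_fin fg.
split; first by apply/integrableP; split=> //; apply: (le_lt_trans le); rewrite ltry.
by apply: le_trans le; exact: le_abse_integral.
Qed.

End Measurability.

(** * Weights, and bounds of the integrands near the diagonal *)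

Section Dominations.
Context {R : realType}.
Implicit Types (alpha t x y z q c s : R) (k i j l : nat).
Notation mu := (@lebesgue_measure R).

Lemma powR_sqr (z p : R) : 0 < z -> (z ^+ 2) `^ p = z `^ (2 * p).
Proof. by move=> z0; rewrite -powR_mulrn ?(ltW z0)// -powRrM. Qed.

(** With scale [x^2] the additional [x^o] is compensated by the larger exponent, so parity leaves no
    trace. *)
Lemma powR_weight_l alpha x y (o : nat) : 0 < x -> 0 < y ->
  (x * y) `^ (alpha + 2^-1) * x ^+ o * (x ^+ 2) `^ (- (alpha + 1 + o%:R / 2)) =
  y `^ (alpha + 1 / 2) / x `^ (alpha + 3 / 2).
Proof.
move=> x0 y0; rewrite (powRM _ (ltW x0) (ltW y0)) (powR_sqr _ x0).
rewrite -(powR_mulrn _ (ltW x0)) div1r -powRN.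
have -> : - (alpha + 3 / 2) = (alpha + 2^-1) + o%:R + 2 * - (alpha + 1 + o%:R / 2).
  by field.
rewrite [x `^ (_ + 2 * _)]powRD ?(gt_eqF x0) ?implybT//.
rewrite [x `^ (_ + o%:R)]powRD ?(gt_eqF x0) ?implybT//; ring.
Qed.

(** With scale [y^2] the compensation is in y instead, which leaves [(x / y)^o], the improvement for
    odd order. *)
Lemma powR_weight_r alpha x y (o : nat) : 0 < x -> 0 < y ->
  (x * y) `^ (alpha + 2^-1) * x ^+ o * (y ^+ 2) `^ (- (alpha + 1 + o%:R / 2)) =
  x `^ (alpha + 2^-1 + o%:R) / y `^ (alpha + 3 / 2 + o%:R).
Proof.
move=> x0 y0; rewrite (powRM _ (ltW x0) (ltW y0)) (powR_sqr _ y0).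
rewrite -(powR_mulrn _ (ltW x0)) -powRN.
have -> : - (alpha + 3 / 2 + o%:R) = (alpha + 2^-1) + 2 * - (alpha + 1 + o%:R / 2).
  by field.
rewrite [y `^ (_ + 2 * _)]powRD ?(gt_eqF y0) ?implybT//.
rewrite [x `^ (_ + o%:R)]powRD ?(gt_eqF x0) ?implybT//; ring.
Qed.

Lemma powR_weight_diag (b : R) : exists2 C : R, 0 < C & forall x y, 0 < x ->
  x / 2 < y -> y < 2 * x -> y `^ b <= C * x `^ b.
Proof.
exists (2 `^ `|b|) => [|x y x0 xy yx]; first by rewrite powR_gt0.
have y0 : 0 < y by lra.
have [b0|b0] := lerP 0 b.
  rewrite (ger0_norm b0) -(powRM _ (ler0n _ 2) (ltW x0)).
  by apply: (ge0_ler_powR b0); rewrite ?nnegrE; [nneg|nneg|exact: ltW].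
rewrite (ltr0_norm b0); have x2 : 0 < x / 2 by rewrite divr_gt0.
have -> : 2 `^ (- b) * x `^ b = (x / 2) `^ b.
  have -> : x `^ b = (x / 2) `^ b * 2 `^ b.
    by rewrite -(powRM _ (ltW x2) (ler0n _ 2)) divfK// pnatr_eq0.
  by rewrite powRN mulrCA mulVf ?mulr1// gt_eqF// powR_gt0.
have nb : 0 <= - b by lra.
have h : (x / 2) `^ (- b) <= y `^ (- b).
  by apply: (ge0_ler_powR nb); rewrite ?nnegrE; [exact: ltW|exact: ltW|exact: ltW].
by move: h; rewrite !powRN lef_pV2 ?posrE ?powR_gt0.
Qed.

Lemma sqrt_gauss_le_hump (e : R) : 0 < e -> exists2 C : R, 0 < C & forall S d, 0 < S -> 0 < d ->
  (Num.sqrt S)^-1 * expR (- (e * d ^+ 2 / S)) <= C * (d^-1 * hump 2^-1 (S / d ^+ 2)).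
Proof.
move=> e0; have [C C0 H] := @powRN_expR_le_hump R 2^-1 e ltac:(lra) e0.
exists C => // S d S0 d0; have v0 : 0 < S / d ^+ 2 by rewrite divr_gt0// exprn_gt0.
have -> : (Num.sqrt S)^-1 * expR (- (e * d ^+ 2 / S)) =
   d^-1 * ((S / d ^+ 2) `^ (- 2^-1) * expR (- (e / (S / d ^+ 2)))).
  rewrite powRN powR12_sqrt ?(ltW v0)// sqrtrM ?(ltW S0)//.
  rewrite sqrtrV ?exprn_ge0 ?(ltW d0)// sqrtr_sqr (gtr0_norm d0).
  have -> : e / (S / d ^+ 2) = e * d ^+ 2 / S by field; rewrite !gt_eqF.
  by field; rewrite !gt_eqF// sqrtr_gt0.
by rewrite [leRHS]mulrCA ler_pM2l ?invr_gt0// H.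
Qed.

(** Used at [w = (x - y)^2 / sinh t]: the exponent 1/4 produces the power 1/2 of [1 / |x - y|] and
    leaves [(sinh t)^(1/4)], enough for integrability against [dt / t] at 0. *)
Lemma gauss_le_powR : exists2 C : R, 0 < C & forall w : R, 0 < w ->
  expR (- (w / 16)) <= C * w `^ (- 4^-1).
Proof.
have [C C0 H] := @powR_le_expR R 4^-1 16^-1 ltac:(lra) ltac:(lra).
exists C => // w w0; rewrite powRN ler_pdivlMr ?powR_gt0//.
have -> : expR (- (w / 16)) = (expR (16^-1 * w))^-1 by rewrite expRN mulrC.
by rewrite mulrC ler_pdivrMr ?expR_gt0// H.
Qed.

Lemma integrand_bound t k (v : R) : 0 < t ->
  `|t `^ (k%:R / 2 - 1) * v| <= t^-1 * Num.sqrt (sinh t) ^+ k * `|v|.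
Proof.
move=> t0; rewrite normrM ger0_norm ?powR_ge0// ler_wpM2r// powR_sinh_le//.
Qed.

(** After cancelling [s^k] a factor [1 / s] remains. For the difference the gain [1 / z + s / x]
    with [z = x y / s^2] turns it into [s / (x y)] and [1 / x]; the Gaussian is kept only in the
    second term, which has no decay at 0 otherwise. *)
Lemma local_integrand_le alpha k : -1 < alpha ->
  exists C Z : R, [/\ 0 < C, 1 <= Z & forall t x y, 0 < t -> 0 < x -> 0 < y ->
  let L := t `^ (k%:R / 2 - 1) *
    iter k (laguerre_D alpha) (fun x' => laguerre_kernel alpha t x' y) x in
  let H := t `^ (k%:R / 2 - 1) *
    iter k (@hermite_D R) (fun x' => hermite_kernel t x' y) x in
  let s := Num.sqrt (sinh t) in
  `|H| <= C * (t^-1 * (s^-1 * near_gauss t x y)) /\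
  (y <= 2 * x -> Z <= cpar t y * x ->
   `|L - H| <= C * (t^-1 * (s / (x * y) + near_gauss t x y / x)))].
Proof.
move=> a1; have [f [h [LP E]]] := iter_local k a1.
have [C1 C10 H1] := local_pair_hermite_le LP.
have [C2 [Z [C20 Z1 H2]]] := local_pair_diff_le a1 LP.
exists (C1 + C2), Z; split => //; first by rewrite addr_gt0.
move=> t x y t0 x0 y0; have [-> ->] := E t y x t0 y0 x0.
have s0 := sinh_gt0 t0; set s := Num.sqrt (sinh t).
have sp : 0 < s by rewrite sqrtr_gt0.
have ss : s ^+ 2 = sinh t by rewrite sqr_sqrtr// ltW.
have G0 := near_gauss_ge0 t x y.
have G1 : near_gauss t x y <= 1.
  rewrite /near_gauss -expR0 ler_expR lerNl oppr0 divr_ge0 ?sqr_ge0//.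
  by rewrite mulr_ge0// ltW.
have {}H1 := H1 t x y t0 x0 y0; have {}H2 := H2 t x y t0 x0 y0.
rewrite -/s in H1 H2.
split.
  apply: (le_trans (integrand_bound _ _ t0)).
  apply: (@le_trans _ _ (t^-1 * s ^+ k * (C1 * (s ^- k.+1 * near_gauss t x y)))).
    by apply: ler_wpM2l H1; nneg.
  have -> : t^-1 * s ^+ k * (C1 * (s ^- k.+1 * near_gauss t x y)) =
     C1 * (t^-1 * (s^-1 * near_gauss t x y)).
    rewrite exprS; move: (near_gauss _ _ _) => g.
    by field; rewrite ?expf_neq0 ?gt_eqF.
  apply: ler_wpM2r; first by nneg.
  by rewrite lerDl ltW.
move=> yx zZ; rewrite -mulrBr.
apply: (le_trans (integrand_bound _ _ t0)).
apply: (@le_trans _ _ (t^-1 * s ^+ k * (C2 * (s ^- k.+1 * near_gauss t x y *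
     ((cpar t y * x)^-1 + s / x))))).
  by apply: ler_wpM2l (H2 yx zZ); nneg.
have -> : t^-1 * s ^+ k * (C2 * (s ^- k.+1 * near_gauss t x y *
     ((cpar t y * x)^-1 + s / x))) =
   C2 * (t^-1 * (s / (x * y) * near_gauss t x y + near_gauss t x y / x)).
  rewrite /cpar -ss exprS; move: (near_gauss _ _ _) => g.
  by field; rewrite ?expf_neq0 ?gt_eqF.
apply: ler_pM; first exact: ltW.
- by nneg.
- by rewrite lerDr ltW.
apply: ler_wpM2l; first by nneg.
rewrite lerD2r ler_piMr//; by nneg.
Qed.

End Dominations.

(** * Integration of the majorants *)

Section Final.
Context {R : realType}.
Implicit Types (alpha t x y z q c s : R) (k i j l : nat).
Notation mu := (@lebesgue_measure R).

Definition laguerre_integrand alpha k x y t : R := t `^ (k%:R / 2 - 1) *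
  iter k (laguerre_D alpha) (fun x' => laguerre_kernel alpha t x' y) x.

Definition hermite_integrand k x y t : R := t `^ (k%:R / 2 - 1) *
  iter k (@hermite_D R) (fun x' => hermite_kernel t x' y) x.

(** Provides integrability for fixed [x <> y], needed to split the integral of the difference; the
    majorant has integral of order [1 / |x - y|]. *)
Lemma hermite_domination k x y : 0 < x -> 0 < y -> y <> x ->
  exists g A, hdom g A /\ forall t, 0 < t -> `|hermite_integrand k x y t| <= g t.
Proof.
move=> x0 y0 yx; have [C [Z [C0 _ H]]] := @local_integrand_le R 0 k ltac:(lra).
have [D D0 HD] := @sqrt_gauss_le_hump R 16^-1 ltac:(lra).
pose d := `|x - y|.
have d0 : 0 < d by rewrite normr_gt0 subr_eq0; apply/eqP => e; exact: yx.
exists (fun t => (C * D / d) * (t^-1 * hump 2^-1 (sinh t / d ^+ 2))).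
exists ((C * D / d) / 2^-1); split; first by apply: hdom_hump; [nneg|lra|posi].
move=> t t0; have s0 := sinh_gt0 t0; have [{}H _] := H t x y t0 x0 y0.
apply: (le_trans H).
apply: (@le_trans _ _ (C * (t^-1 * (D * (d^-1 * hump 2^-1 (sinh t / d ^+ 2)))))).
  apply: ler_wpM2l; first exact: ltW.
  apply: ler_wpM2l; first by nneg.
  have := HD _ _ s0 d0; rewrite /near_gauss.
  have -> : 16^-1 * d ^+ 2 / sinh t = (x - y) ^+ 2 / (16 * sinh t).
    by rewrite /d real_normK ?num_real//; field; rewrite gt_eqF.
  by [].
by rewrite le_eqVlt; apply/orP; left; apply/eqP; ring.
Qed.

(** Argument at least 1 means [sinh t <= x y], the range where a power is bounded by its hump. The
    constant 8 is 4 from that bound times 2 from [x / 2 <= sqrt (x y)]. *)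
Lemma sqrt_sinh_le_hump t x y : 0 < t -> 0 < x -> x / 2 < y -> 1 <= cpar t y * x ->
  Num.sqrt (sinh t) / (x * y) <= 8 / x * hump 2^-1 (sinh t / (x * y)).
Proof.
move=> t0 x0 xy z1; have y0 : 0 < y by lra.
have s0 := sinh_gt0 t0; have xy0 : 0 < x * y by rewrite mulr_gt0.
have Sxy : sinh t <= x * y.
  by move: z1; rewrite /cpar mulrAC ler_pdivlMr// mul1r mulrC.
have v01 : 0 < sinh t / (x * y) <= 1.
  by rewrite divr_gt0//= ler_pdivrMr// mul1r.
have := @powR_le_hump R 2^-1 _ ltac:(lra) v01.
set b := hump _ _; have b0 : 0 <= b by exact: hump_ge0.
case/andP: v01 => v0 _; rewrite powR12_sqrt ?(ltW v0)// => h.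
pose q := Num.sqrt (x * y); have q0 : 0 < q by rewrite sqrtr_gt0.
have qq : q ^+ 2 = x * y by rewrite sqr_sqrtr// ltW.
have qx : x / 2 <= q.
  rewrite -(@ler_pXn2r _ 2) ?nnegrE ?(ltW q0) ?divr_ge0 ?(ltW x0)//.
  by rewrite qq !expr2; nra.
have -> : Num.sqrt (sinh t) / (x * y) = Num.sqrt (sinh t / (x * y)) / q.
  have -> : Num.sqrt (sinh t / (x * y)) = Num.sqrt (sinh t) / q.
    by rewrite /q -sqrtrV ?(ltW xy0)// -sqrtrM ?(ltW s0).
  rewrite -qq; move: (Num.sqrt (sinh t)) => w; clearbody q; field.
  by rewrite gt_eqF.
apply: (@le_trans _ _ (4 * b / (x / 2))).
  apply: ler_pM => //; rewrite ?sqrtr_ge0 ?invr_ge0 ?(ltW q0)//.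
  by rewrite lef_pV2 ?posrE// divr_gt0.
by rewrite le_eqVlt; apply/orP; left; apply/eqP; field; rewrite gt_eqF.
Qed.

(** The scale is [2 x^2] because [sinh t <= x y <= 2 x^2] in this range. *)
Lemma near_gauss_le_hump : exists2 C : R, 0 < C & forall t x y,
  0 < t -> 0 < x -> 0 < y -> y < 2 * x -> y <> x -> 1 <= cpar t y * x ->
  near_gauss t x y <=
    C * ((x / `|x - y|) `^ 2^-1 * hump 4^-1 (sinh t / (2 * x ^+ 2))).
Proof.
have [C C0 H] := @gauss_le_powR R; exists (C * (2 `^ 4^-1 * 4)); first by posi.
move=> t x y t0 x0 y0 yx nyx z1; have s0 := sinh_gt0 t0.
pose d := `|x - y|.
have d0 : 0 < d by rewrite normr_gt0 subr_eq0; apply/eqP => e; exact: nyx.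
have X0 : 0 < 2 * x ^+ 2 by posi.
have v01 : 0 < sinh t / (2 * x ^+ 2) <= 1.
  rewrite divr_gt0//= ler_pdivrMr// mul1r.
  have : sinh t <= y * x by move: z1; rewrite /cpar mulrAC ler_pdivlMr// mul1r.
  by move=> /le_trans; apply; rewrite expr2 mulrA ler_pM2r// ltW.
have h := @powR_le_hump R 4^-1 _ ltac:(lra) v01.
case/andP: v01 => v0 _.
have w0 : 0 < d ^+ 2 / sinh t by rewrite divr_gt0// exprn_gt0.
have := H _ w0.
have -> : expR (- (d ^+ 2 / sinh t / 16)) = near_gauss t x y.
  rewrite /near_gauss /d real_normK ?num_real//; congr (expR (- _)).
  by field; rewrite gt_eqF.
have -> : (d ^+ 2 / sinh t) `^ (- 4^-1) =
    2 `^ 4^-1 * ((x / d) `^ 2^-1 * (sinh t / (2 * x ^+ 2)) `^ 4^-1).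
  have -> : (x / d) `^ 2^-1 = ((x / d) ^+ 2) `^ 4^-1.
    by rewrite powR_sqr ?divr_gt0//; congr (_ `^ _); field.
  have i1 : 0 <= (x / d) ^+ 2 by nneg.
  rewrite -(powRM _ i1 (ltW v0)) -(powRM _ (ler0n _ 2) (mulr_ge0 i1 (ltW v0))).
  rewrite -mulN1r powRrM (powR_inv1 (ltW w0)).
  by congr (_ `^ _); field; rewrite !gt_eqF.
move=> /le_trans; apply.
have -> : C * (2 `^ 4^-1 * 4) * ((x / d) `^ 2^-1 * hump 4^-1 (sinh t / (2 * x ^+ 2))) =
    C * (2 `^ 4^-1 * ((x / d) `^ 2^-1 * (4 * hump 4^-1 (sinh t / (2 * x ^+ 2))))).
  by move: (hump _ _) (_ `^ _) (_ `^ _) => *; ring.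
apply: ler_wpM2l; first exact: ltW.
by apply: ler_wpM2l; [nneg|apply: ler_wpM2l; [nneg|exact: h]].
Qed.

(** [g1] and [g2] bound the difference where the argument of the Bessel function is at least Z; [g3]
    and [g4] bound the two integrands separately elsewhere. Their sum is one majorant for all t.
    Only [g2] carries the singular factor. *)
Lemma local_domination alpha k : -1 < alpha -> exists2 K : R, 0 < K &
  forall x y, 0 < x -> x / 2 < y -> y < 2 * x -> y <> x ->
  exists g A, [/\ hdom g A, A <= K * (x^-1 * (1 + (x / `|x - y|) `^ (1 / 2))) &
    forall t, 0 < t ->
      `|laguerre_integrand alpha k x y t - hermite_integrand k x y t| <= g t].
Proof.
move=> a1; have [C [Z [C0 Z1 H]]] := local_integrand_le k a1.
pose p : R := alpha + 1 + (odd k)%:R / 2.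
have p0 : 0 < p by rewrite /p; case: (odd k); rewrite /= ?mul0r ?mul1r; lra.
have [CN CN0 HN] := laguerre_integrand_le k Z a1; rewrite /= -/p in HN.
have [CW CW0 HW] := @powR_weight_diag R (alpha + 1 / 2).
have [D D0 HD] := @sqrt_gauss_le_hump R 16^-1 ltac:(lra).
have [E E0 HE] := near_gauss_le_hump.
pose Kd := C * (expR (Z / 8) * D).
have Kd0 : 0 < Kd by rewrite /Kd; posi.
exists (C * 8 / 2^-1 + C * E / 4^-1 + CN * CW / p + Kd / 2^-1).
  by rewrite !addr_gt0// divr_gt0//; try posi; lra.
move=> x y x0 xy yx nyx; have y0 : 0 < y by lra.
set q := (x / `|x - y|) `^ (1 / 2).
have q0 : 0 <= q by exact: powR_ge0.
pose g1 t := C * 8 / x * (t^-1 * hump 2^-1 (sinh t / (x * y))).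
pose g2 t := C * E * q / x * (t^-1 * hump 4^-1 (sinh t / (2 * x ^+ 2))).
pose g3 t := CN * CW / x * (t^-1 * hump p (sinh t / x ^+ 2)).
pose g4 t := Kd / x * (t^-1 * hump 2^-1 (sinh t / x ^+ 2)).
exists (fun t => g1 t + g2 t + g3 t + g4 t).
exists (C * 8 / x / 2^-1 + C * E * q / x / 4^-1 + CN * CW / x / p + Kd / x / 2^-1).
have h1 : hdom g1 (C * 8 / x / 2^-1) by apply: hdom_hump; [nneg|lra|posi].
have h2 : hdom g2 (C * E * q / x / 4^-1) by apply: hdom_hump; [nneg|lra|posi].
have h3 : hdom g3 (CN * CW / x / p) by apply: hdom_hump; [nneg|done|posi].
have h4 : hdom g4 (Kd / x / 2^-1) by apply: hdom_hump; [nneg|lra|posi].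
split; first exact: (hdomD (hdomD (hdomD h1 h2) h3) h4).
  have e1 : 0 <= C * 8 / x / 2^-1 by nneg.
  have e2 : 0 <= C * E / x / 4^-1 by nneg.
  have e3 : 0 <= CN * CW / x / p by nneg.
  have e4 : 0 <= Kd / x / 2^-1 by nneg.
  rewrite -subr_ge0.
  have -> : (C * 8 / 2^-1 + C * E / 4^-1 + CN * CW / p + Kd / 2^-1) *
      (x^-1 * (1 + q)) - (C * 8 / x / 2^-1 + C * E * q / x / 4^-1 +
      CN * CW / x / p + Kd / x / 2^-1) =
    C * 8 / x / 2^-1 * q + C * E / x / 4^-1 + CN * CW / x / p * q + Kd / x / 2^-1 * q.
    by field; rewrite !gt_eqF.
  by nneg.
move=> t t0; have s0 := sinh_gt0 t0; have c0 := cpar_gt0 t0 y0.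
have g10 : 0 <= g1 t by have [_ + _] := h1; apply.
have g20 : 0 <= g2 t by have [_ + _] := h2; apply.
have g30 : 0 <= g3 t by have [_ + _] := h3; apply.
have g40 : 0 <= g4 t by have [_ + _] := h4; apply.
have [Hh Hd] := H t x y t0 x0 y0.
rewrite -/(hermite_integrand k x y t) in Hh Hd.
rewrite -/(laguerre_integrand alpha k x y t) in Hd.
have [zZ|zZ] := lerP Z (cpar t y * x).
  apply: (@le_trans _ _ (g1 t + g2 t)); last by lra.
  apply: (le_trans (Hd (ltW yx) zZ)).
  have z1 : 1 <= cpar t y * x by exact: le_trans zZ.
  have b1 := sqrt_sinh_le_hump t0 x0 xy z1.
  have b2 := HE t x y t0 x0 y0 yx nyx z1.
  have b2' : near_gauss t x y / x <=
      E * (q * hump 4^-1 (sinh t / (2 * x ^+ 2))) / x.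
    by rewrite ler_wpM2r ?invr_ge0 ?(ltW x0)// /q div1r.
  apply: (@le_trans _ _ (C * (t^-1 * (8 / x * hump 2^-1 (sinh t / (x * y)) +
      E * (q * hump 4^-1 (sinh t / (2 * x ^+ 2))) / x)))).
    apply: ler_wpM2l; first exact: ltW.
    by apply: ler_wpM2l; [nneg|exact: lerD].
  rewrite le_eqVlt; apply/orP; left; apply/eqP; rewrite /g1 /g2.
  move: (hump _ _) (hump _ _) => u v; ring.
apply: (@le_trans _ _ (g3 t + g4 t)); last by lra.
apply: (le_trans (ler_normB _ _)); apply: lerD.
  have x20 : 0 < x ^+ 2 by rewrite exprn_gt0.
  have := HN t x y (x ^+ 2) t0 x0 y0 x20.
  rewrite lerDl sqr_ge0 => /(_ isT (Or33 _ _ (ltW zZ))) hN.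
  apply: (le_trans hN).
  rewrite (powR_weight_l alpha (odd k) x0 y0).
  have hW := HW x y x0 xy yx.
  apply: (@le_trans _ _ (CN * (CW * x `^ (alpha + 1 / 2) / x `^ (alpha + 3 / 2)) *
      (t^-1 * hump p (sinh t / x ^+ 2)))).
    apply: ler_wpM2r; first by apply: mulr_ge0; [nneg|exact: hump_ge0].
    apply: ler_wpM2l; first exact: ltW.
    by apply: ler_wpM2r => //; nneg.
  have -> : x `^ (alpha + 3 / 2) = x `^ (alpha + 1 / 2) * x.
    by rewrite -(powRS _ x0); congr (_ `^ _); field.
  rewrite le_eqVlt; apply/orP; left; apply/eqP; rewrite /g3.
  move: (hump _ _) => u; field.
  by rewrite ?gt_eqF ?powR_gt0.
apply: (le_trans Hh).
(* Expanding the square, the cross term is one eighth of the Bessel argument, hence at most [Z / 8];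
   so a Gaussian in x alone survives up to the diagonal. *)
have hG : near_gauss t x y <= expR (Z / 8) * expR (- (16^-1 * x ^+ 2 / sinh t)).
  rewrite /near_gauss -expRD ler_expR.
  have zE : cpar t y * x = x * y / sinh t by rewrite /cpar; ring.
  rewrite zE in zZ.
  have -> : - ((x - y) ^+ 2 / (16 * sinh t)) =
     x * y / sinh t / 8 + - (16^-1 * x ^+ 2 / sinh t) - y ^+ 2 / (16 * sinh t).
    by field; rewrite gt_eqF.
  have : 0 <= y ^+ 2 / (16 * sinh t) by nneg.
  by move: zZ; move: (x * y / sinh t) (_ / (16 * _)) (16^-1 * _ / _) => u v w; lra.
apply: (@le_trans _ _ (C * (t^-1 * (expR (Z / 8) * (D * (x^-1 * hump 2^-1 (sinh t / x ^+ 2))))))).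
  apply: ler_wpM2l; first exact: ltW.
  apply: ler_wpM2l; first by nneg.
  apply: (@le_trans _ _ ((Num.sqrt (sinh t))^-1 * (expR (Z / 8) * expR (- (16^-1 * x ^+ 2 / sinh t))))).
    by apply: ler_wpM2l; [nneg|].
  by rewrite mulrCA; apply: ler_wpM2l; [nneg|exact: HD].
rewrite le_eqVlt; apply/orP; left; apply/eqP; rewrite /g4 /Kd.
move: (hump _ _) => u; ring.
Qed.

Lemma nonlocal_riesz_le alpha k : -1 < alpha -> (1 <= k)%N ->
  exists2 C : R, 0 < C & forall x y b, 0 < x -> 0 < y -> 0 < b ->
  b <= x ^+ 2 + y ^+ 2 -> 2 * x <= y \/ 2 * y <= x ->
  (`|laguerre_riesz alpha k x y| <= (C * ((x * y) `^ (alpha + 2^-1) * x ^+ odd k *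
     b `^ (- (alpha + 1 + (odd k)%:R / 2))))%:E)%E.
Proof.
move=> a1 k1; pose p : R := alpha + 1 + (odd k)%:R / 2.
have p0 : 0 < p by rewrite /p; case: (odd k); rewrite /= ?mul0r ?mul1r; lra.
(* With [Z = 0] the third regime is empty, as the Bessel argument is positive. *)
have [C C0 H] := laguerre_integrand_le k 0 a1; rewrite /= -/p in H.
have G0 : 0 < Gamma (k%:R / 2) :> R by rewrite Gamma_gt0// divr_gt0// ltr0n.
exists ((Gamma (k%:R / 2))^-1 * (C / p)); first by rewrite mulr_gt0 ?invr_gt0 ?divr_gt0.
move=> x y b x0 y0 b0 bW reg.
set W := (x * y) `^ _ * _ * _.
have W0 : 0 <= W by rewrite /W; nneg.
have hd := @hdom_hump R (C * W) p b (mulr_ge0 (ltW C0) W0) p0 b0.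
have reg' t : [\/ 2 * x <= y, 2 * y <= x | cpar t y * x <= 0].
  by case: reg => h; [apply: Or31|apply: Or32].
have hH t : 0 < t -> `|laguerre_integrand alpha k x y t| <=
    C * W * (t^-1 * hump p (sinh t / b)).
  by move=> t0; apply: (H t x y b t0 x0 y0 b0 bW (reg' t)).
have [_ le] := hdom_integral (measurable_laguerre_integrand k a1 x0 y0) hH hd.
rewrite /laguerre_riesz abseM.
have -> : (`|((Gamma (k%:R / 2))^-1)%:E| = ((Gamma (k%:R / 2))^-1 : R)%:E)%E.
  by rewrite /= ger0_norm// invr_ge0 ltW.
have -> : (Gamma (k%:R / 2))^-1 * (C / p) * W = (Gamma (k%:R / 2))^-1 * (C * W / p) by ring.
rewrite EFinM; apply: lee_wpmul2l le.
by rewrite lee_fin invr_ge0 ltW.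
Qed.

Lemma fin_num_muleBr (c : R) (u v : \bar R) : u \is a fin_num -> v \is a fin_num ->
  (c%:E * u - c%:E * v = c%:E * (u - v))%E.
Proof.
move: u v => [u||] [v||]// _ _.
exact: (congr1 (@EFin R) (esym (mulrBr c u v))).
Qed.

Lemma local_riesz_le alpha k : -1 < alpha -> (1 <= k)%N ->
  exists2 C : R, 0 < C & forall x y, 0 < x -> x / 2 < y -> y < 2 * x -> y <> x ->
  (`|laguerre_riesz alpha k x y - hermite_riesz k x y|
     <= (C * (x^-1 * (1 + (x / `|x - y|) `^ (1 / 2))))%:E)%E.
Proof.
move=> a1 k1; have [K K0 H] := local_domination k a1.
have G0 : 0 < Gamma (k%:R / 2) :> R by rewrite Gamma_gt0// divr_gt0// ltr0n.
exists ((Gamma (k%:R / 2))^-1 * K); first by rewrite mulr_gt0 ?invr_gt0.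
move=> x y x0 xy yx nyx; have y0 : 0 < y by lra.
have [g [A [gA AK Hg]]] := H x y x0 xy yx nyx.
have [g' [A' [gA' Hg']]] := hermite_domination k x0 y0 nyx.
have mL := measurable_laguerre_integrand k a1 x0 y0.
have mH := measurable_hermite_integrand k x0 y0.
have [iH _] := hdom_integral mH Hg' gA'.
have [iD le] := hdom_integral (measurable_funB mL mH) Hg gA.
(* Near the diagonal the Laguerre integrand is integrable as the sum of the difference and the
   Hermite integrand. *)
have iL : mu.-integrable `](0:R), +oo[ (EFin \o laguerre_integrand alpha k x y).
  apply: eq_integrable (integrableD _ iD iH) => //.
  by move=> t _; rewrite /= -EFinD subrK.
rewrite /laguerre_riesz /hermite_riesz.
have -> : ((((Gamma (k%:R / 2))^-1)%:E *
   \int[lebesgue_measure]_(t in `]0%R, +oo[) (laguerre_integrand alpha k x y t)%:E) -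
  (((Gamma (k%:R / 2))^-1)%:E *
   \int[lebesgue_measure]_(t in `]0%R, +oo[) (hermite_integrand k x y t)%:E) =
  ((Gamma (k%:R / 2))^-1)%:E * \int[lebesgue_measure]_(t in `]0%R, +oo[)
    (laguerre_integrand alpha k x y t - hermite_integrand k x y t)%:E)%E.
  have e : (\int[lebesgue_measure]_(t in `]0%R, +oo[)
      (laguerre_integrand alpha k x y t - hermite_integrand k x y t)%:E =
      \int[lebesgue_measure]_(t in `]0%R, +oo[) (laguerre_integrand alpha k x y t)%:E -
      \int[lebesgue_measure]_(t in `]0%R, +oo[) (hermite_integrand k x y t)%:E)%E.
    by under eq_integral do rewrite EFinB; exact: integralB_EFin.
  rewrite e.
  have fL : (\int[lebesgue_measure]_(t in `]0%R, +oo[)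
      (laguerre_integrand alpha k x y t)%:E)%E \is a fin_num.
    exact: (integrable_fin_num _ iL).
  have fH : (\int[lebesgue_measure]_(t in `]0%R, +oo[)
      (hermite_integrand k x y t)%:E)%E \is a fin_num.
    exact: (integrable_fin_num _ iH).
  exact: (fin_num_muleBr _ fL fH).
rewrite abseM.
have -> : (`|((Gamma (k%:R / 2))^-1)%:E| = ((Gamma (k%:R / 2))^-1 : R)%:E)%E.
  by rewrite /= ger0_norm// invr_ge0 ltW.
rewrite -mulrA EFinM; apply: lee_wpmul2l.
  by rewrite lee_fin invr_ge0 ltW.
by apply: (le_trans le); rewrite lee_fin.
Qed.

End Final.

Theorem proposition3p11 (R : realType) (alpha : R) (k : nat)
    (halpha : -1 < alpha) (hk : (1 <= k)%N) :
  exists2 C : R, 0 < C &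
    [/\ forall x y : R, 0 < y -> y < x / 2 ->
          (`|laguerre_riesz alpha k x y|
           <= (C * (y `^ (alpha + 1 / 2) / x `^ (alpha + 3 / 2)))%:E)%E,
        forall x y : R, 0 < x -> 2 * x < y ->
          (~~ odd k ->
            (`|laguerre_riesz alpha k x y|
             <= (C * (x `^ (alpha + 1 / 2) / y `^ (alpha + 3 / 2)))%:E)%E) /\
          (odd k ->
            (`|laguerre_riesz alpha k x y|
             <= (C * (x `^ (alpha + 3 / 2) / y `^ (alpha + 5 / 2)))%:E)%E)
      & forall x y : R, 0 < x -> x / 2 < y -> y < 2 * x -> y <> x ->
          (`|laguerre_riesz alpha k x y - hermite_riesz k x y|
           <= (C * (x^-1 * (1 + (x / `|x - y|) `^ (1 / 2))))%:E)%E ].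
Proof.
have [C1 C10 H1] := nonlocal_riesz_le halpha hk.
have [C2 C20 H2] := local_riesz_le halpha hk.
exists (C1 + C2); first by rewrite addr_gt0.
split.
(* The larger variable sets the scale: [b = x^2] here, [b = y^2] in the next case. *)
- move=> x y y0 yx; have x0 : 0 < x by lra.
  have x20 : 0 < x ^+ 2 by rewrite exprn_gt0.
  have xW : x ^+ 2 <= x ^+ 2 + y ^+ 2 by rewrite lerDl sqr_ge0.
  have reg : 2 * x <= y \/ 2 * y <= x by right; lra.
  have := H1 x y (x ^+ 2) x0 y0 x20 xW reg; rewrite (powR_weight_l _ _ x0 y0).
  move=> /le_trans; apply; rewrite lee_fin.
  by apply: ler_wpM2r; [nneg|rewrite lerDl ltW].
- move=> x y x0 xy; have y0 : 0 < y by lra.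
  have y20 : 0 < y ^+ 2 by rewrite exprn_gt0.
  have yW : y ^+ 2 <= x ^+ 2 + y ^+ 2 by rewrite lerDr sqr_ge0.
  have reg : 2 * x <= y \/ 2 * y <= x by left; exact: ltW.
  have := H1 x y (y ^+ 2) x0 y0 y20 yW reg; rewrite (powR_weight_r _ _ x0 y0).
  move=> h; split=> ok; apply: (le_trans h); rewrite lee_fin.
    rewrite (negbTE ok) !addr0 div1r.
    by apply: ler_wpM2r; [nneg|rewrite lerDl ltW].
  rewrite ok; have -> : alpha + 2^-1 + 1%:R = alpha + 3 / 2 by field.
  have -> : alpha + 3 / 2 + 1%:R = alpha + 5 / 2 by field.
  by apply: ler_wpM2r; [nneg|rewrite lerDl ltW].
- move=> x y x0 xy yx nyx; apply: (le_trans (H2 x y x0 xy yx nyx)).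
  rewrite lee_fin; apply: ler_wpM2r; last by rewrite lerDr ltW.
  by nneg.
Qed.
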